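(* Let $\mathbb F\in\{\mathbb R,\mathbb C\}$. For integers $n,m\geq3$, the probability $p_{n,m}^{\mathbb F}$ that a random positive map $\Phi:M_n(\mathbb F)\to M_m(\mathbb F)$ is completely positive is bounded above by $$p_{n,m}^{\mathbb F}<\left(\frac{C}{\min(n,m)-\frac12}\right)^{\frac{D_{\mathcal M_{\mathcal C_{\mathbb F}}}}{2}},$$ where $$C:=\frac{2^{28-\dim_{\mathbb R}\mathbb F}\cdot5^4\cdot10^{\frac49}}{3^5}\qquad\text{and}\qquad D_{\mathcal M_{\mathcal C_{\mathbb F}}}=\begin{cases}n^2m^2-1,&\text{if }\mathbb F=\mathbb C,\\ \frac{nm(nm+1)}{2}-1,&\text{if }\mathbb F=\mathbb R.\end{cases}$$
   Context: Let $\mathtt z=(z_1,\dots,z_n)$, $\mathtt w=(w_1,\dots,w_m)$ be complex variables. Let $$\operatorname{Sym}\mathbb F[\mathtt z,\overline{\mathtt z},\mathtt w,\overline{\mathtt w}]_{1,1,1,1}=\Bigl\{\textstyle\sum_{i,j=1}^n\sum_{k,\ell=1}^m a_{ijk\ell}\,\overline{z_i}z_j\overline{w_k}w_\ell: a_{ijk\ell}\in\mathbb F,\ a_{ijk\ell}=\overline{a_{ji\ell k}}\Bigr\},$$ and let $\mathbb F[\mathtt z,\mathtt w]_{1,1}$ be the polynomials $\sum_{j,k}a_{jk}z_jw_k$ with $a_{jk}\in\mathbb F$. Define inside $\operatorname{Sym}\mathbb F[\mathtt z,\overline{\mathtt z},\mathtt w,\overline{\mathtt w}]_{1,1,1,1}$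 the cones: $\operatorname{Pos}_{\mathbb F}$, those $f$ with $f(z,w)\ge0$ for all $(z,w)\in\mathbb C^n\times\mathbb C^m$; $\operatorname{Sos}_{\mathbb F}$, the finite sums $\sum_r f_r^*f_r$ with $f_r\in\mathbb F[\mathtt z,\mathtt w]_{1,1}$ (where $f^*$ is the complex conjugate of $f$); and, for $\mathbb F=\mathbb R$, $\mathcal P_{\mathbb R}$, those $f$ with $f|_{\mathbb R^n\times\mathbb R^m}\ge0$. A $*$-linear map ($\mathbb F$-linear with $\Phi(A^* )=\Phi(A)^*$) $\Phi:M_n(\mathbb C)\to M_m(\mathbb C)$ corresponds bijectively to $p_\Phi(\mathtt z,\mathtt w)=\mathtt w^*\Phi(\overline{\mathtt z}\,\overline{\mathtt z}^{*})\mathtt w\in\operatorname{Sym}\mathbb C[\mathtt z,\overline{\mathtt z},\mathtt w,\overline{\mathtt w}]_{1,1,1,1}$; positive maps correspond to $\operatorname{Pos}_{\mathbb C}$, completely positive ones to $\operatorname{Sos}_{\mathbb C}$. A $*$-linear map $\Phi:M_n(\mathbb R)\to M_m(\mathbb R)$ corresponds to $p_{\Phi^{\mathbb C}}\in\operatorname{Sym}\mathbb R[\mathtt z,\overline{\mathtt z},\mathtt w,\overline{\mathtt w}]_{1,1,1,1}$ with $\Phi^{\mathbb C}(A+iB)=\Phi(A)+i\Phi(B)$; positive maps correspond to $\mathcal P_{\mathbb R}$, completely positive ones to $\operatorname{Sos}_{\mathbb R}$. Introduce real variables $\mathtt x=(x_1,\dots,x_{2n})$, $\mathtt y=(y_1,\dots,y_{2m})$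 by $z_j=x_j+i\,x_{n+j}$, $w_k=y_k+i\,y_{m+k}$. This identifies $\operatorname{Sym}\mathbb F[\mathtt z,\overline{\mathtt z},\mathtt w,\overline{\mathtt w}]_{1,1,1,1}$ with a real subspace $\mathcal C_{\mathbb F}$ of the space $\mathbb R[\mathtt x,\mathtt y]_{2,2}$ of polynomials homogeneous of degree $2$ in $\mathtt x$ and of degree $2$ in $\mathtt y$. Write $\operatorname{Pos}_{\mathcal C_{\mathbb F}},\operatorname{Sos}_{\mathcal C_{\mathbb F}},\mathcal P_{\mathcal C_{\mathbb R}}\subset\mathcal C_{\mathbb F}$ for the images of $\operatorname{Pos}_{\mathbb F},\operatorname{Sos}_{\mathbb F},\mathcal P_{\mathbb R}$. Let $\sigma$ be the product of the normalized (probability) Lebesgue measures on $S^{2n-1}$ and $S^{2m-1}$, $T=S^{2n-1}\times S^{2m-1}$, $\langle f,g\rangle=\int_Tfg\,d\sigma$, and $\mathcal M_{\mathcal C_{\mathbb F}}=\{f\in\mathcal C_{\mathbb F}:\int_Tf\,d\sigma=0\}$, of dimension $D_{\mathcal M_{\mathcal C_{\mathbb F}}}$; $\operatorname{Vol}$ is the pushforward to $\mathcal M_{\mathcal C_{\mathbb F}}$ of Lebesgue measure under any linear isometry $\mathbb R^{D_{\mathcal M_{\mathcal C_{\mathbb F}}}}\to\mathcal M_{\mathcal C_{\mathbb F}}$. For a cone $K\subseteq\mathcal C_{\mathbb F}$ put $\widetilde K=\{f\in\mathcal M_{\mathcal C_{\mathbb F}}:f+(\sum_{i=1}^{2n}x_i^2)(\sum_{j=1}^{2m}y_j^2)\in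 K\}$. By definition $$p_{n,m}^{\mathbb C}=\frac{\operatorname{Vol}\widetilde{\operatorname{Sos}}_{\mathcal C_{\mathbb C}}}{\operatorname{Vol}\widetilde{\operatorname{Pos}}_{\mathcal C_{\mathbb C}}},\qquad p_{n,m}^{\mathbb R}=\frac{\operatorname{Vol}\widetilde{\operatorname{Sos}}_{\mathcal C_{\mathbb R}}}{\operatorname{Vol}\widetilde{\mathcal P}_{\mathcal C_{\mathbb R}}}.$$ *)

(* Defs.v *)
From HB Require Import structures.
From mathcomp Require Import all_boot all_order all_algebra.
From mathcomp Require Import all_classical all_reals all_analysis.
From mathcomp Require Import measurable_realfun.
From mathcomp.real_closed Require Import complex.
From mathcomp.multinomials Require mpoly.

Set Implicit Arguments.
Unset Strict Implicit.
Unset Printing Implicit Defensive.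

Import Order.TTheory GRing.Theory Num.Theory.
Import numFieldNormedType.Exports.

Local Open Scope classical_set_scope.
Local Open Scope ring_scope.

Section tuple_cons.
Context (R : realType) (d : nat).

Definition tcons (p : measurableTypeR R * d.-tuple R) : d.+1.-tuple R :=
  [tuple of p.1 :: p.2].

Definition tuncons (t : d.+1.-tuple R) : measurableTypeR R * d.-tuple R :=
  (thead t, [tuple of behead t]).

Lemma tconsK : cancel tcons tuncons.
Proof.
by move=> [x t]; congr (_, _); exact/val_inj.
Qed.

Lemma measurable_tcons : measurable_fun setT tcons.
Proof. exact: (measurable_cons (T2 := R)). Qed.

Lemma measurable_tuncons : measurable_fun setT tuncons.
Proof.
apply: measurable_fun_pair; last exact: measurable_behead.
exact: (@measurable_tnth _ R d.+1 ord0).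
Qed.

HB.instance Definition _ :=
  isMeasurableFun.Build _ _ _ _ tcons measurable_tcons.

End tuple_cons.

Section lebesgue_step.
Context (R : realType) (d : nat).
Context (mu : {sigma_finite_measure set (d.-tuple R) -> \bar R}).

Definition lebesgue_step : set (d.+1.-tuple R) -> \bar R :=
  pushforward (@lebesgue_measure R \x mu)%E (@tcons R d).

Let step0 : lebesgue_step set0 = 0%E.
Proof. exact: measure0. Qed.

Let step_ge0 A : (0 <= lebesgue_step A)%E.
Proof. exact: measure_ge0. Qed.

Let step_sigma_additive : semi_sigma_additive lebesgue_step.
Proof. exact: measure_semi_sigma_additive. Qed.

HB.instance Definition _ := isMeasure.Build _ _ _ lebesgue_step
  step0 step_ge0 step_sigma_additive.

Let step_sigma_finite : sigma_finite setT lebesgue_step.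
Proof.
have /sigma_finiteP[F [FT ndF Foo]] := sigma_finiteT (@lebesgue_measure R).
have /sigma_finiteP[G [GT ndG Goo]] := sigma_finiteT mu.
exists (fun k => @tuncons R d @^-1` (F k `*` G k)).
  rewrite -preimage_bigcup -[LHS](preimage_setT (@tuncons R d)).
  congr (_ @^-1` _).
  apply/seteqP; split=> // -[x t] _.
  have [i _ Fx] : (\bigcup_k F k) x by rewrite -FT.
  have [j _ Gt] : (\bigcup_k G k) t by rewrite -GT.
  exists (maxn i j) => //; split.
    by move: Fx; exact/subsetPset/ndF/leq_maxl.
  by move: Gt; exact/subsetPset/ndG/leq_maxr.
move=> k; have [mF Fk] := Foo k; have [mG Gk] := Goo k.
have mFG : measurable (F k `*` G k) by exact: measurableX.
split.
  by rewrite -[X in measurable X]setTI; exact: measurable_tuncons.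
rewrite /lebesgue_step /pushforward -comp_preimage.
rewrite (_ : tuncons (d:=d) \o _ = id); last first.
  by apply/funext => x; exact: tconsK.
by rewrite preimage_id product_measure1E// lte_mul_pinfty// ge0_fin_numE.
Qed.

HB.instance Definition _ := Measure_isSigmaFinite.Build _ _ _ lebesgue_step
  step_sigma_finite.

End lebesgue_step.

Fixpoint lebesgue_tuple (R : realType) (d : nat) :
    {sigma_finite_measure set (d.-tuple R) -> \bar R} :=
  match d with
  | 0 => \d_ [tuple]
  | d'.+1 => lebesgue_step (lebesgue_tuple R d')
  end.

Section sphere.
Context (R : realType) (k : nat).

Definition sqnorm (t : k.-tuple R) : R := \sum_(i < k) tnth t i ^+ 2.

Definition sphere : set (k.-tuple R) := [set t | sqnorm t = 1].

Definition unit_ball : set (k.-tuple R) := [set t | sqnorm t <= 1].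

Definition radial (t : k.-tuple R) : k.-tuple R :=
  [tuple tnth t i / Num.sqrt (sqnorm t) | i < k].

Lemma sqnorm_ge0 t : 0 <= sqnorm t.
Proof. by apply: sumr_ge0 => i _; exact: sqr_ge0. Qed.

Lemma measurable_sqnorm : measurable_fun setT sqnorm.
Proof.
apply: measurable_sum => i.
by apply: measurable_funX => /=; exact: measurable_tnth.
Qed.

Lemma measurable_unit_ball : measurable unit_ball.
Proof.
rewrite (_ : unit_ball = sqnorm @^-1` `]-oo, 1]).
  by rewrite -[X in measurable X]setTI; exact: measurable_sqnorm.
by apply/seteqP; split => t /=; rewrite in_itv.
Qed.

Lemma measurable_radial : measurable_fun setT radial.
Proof.
apply/measurable_fun_tnthP => i.
rewrite (_ : _ \o _ =
    (fun t => tnth t i * ((sqnorm t `^ (2^-1)) `^ (-1)))); last first.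
  apply/funext => t /=; rewrite tnth_mktuple powR12_sqrt ?sqnorm_ge0//.
  by rewrite powR_inv1// sqrtr_ge0.
apply: measurable_funM; first exact: measurable_tnth.
apply: (measurableT_comp (measurable_powR _)).
by apply: (measurableT_comp (measurable_powR _)); exact: measurable_sqnorm.
Qed.

HB.instance Definition _ :=
  isMeasurableFun.Build _ _ _ _ radial measurable_radial.

(* The rotation-invariant probability on the sphere, as the law of the radial
   projection of a uniform point of the ball.  The Dirac mass is only the
   fallback required by [mnormalize]: it is never used, since the volume of the
   ball is positive and finite. *)
Definition sphere_prob : probability (k.-tuple R) R :=
  distribution
    (mnormalize (mrestr (lebesgue_tuple R k) measurable_unit_ball)
       (\d_ ([tuple of nseq k 0] : k.-tuple R)))
    radial.

End sphere.

Variant ground_field := GroundR | GroundC.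

Definition dim_ground (F : ground_field) : nat :=
  match F with GroundR => 1 | GroundC => 2 end.

Definition in_ground (R : realType) (F : ground_field) (c : R[i]) : Prop :=
  match F with GroundR => complex.Im c = 0 | GroundC => True end.

(* The notations of mpoly clash with those of the analysis library. *)
Import -(notations) mpoly.

Section biquadratic_forms.
Context (R : realType) (n m : nat).

(* Variables are listed as x_1..x_2n, y_1..y_2m. *)
Definition nvars := (n + n + (m + m))%N.

Definition xvar (j : 'I_(n + n)) : mpoly nvars R :=
  mpolyX R (mnm1 (lshift (m + m) j)).

Definition yvar (k : 'I_(m + m)) : mpoly nvars R :=
  mpolyX R (mnm1 (rshift (n + n) k)).

Definition complexify : mpoly nvars R -> mpoly nvars R[i] :=
  map_mpoly (real_complex R).

(* Conjugation of the coefficients: the variables x and y are real. *)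
Definition pconj : mpoly nvars R[i] -> mpoly nvars R[i] := map_mpoly conjc.

Definition zvar (j : 'I_n) : mpoly nvars R[i] :=
  complexify (xvar (lshift n j)) + 'i%C *: complexify (xvar (rshift n j)).

Definition wvar (k : 'I_m) : mpoly nvars R[i] :=
  complexify (yvar (lshift m k)) + 'i%C *: complexify (yvar (rshift m k)).

(* Sym F[z, zbar, w, wbar]_{1,1,1,1} *)
Definition SymF (F : ground_field) : set (mpoly nvars R[i]) :=
  [set f | exists a : 'I_n -> 'I_n -> 'I_m -> 'I_m -> R[i],
    [/\ forall i j k l, in_ground F (a i j k l),
        forall i j k l, a i j k l = (a j i l k)^*%C &
        f = \sum_(i < n) \sum_(j < n) \sum_(k < m) \sum_(l < m)
              a i j k l *: (pconj (zvar i) * zvar j * pconj (wvar k) * wvar l)]].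

(* F[z, w]_{1,1} *)
Definition bilinF (F : ground_field) : set (mpoly nvars R[i]) :=
  [set f | exists a : 'I_n -> 'I_m -> R[i],
    (forall j k, in_ground F (a j k)) /\
    f = \sum_(j < n) \sum_(k < m) a j k *: (zvar j * wvar k)].

Definition real_point (x : 'I_(n + n) -> R) (y : 'I_(m + m) -> R)
    (i : 'I_nvars) : R :=
  match fintype.split i with inl j => x j | inr k => y k end.

(* (Re v, Im v) *)
Definition re_im p (v : 'rV[R[i]]_p) (i : 'I_(p + p)) : R :=
  match fintype.split i with
  | inl j => complex.Re (v 0 j)
  | inr j => complex.Im (v 0 j)
  end.

Definition ceval (f : mpoly nvars R[i]) (z : 'rV[R[i]]_n) (w : 'rV[R[i]]_m) :
    R[i] :=
  meval (fun i => (real_point (re_im z) (re_im w) i)%:C%C) f.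

(* In R[i], 0 <= c means that c is real and nonnegative. *)
Definition PosF (F : ground_field) : set (mpoly nvars R[i]) :=
  [set f | SymF F f /\ forall z w, 0 <= ceval f z w].

Definition PosR : set (mpoly nvars R[i]) :=
  [set f | SymF GroundR f /\
    forall (x : 'rV[R]_n) (y : 'rV[R]_m),
      0 <= ceval f (map_mx (real_complex R) x) (map_mx (real_complex R) y)].

Definition SosF (F : ground_field) : set (mpoly nvars R[i]) :=
  [set f | SymF F f /\ exists r (g : 'I_r -> mpoly nvars R[i]),
    (forall s, bilinF F (g s)) /\ f = \sum_(s < r) pconj (g s) * g s].

(* The cone of the forms p_Phi, for Phi : M_n(F) -> M_m(F) positive *)
Definition positive_maps (F : ground_field) : set (mpoly nvars R[i]) :=
  match F with GroundR => PosR | GroundC => PosF GroundC end.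

(* The set of polynomials of R[x, y] identified with the elements of K by
   z_j = x_j + i x_(n+j), w_k = y_k + i y_(m+k) *)
Definition real_model (K : set (mpoly nvars R[i])) : set (mpoly nvars R) :=
  [set f | K (complexify f)].

Definition reval (f : mpoly nvars R)
    (p : (n + n).-tuple R * (m + m).-tuple R) : R :=
  meval (real_point (tnth p.1) (tnth p.2)) f.

Definition integral_T (f : mpoly nvars R) : R :=
  \int[(sphere_prob R (n + n) \x sphere_prob R (m + m))%E]_(p in
      @sphere R (n + n) `*` @sphere R (m + m)) reval f p.

Definition inner (f g : mpoly nvars R) : R := integral_T (f * g).

(* M_{C_F} *)
Definition mean_zero (F : ground_field) : set (mpoly nvars R) :=
  [set f | real_model (SymF F) f /\ integral_T f = 0].

Definition sqnorms : mpoly nvars R :=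
  (\sum_(j < n + n) xvar j ^+ 2) * (\sum_(k < m + m) yvar k ^+ 2).

Definition section_of (F : ground_field) (K : set (mpoly nvars R)) :
    set (mpoly nvars R) :=
  [set f | mean_zero F f /\ K (f + sqnorms)].

Definition has_dimension (V : set (mpoly nvars R)) (d : nat) : Prop :=
  exists phi : {linear 'rV[R]_d -> mpoly nvars R},
    injective phi /\ range phi = V.

Definition linear_isometry_onto (V : set (mpoly nvars R)) (d : nat)
    (iota : {linear 'rV[R]_d -> mpoly nvars R}) : Prop :=
  (forall u v, inner (iota u) (iota v) = \sum_(i < d) u 0 i * v 0 i) /\
  range iota = V.

(* The value on K of the pushforward by iota of the Lebesgue measure *)
Definition Vol (d : nat) (iota : {linear 'rV[R]_d -> mpoly nvars R})
    (K : set (mpoly nvars R)) : \bar R :=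
  lebesgue_tuple R d [set t | K (iota (\row_i tnth t i))].

(* p^F_{n,m}, with Vol computed through iota.  The quotient is taken in the
   extended reals, where a finite number divided by +oo is 0.  This matters for
   GroundR: Im(conj z_1 z_2) Im(conj w_1 w_2) vanishes on R^n x R^m and has mean
   zero, so that the section of P_R contains lines. *)
Definition prob_cp (F : ground_field) (d : nat)
    (iota : {linear 'rV[R]_d -> mpoly nvars R}) : \bar R :=
  (Vol iota (section_of F (real_model (SosF F))) /
   Vol iota (section_of F (real_model (positive_maps F))))%E.

End biquadratic_forms.

Definition dimM (F : ground_field) (n m : nat) : nat :=
  match F with
  | GroundC => (n ^ 2 * m ^ 2 - 1)%N
  | GroundR => ((n * m * (n * m + 1)) %/ 2 - 1)%N
  end.

Definition constC (R : realType) (F : ground_field) : R :=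
  2 ^+ (28 - dim_ground F) * 5 ^+ 4 * 10 `^ (4 / 9) / 3 ^+ 5.

(* Main.v *)
Require Import Defs.
From HB Require Import structures.
From mathcomp Require Import all_boot all_order all_algebra.
From mathcomp Require Import all_classical all_reals all_analysis.
From mathcomp Require Import measurable_realfun.
From mathcomp Require spectral sesquilinear.
From mathcomp Require Import perm zify ring lra.
From mathcomp.real_closed Require Import complex.
From mathcomp.multinomials Require mpoly.
Import -(notations) mpoly.
Import Order.TTheory GRing.Theory Num.Theory.
Import numFieldNormedType.Exports.
Local Open Scope classical_set_scope.
Local Open Scope ring_scope.

(** Real and imaginary parts turn a form into a Hermitian matrix X of size
    N = nm acting on product vectors z (x) w: Sos_C becomes "X is positive
    semidefinite" and Pos_C becomes "X is nonnegative on product vectors".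

    Complex case.  Among the positive semidefinite X, let v be fixed and
    consider those with X[v] away from (tr X / N) |v|^2 by a relative factor tau.
    The congruence by 1 + s v v^* / |v|^2, with s = tau / 6, has Jacobian
    (1 + s)^(2N) and maps them to positive semidefinite matrices whose trace has
    grown by at most a controlled factor, so that their proportion is at most
    exp(- N tau^2 / 6).  Product vectors admit a net of exp(O(n + m)) points, so
    that a tau of order min(n, m)^(-1/2) makes the exceptional matrices at most
    half of the cone.  The traceless part of the other ones lies in the dilate by
    2 tau of the section of Pos_C, whence a ratio at most 2 (2 tau)^D.  When
    min(n, m) is below an absolute constant, the bound exceeds 1.

    Real case.  The section of P_R contains lines, hence has infinite volume,
    and the quotient is 0. *)

Set Implicit Arguments.
Unset Strict Implicit.
Unset Printing Implicit Defensive.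

(** * Lebesgue measure on tuples and linear maps *)

(** A congruence does not preserve the section of a cone, but it preserves the cone; so the estimate
    takes place in the cone truncated at height 1, whose volume is that of the section times a
    constant that cancels. The Jacobian of a congruence is obtained without determinants. The factor
    by which a linear map changes volume is multiplicative and equals 1 on involutions. A reflection
    turns the rank one update along any v into one along a basis vector, so all directions share one
    factor; the product over a basis is a scalar matrix, whose factor is explicit, and an N-th root
    gives the result. The net controls a form at finitely many product vectors only. Passing to all
    of them doubles the bound, which is why the dilation is by 2 tau and not tau. Finiteness of
    volumes is treated by cases, an infinite denominator giving quotient 0. Complex scalars are
    essential to identify forms with matrices: values on complex product vectors determine a
    Hermitian matrix, values on real ones do not, and this defect is the line contained in the
    section of P_R. *)

Section pushforward_iso.
Context (d1 d2 : measure_display) (T1 : measurableType d1)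
  (T2 : measurableType d2) (R : realType).

Section pushforward_mfun.
Variables (m : {measure set T1 -> \bar R}) (f : {mfun T1 >-> T2}).

Definition push_mfun : set T2 -> \bar R := pushforward m f.

Let push0 : push_mfun set0 = 0%E.
Proof. exact: measure0. Qed.

Let push_ge0 A : (0 <= push_mfun A)%E.
Proof. exact: measure_ge0. Qed.

Let push_sigma_additive : semi_sigma_additive push_mfun.
Proof. exact: measure_semi_sigma_additive. Qed.

HB.instance Definition _ := measure_function.isMeasure.Build _ _ _ push_mfun
  push0 push_ge0 push_sigma_additive.

End pushforward_mfun.

Variables (m : {sigma_finite_measure set T1 -> \bar R})
  (f : {mfun T1 >-> T2}) (g : {mfun T2 >-> T1}) (fK : cancel f g).

(** The cancellation proof is an argument because sigma-finiteness depends on it: a cover of the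
    source by sets of finite measure is transported by preimage under g. The instance can then be
    attached to this term. *)
Definition push_iso (_ : cancel f g) : set T2 -> \bar R := push_mfun m f.

HB.instance Definition _ := measure_function.Measure.on (push_iso fK).

Let push_iso_sigma_finite : sigma_finite setT (push_iso fK).
Proof.
have /sigma_finiteP[F [FT _ Foo]] := sigma_finiteT m.
exists (fun k => g @^-1` F k).
  by rewrite -preimage_bigcup -FT preimage_setT.
move=> k; have [mF Fk] := Foo k; split; first exact: measurable_funPTI.
rewrite /push_iso /push_mfun /pushforward -comp_preimage.
by rewrite (_ : g \o f = id) ?preimage_id //; apply/funext.
Qed.

HB.instance Definition _ := Measure_isSigmaFinite.Build _ _ _ (push_iso fK)
  push_iso_sigma_finite.

End pushforward_iso.

Section tuple_vectors.
Context {R : realType}.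

Definition tadd d (s t : d.-tuple R) : d.-tuple R :=
  [tuple tnth s i + tnth t i | i < d].
Definition topp d (t : d.-tuple R) : d.-tuple R := [tuple - tnth t i | i < d].
Definition tscale d (a : R) (t : d.-tuple R) : d.-tuple R :=
  [tuple a * tnth t i | i < d].
Definition tuple_row d (t : d.-tuple R) : 'rV[R]_d := \row_i tnth t i.
Definition row_tuple d (v : 'rV[R]_d) : d.-tuple R := [tuple v 0 i | i < d].
Definition tmulmx d e (A : 'M[R]_(d, e)) (t : d.-tuple R) : e.-tuple R :=
  row_tuple (tuple_row t *m A).

Lemma tuple_rowK d : cancel (@tuple_row d) (@row_tuple d).
Proof. by move=> t; apply: eq_from_tnth => i; rewrite tnth_mktuple mxE. Qed.

Lemma row_tupleK d : cancel (@row_tuple d) (@tuple_row d).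
Proof. by move=> v; apply/rowP => i; rewrite mxE tnth_mktuple. Qed.

Lemma tmulmxE d e (A : 'M[R]_(d, e)) t :
  tuple_row (tmulmx A t) = tuple_row t *m A.
Proof. exact: row_tupleK. Qed.

Lemma tmulmxM d e f (A : 'M[R]_(d, e)) (B : 'M[R]_(e, f)) t :
  tmulmx B (tmulmx A t) = tmulmx (A *m B) t.
Proof. by rewrite /tmulmx row_tupleK mulmxA. Qed.

Lemma tmulmx1 d (t : d.-tuple R) : tmulmx 1%:M t = t.
Proof. by rewrite /tmulmx mulmx1 tuple_rowK. Qed.

Lemma tmulmx_scalar d (a : R) (t : d.-tuple R) : tmulmx a%:M t = tscale a t.
Proof.
by apply: eq_from_tnth => i; rewrite !tnth_mktuple mul_mx_scalar !mxE.
Qed.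

Lemma tmulmx_add d e (A : 'M[R]_(d, e)) s t :
  tmulmx A (tadd s t) = tadd (tmulmx A s) (tmulmx A t).
Proof.
apply: eq_from_tnth => i; rewrite !tnth_mktuple.
have -> : tuple_row (tadd s t) = tuple_row s + tuple_row t.
  by apply/rowP => j; rewrite !mxE tnth_mktuple.
by rewrite mulmxDl mxE.
Qed.

Lemma measurable_tnthT d (i : 'I_d) :
  measurable_fun [set: d.-tuple R] (fun t => tnth t i).
Proof. exact: measurable_tnth. Qed.

Lemma measurable_tmulmx d e (A : 'M[R]_(d, e)) :
  measurable_fun setT (tmulmx A).
Proof.
apply/measurable_fun_tnthP => i.
rewrite (_ : _ \o _ = (fun t => \sum_j tnth t j * A j i)); last first.
  apply/funext => t /=; rewrite tnth_mktuple mxE.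
  by apply: eq_bigr => j _; rewrite mxE.
apply: measurable_sum => j; apply: measurable_funM => //.
exact: measurable_tnthT.
Qed.

Lemma measurable_tadd d :
  measurable_fun setT (fun p : d.-tuple R * d.-tuple R => tadd p.1 p.2).
Proof.
apply/measurable_fun_tnthP => i.
rewrite (_ : _ \o _ = (fun p => tnth p.1 i + tnth p.2 i)); last first.
  by apply/funext => t /=; rewrite tnth_mktuple.
apply: measurable_funD.
  by apply: (measurableT_comp (measurable_tnthT i)); exact: measurable_fst.
by apply: (measurableT_comp (measurable_tnthT i)); exact: measurable_snd.
Qed.

Lemma measurable_topp d : measurable_fun setT (@topp d).
Proof.
apply/measurable_fun_tnthP => i.
rewrite (_ : _ \o _ = (fun p => - tnth p i)); last first.
  by apply/funext => t /=; rewrite tnth_mktuple.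
by apply: (measurableT_comp (@oppr_measurable _ setT)); exact: measurable_tnthT.
Qed.

Lemma measurable_taddl d (s : d.-tuple R) : measurable_fun setT (tadd s).
Proof.
apply: (measurableT_comp (@measurable_tadd d)
  (g := fun t => (s, t))).
exact: measurable_pair1.
Qed.

Lemma measurableTI (dT dT' : measure_display) (T : measurableType dT)
    (T' : measurableType dT') (f : T -> T') E :
  measurable_fun setT f -> measurable E -> measurable (f @^-1` E).
Proof. by move=> mf mE; rewrite -[X in measurable X]setTI; exact: mf. Qed.

Lemma lebesgue_measure_shift (a : R) (A : set R) : measurable A ->
  lebesgue_measure ((fun x => a + x) @^-1` A) = lebesgue_measure A.
Proof.
move=> mA.
pose f : measurableTypeR R -> measurableTypeR R := fun x => a + x.
have mf : measurable_fun setT f.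
  exact: (@measurable_funD _ (measurableTypeR R) _ setT (cst a) id).
pose F : {mfun _ >-> _} := HB.pack f (isMeasurableFun.Build _ _ _ _ f mf).
rewrite -[LHS]/(push_mfun (@lebesgue_measure R) F A).
apply/esym/lebesgue_measure_unique => // _ [[b c]] _ <-.
rewrite -[RHS]/(lebesgue_measure (f @^-1` _)).
rewrite (_ : f @^-1` _ = [set` `]b - a, c - a]]); last first.
  by apply/seteqP; split => x /=; rewrite !in_itv/= /f; lra.
rewrite !lebesgue_measure_itv/= !lte_fin ltrD2r.
by case: ifPn => //; rewrite -!EFinB opprB addrA subrK.
Qed.

Lemma lebesgue_measure_scale (a : R) (A : set R) : 0 < a -> measurable A ->
  lebesgue_measure ((fun x => a * x) @^-1` A) =
  (a^-1%:E * lebesgue_measure A)%E.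
Proof.
move=> a0 mA.
have a0' : 0 <= a by exact: ltW.
pose f : measurableTypeR R -> measurableTypeR R := fun x => a * x.
have mf : measurable_fun setT f.
  exact: (@measurable_funM _ (measurableTypeR R) _ setT (cst a) id).
pose F : {mfun _ >-> _} := HB.pack f (isMeasurableFun.Build _ _ _ _ f mf).
rewrite -[LHS]/(push_mfun (@lebesgue_measure R) F A).
suff : lebesgue_measure A =
    mscale (NngNum a0') (push_mfun (@lebesgue_measure R) F) A.
  by move=> ->; rewrite /mscale/= muleA -EFinM mulVf ?mul1e ?gt_eqF.
apply: lebesgue_measure_unique => // _ [[b c]] _ <-.
rewrite -[RHS]/(a%:E * lebesgue_measure (f @^-1` _))%E.
rewrite (_ : f @^-1` _ = [set` `]b / a, c / a]]); last first.
  apply/seteqP; split => x /=; rewrite !in_itv/= /f.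
    by rewrite ltr_pdivrMr // ler_pdivlMr // mulrC.
  by rewrite ltr_pdivrMr // ler_pdivlMr // mulrC.
rewrite !lebesgue_measure_itv/= !lte_fin ltr_pM2r ?invr_gt0 //.
case: ifPn => //; last by rewrite mule0.
by move=> _; rewrite -!EFinB -EFinM -mulrBl mulrC divfK ?gt_eqF.
Qed.

End tuple_vectors.

Section lebesgue_tuple_theory.
Context {R : realType}.
Local Notation mu := (lebesgue_tuple R).

Lemma lebesgue_tupleS d (E : set (d.+1.-tuple R)) :
  mu d.+1 E = (\int[lebesgue_measure]_x mu d [set t | E (tcons (x, t))])%E.
Proof.
apply: eq_integral => x _ /=; congr (lebesgue_tuple R d _).
by apply/seteqP; split => t /=; rewrite /xsection /= inE.
Qed.

Lemma measurable_tcons_section d (E : set (d.+1.-tuple R)) x : measurable E ->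
  measurable [set t : d.-tuple R | E (tcons (x, t))].
Proof.
move=> mE; rewrite (_ : mkset _ = xsection ((@tcons R d) @^-1` E) x).
  by apply: measurable_xsection; apply: measurableTI => //; exact: measurable_tcons.
by apply/seteqP; split => t /=; rewrite /xsection /= inE.
Qed.

Lemma measurable_fun_tcons_section d (E : set (d.+1.-tuple R)) : measurable E ->
  measurable_fun [set: measurableTypeR R]
    (fun x => mu d [set t | E (tcons (x, t))]).
Proof.
move=> mE.
have mE' : measurable ((@tcons R d) @^-1` E).
  by apply: measurableTI => //; exact: measurable_tcons.
have := measurable_fun_xsection (mu d) mE'.
apply: eq_measurable_fun => x _ /=; congr (lebesgue_tuple R d _).
by apply/seteqP; split => t /=; rewrite /xsection /= inE.
Qed.

Lemma ge0_integral_shift (a : R) (f : R -> \bar R) :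
  measurable_fun [set: measurableTypeR R] f -> (forall x, 0 <= f x)%E ->
  (\int[lebesgue_measure]_x f (a + x)%R = \int[lebesgue_measure]_x f x)%E.
Proof.
move=> mf f0.
have ma : measurable_fun [set: measurableTypeR R]
    ((fun x => a + x) : _ -> measurableTypeR R).
  exact: (@measurable_funD _ (measurableTypeR R) _ setT (cst a) id).
have := @ge0_integral_pushforward _ _ (measurableTypeR R) (measurableTypeR R) R
  _ ma lebesgue_measure setT f measurableT mf (fun x _ => f0 x).
rewrite preimage_setT => <-.
by apply: eq_measure_integral => A mA _; exact: lebesgue_measure_shift.
Qed.

Lemma ge0_integral_scale (a : R) (f : R -> \bar R) : 0 < a ->
  measurable_fun [set: measurableTypeR R] f -> (forall x, 0 <= f x)%E ->
  (\int[lebesgue_measure]_x f (a * x)%R =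
   a^-1%:E * \int[lebesgue_measure]_x f x)%E.
Proof.
move=> a0 mf f0.
have ma : measurable_fun [set: measurableTypeR R]
    ((fun x => a * x) : _ -> measurableTypeR R).
  exact: (@measurable_funM _ (measurableTypeR R) _ setT (cst a) id).
have := @ge0_integral_pushforward _ _ (measurableTypeR R) (measurableTypeR R) R
  _ ma lebesgue_measure setT f measurableT mf (fun x _ => f0 x).
rewrite preimage_setT => <-.
have a0' : 0 <= a^-1 by rewrite invr_ge0 ltW.
rewrite -[RHS](@ge0_integral_mscale _ _ R lebesgue_measure _ measurableT
  (NngNum a0') f) //.
apply: eq_measure_integral => A mA _; exact: lebesgue_measure_scale.
Qed.

Lemma tadd_tcons d (s : d.+1.-tuple R) x t :
  tadd s (tcons (x, t)) = tcons (thead s + x, tadd [tuple of behead s] t).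
Proof.
apply: eq_from_tnth => i; rewrite tnth_mktuple.
have [j ->|->] := unliftP ord0 i; last by [].
rewrite !tnthS tnth_mktuple /= tnth_behead.
congr (_ + _); congr (tnth _ _); apply/val_inj.
by rewrite /= inordK // ltnS.
Qed.

Lemma tscale_tcons d (a : R) x (t : d.-tuple R) :
  tscale a (tcons (x, t)) = tcons (a * x, tscale a t).
Proof.
apply: eq_from_tnth => i; rewrite tnth_mktuple.
have [j ->|->] := unliftP ord0 i; last by [].
by rewrite !tnthS tnth_mktuple.
Qed.

Lemma lebesgue_tuple_shift d (s : d.-tuple R) E : measurable E ->
  mu d (tadd s @^-1` E) = mu d E.
Proof.
elim: d s E => [|d IH] s E mE.
  congr (lebesgue_tuple R 0 _); apply/seteqP.
  by split => t /=; rewrite (tuple0 (tadd s t)) (tuple0 t).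
rewrite !lebesgue_tupleS.
under eq_integral => x _.
  rewrite (_ : mkset _ = tadd [tuple of behead s] @^-1`
    [set t | E (tcons (thead s + x, t))]); last first.
    by apply/seteqP; split => t /=; rewrite tadd_tcons.
  rewrite IH; last exact: measurable_tcons_section.
  over.
apply: (@ge0_integral_shift (thead s) (fun x => mu d [set t | E (tcons (x, t))])).
  exact: measurable_fun_tcons_section.
by move=> x; exact: measure_ge0.
Qed.

Lemma measurable_tscale d (a : R) : measurable_fun setT (@tscale R d a).
Proof.
rewrite (_ : @tscale R d a = tmulmx a%:M); first exact: measurable_tmulmx.
by apply/funext => t; rewrite tmulmx_scalar.
Qed.

Lemma lebesgue_tuple_scale d (a : R) E : 0 < a -> measurable E ->
  mu d (@tscale R d a @^-1` E) = ((a ^+ d)^-1%:E * mu d E)%E.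
Proof.
move=> a0; elim: d E => [|d IH] E mE.
  rewrite expr0 invr1 mul1e.
  congr (lebesgue_tuple R 0 _); apply/seteqP.
  by split => t /=; rewrite (tuple0 (tscale a t)) (tuple0 t).
rewrite !lebesgue_tupleS.
under eq_integral => x _.
  rewrite (_ : mkset _ = @tscale R d a @^-1`
    [set t | E (tcons (a * x, t))]); last first.
    by apply/seteqP; split => t /=; rewrite tscale_tcons.
  rewrite IH; last exact: measurable_tcons_section.
  over.
have mf := measurable_fun_tcons_section mE.
have ma : measurable_fun [set: measurableTypeR R]
    ((fun x => a * x) : _ -> measurableTypeR R).
  exact: (@measurable_funM _ (measurableTypeR R) _ setT (cst a) id).
rewrite ge0_integralZl //=; last 2 first.
- exact: (measurableT_comp mf ma).
- by rewrite lee_fin invr_ge0 exprn_ge0 // ltW.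
rewrite (ge0_integral_scale (f := fun x => mu d [set t | E (tcons (x, t))])) //.
by rewrite muleA -EFinM -invfM exprSr.
Qed.

Definition cube d (r : R) : set (d.-tuple R) :=
  [set t | forall i, `|tnth t i| <= r].

Lemma measurable_cube d r : measurable (@cube d r).
Proof.
rewrite (_ : cube r =
  \bigcap_(i in [set: 'I_d]) ((fun t => `|tnth t i|) @^-1` `]-oo, r])).
  apply: fin_bigcap_measurable => // i _; apply: measurableTI => //.
  by apply: measurableT_comp => //; exact: measurable_tnthT.
by apply/seteqP; split => t /= h i; have := h i; rewrite /= in_itv/=; auto.
Qed.

Lemma lebesgue_cube d r : 0 <= r -> mu d (cube r) = ((2 * r) ^+ d)%:E.
Proof.
move=> r0; elim: d => [|d IH].
  rewrite expr0 /= diracE mem_set //.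
  by move=> [].
have -> : mu d.+1 (cube r) = (@lebesgue_measure R \x mu d)%E (`[-r, r] `*` cube r).
  congr (product_measure1 _ _ _); apply/seteqP; split => -[x t] /= h.
    rewrite in_itv /= -ler_norml; split; first exact: (h ord0).
    by move=> i; have := h (lift ord0 i); rewrite tnthS.
  case: h; rewrite in_itv /= -ler_norml => h1 h2 i.
  by have [j ->|->] := unliftP ord0 i => //; rewrite tnthS.
rewrite product_measure1E //; last exact: measurable_cube.
have I : lebesgue_measure ([set` `[-r, r]] : set R) = (2 * r)%:E.
  rewrite lebesgue_measure_itv /= lte_fin; case: ltP => h.
    by rewrite -EFinB opprK mulr2n mulrDl mul1r.
  have -> : r = 0 by apply/le_anti; rewrite r0 andbT; lra.
  by rewrite mulr0.
by rewrite exprS EFinM -IH -I.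
Qed.

End lebesgue_tuple_theory.

(** * Uniqueness of the translation-invariant measure; volume factors of linear maps *)

Section haar.
Context {R : realType}.
Local Notation mu := (lebesgue_tuple R).

Lemma tadd_oppK d (s t : d.-tuple R) : tadd (topp s) (tadd s t) = t.
Proof. by apply: eq_from_tnth => i; rewrite !tnth_mktuple addKr. Qed.

Lemma taddC d (s t : d.-tuple R) : tadd s t = tadd t s.
Proof. by apply: eq_from_tnth => i; rewrite !tnth_mktuple addrC. Qed.

Lemma toppK d : involutive (@topp R d).
Proof. by move=> t; apply: eq_from_tnth => i; rewrite !tnth_mktuple opprK. Qed.

Lemma topp_add d (s t : d.-tuple R) : topp (tadd s t) = tadd (topp s) (topp t).
Proof. by apply: eq_from_tnth => i; rewrite !tnth_mktuple opprD. Qed.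

(* Tonelli on the two sets {(x, y) | x \in E, x + y \in F} and
   {(x, y) | x - y \in E, x \in F}, which differ by translations of x. *)
Lemma translation_invariant_unique d
    (nu : {sigma_finite_measure set (d.-tuple R) -> \bar R}) :
  (forall s E, measurable E -> nu (tadd s @^-1` E) = nu E) ->
  forall E F, measurable E -> measurable F ->
  (mu d E * nu F = mu d F * nu (@topp R d @^-1` E))%E.
Proof.
move=> nuT E F mE mF.
pose V := (d.-tuple R).
pose P : set (V * V) := [set p | E p.1 /\ F (tadd p.1 p.2)].
pose Q : set (V * V) := [set p | E (tadd p.1 (topp p.2)) /\ F p.1].
have mP : measurable P.
  apply: (@measurableI _ _ (fst @^-1` E) ((fun p : V * V => tadd p.1 p.2) @^-1` F)).
    by apply: measurableTI => //; exact: measurable_fst.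
  by apply: measurableTI => //; exact: measurable_tadd.
have mQ : measurable Q.
  apply: (@measurableI _ _ ((fun p : V * V => tadd p.1 (topp p.2)) @^-1` E)
    (fst @^-1` F)).
    apply: measurableTI => //.
    apply: (measurableT_comp (@measurable_tadd R d)
      (g := fun p : V * V => (p.1, topp p.2))).
    apply: measurable_fun_pair => //=.
    by apply: (measurableT_comp (@measurable_topp R d)); exact: measurable_snd.
  by apply: measurableTI => //; exact: measurable_fst.
have swap A : measurable A ->
    (\int[mu d]_x nu (xsection A x) = \int[nu]_y mu d (ysection A y))%E.
  move=> mA; have := indic_fubini_tonelli (mu d) nu mA.
  by rewrite indic_fubini_tonelli_FE // indic_fubini_tonelli_GE.
transitivity (\int[mu d]_x nu (xsection P x))%E.
  transitivity (\int[mu d]_(x in E) cst (nu F) x)%E.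
    by rewrite integral_cst // muleC.
  rewrite integral_mkcond; apply: eq_integral => x _; rewrite patchE.
  case: ifPn => [|] xE.
    rewrite -(nuT x F mF); congr (nu _); apply/seteqP; split => y /=.
      by rewrite /xsection /= inE => yF; split => //; rewrite inE in xE.
    by rewrite /xsection /= inE => -[].
  rewrite (_ : xsection P x = set0) ?measure0 //.
  apply/seteqP; split => y //=; rewrite /xsection /= inE => -[/= h _].
  by move: xE; rewrite notin_setE.
rewrite swap //.
transitivity (\int[nu]_y mu d (ysection Q y))%E.
  apply: eq_integral => y _.
  rewrite -[RHS](lebesgue_tuple_shift y); last exact: measurable_ysection.
  congr (lebesgue_tuple R d _); apply/seteqP; split => x /=.
    rewrite /ysection /= !inE => -[/= h1 h2]; split => /=.
      by rewrite (taddC _ (topp y)) tadd_oppK.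
    by rewrite taddC.
  rewrite /ysection /= !inE => -[/= h1 h2]; split => /=.
    by move: h1; rewrite (taddC _ (topp y)) tadd_oppK.
  by rewrite taddC.
rewrite -swap //.
transitivity (\int[mu d]_(x in F) cst (nu (@topp R d @^-1` E)) x)%E; last first.
  by rewrite integral_cst // muleC.
rewrite [RHS]integral_mkcond; apply: eq_integral => x _; rewrite patchE.
have mE' : measurable (@topp R d @^-1` E).
  by apply: measurableTI => //; exact: measurable_topp.
case: ifPn => xF.
  rewrite -(nuT (topp x) _ mE'). congr (nu _); apply/seteqP; split => y /=.
    by rewrite /xsection /= inE topp_add toppK => -[].
  rewrite /xsection /= inE topp_add toppK => h; split => //=.
  by rewrite inE in xF.
rewrite (_ : xsection Q x = set0) ?measure0 //.
apply/seteqP; split => y //=; rewrite /xsection /= inE => -[/= _ h].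
by move: xF; rewrite notin_setE.
Qed.

(** This cube is the unit of volume: used as a test set in the uniqueness lemma, it turns
    proportionality into an equality. *)
Lemma lebesgue_cube_half d : mu d (cube 2^-1) = 1%E.
Proof. by rewrite lebesgue_cube ?invr_ge0 // divff ?expr1n // pnatr_eq0. Qed.

Lemma lebesgue_tuple_opp d E : measurable E -> mu d (@topp R d @^-1` E) = mu d E.
Proof.
move=> mE.
have := translation_invariant_unique (@lebesgue_tuple_shift R d) mE
  (@measurable_cube R d 2^-1).
by rewrite lebesgue_cube_half mul1e mule1 => ->.
Qed.

Definition vol_scale d (A : 'M[R]_d) : \bar R :=
  mu d (tmulmx A @^-1` cube 2^-1).

(** The pushforward of Lebesgue measure by an invertible linear map is translation invariant, hence
    proportional to it, and the unit cube reads off the constant. Uniqueness is applied to the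
    opposite of E to cancel the sign that it introduces. *)
Lemma vol_scaleE_subproof d (A : 'M[R]_d) E : A \in unitmx -> measurable E ->
  mu d (tmulmx A @^-1` E) = (vol_scale A * mu d E)%E.
Proof.
move=> Au mE.
pose F : {mfun _ >-> _} := HB.pack (tmulmx A)
  (isMeasurableFun.Build _ _ _ _ _ (measurable_tmulmx A)).
pose G : {mfun _ >-> _} := HB.pack (tmulmx (invmx A))
  (isMeasurableFun.Build _ _ _ _ _ (measurable_tmulmx (invmx A))).
have FK : cancel F G by move=> t /=; rewrite tmulmxM mulmxV // tmulmx1.
pose nu : {sigma_finite_measure set (d.-tuple R) -> \bar R} := push_iso (mu d) FK.
have nuE X : nu X = mu d (tmulmx A @^-1` X) by [].
have nuT s X : measurable X -> nu (tadd s @^-1` X) = nu X.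
  move=> mX; rewrite !nuE.
  rewrite -(lebesgue_tuple_shift (tmulmx (invmx A) s)
    (measurableTI (measurable_tmulmx A) mX)).
  congr (lebesgue_tuple R d _); apply/seteqP; split => t /=;
    by rewrite tmulmx_add tmulmxM mulVmx // tmulmx1.
have mE' : measurable (@topp R d @^-1` E).
  by apply: measurableTI => //; exact: measurable_topp.
have := translation_invariant_unique nuT mE' (@measurable_cube R d 2^-1).
rewrite lebesgue_tuple_opp // lebesgue_cube_half mul1e muleC -!nuE => ->.
by congr (nu _); apply/seteqP; split => t /=; rewrite toppK.
Qed.

Lemma vol_scale_mul d (A B : 'M[R]_d) : A \in unitmx -> B \in unitmx ->
  vol_scale (A *m B) = (vol_scale A * vol_scale B)%E.
Proof.
move=> Au Bu; rewrite {3}/vol_scale -vol_scaleE_subproof //; last first.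
  by apply: measurableTI; [exact: measurable_tmulmx|exact: measurable_cube].
by congr (lebesgue_tuple R d _); apply/seteqP; split => t /=; rewrite tmulmxM.
Qed.

Lemma vol_scale1 d : vol_scale (1%:M : 'M[R]_d) = 1%E.
Proof.
rewrite -[RHS](lebesgue_cube_half d); congr (lebesgue_tuple R d _).
by apply/seteqP; split => t /=; rewrite tmulmx1.
Qed.

(** For invertible A this is |det A|^-1, the inverse because preimages are measured. It is handled
    through multiplicativity and its values on scalars and involutions. *)
Definition volume_factor d (A : 'M[R]_d) : R := fine (vol_scale A).

(** The factors of A and of its inverse have product 1, which excludes both 0 and +oo. *)
Lemma vol_scale_fin d (A : 'M[R]_d) : A \in unitmx ->
  0 < volume_factor A /\ vol_scale A = (volume_factor A)%:E.
Proof.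
move=> Au; rewrite /volume_factor.
have Vu : invmx A \in unitmx by rewrite unitmx_inv.
have := vol_scale_mul Au Vu; rewrite mulmxV // vol_scale1.
have : (0 <= vol_scale A)%E by exact: measure_ge0.
have : (0 <= vol_scale (invmx A))%E by exact: measure_ge0.
case: (vol_scale A) => [a| |] //; case: (vol_scale (invmx A)) => [b| |] //=.
- rewrite !lee_fin => b0 a0 [] /esym ab; split => //.
  rewrite lt_neqAle a0 andbT eq_sym; apply/eqP => z.
  by move/eqP: ab; rewrite z mul0r eq_sym oner_eq0.
- rewrite lee_fin => _ a0; have [->|az] := eqVneq a 0.
    by rewrite mul0e => -[] /eqP; rewrite oner_eq0.
  by rewrite gt0_muley // lte_fin lt_neqAle eq_sym az.
- rewrite lee_fin => b0 _; have [->|bz] := eqVneq b 0.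
    by rewrite mule0 => -[] /eqP; rewrite oner_eq0.
  by rewrite gt0_mulye // lte_fin lt_neqAle eq_sym bz.
Qed.

Lemma volume_factor_gt0 d (A : 'M[R]_d) : A \in unitmx -> 0 < volume_factor A.
Proof. by case/vol_scale_fin. Qed.

Lemma lebesgue_tuple_linear d (A : 'M[R]_d) E : A \in unitmx -> measurable E ->
  mu d (tmulmx A @^-1` E) = ((volume_factor A)%:E * mu d E)%E.
Proof.
by move=> Au mE; rewrite vol_scaleE_subproof //; have [_ ->] := vol_scale_fin Au.
Qed.

Lemma volume_factorM d (A B : 'M[R]_d) : A \in unitmx -> B \in unitmx ->
  volume_factor (A *m B) = volume_factor A * volume_factor B.
Proof.
move=> Au Bu; rewrite {1}/volume_factor vol_scale_mul //.
by have [_ ->] := vol_scale_fin Au; have [_ ->] := vol_scale_fin Bu.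
Qed.

Lemma volume_factor1 d : volume_factor (1%:M : 'M[R]_d) = 1.
Proof. by rewrite /volume_factor vol_scale1. Qed.

Lemma volume_factor_scalar d (a : R) : 0 < a ->
  volume_factor (a%:M : 'M[R]_d) = (a ^+ d)^-1.
Proof.
move=> a0; rewrite /volume_factor /vol_scale.
rewrite (_ : tmulmx _ @^-1` _ = @tscale R d a @^-1` cube 2^-1); last first.
  by apply/seteqP; split => t /=; rewrite tmulmx_scalar.
rewrite lebesgue_tuple_scale //; last exact: measurable_cube.
by rewrite lebesgue_cube_half mule1.
Qed.

Lemma volume_factor_involution d (A : 'M[R]_d) : A *m A = 1%:M ->
  volume_factor A = 1.
Proof.
move=> AA; have Au : A \in unitmx by case/mulmx1_unit: AA.
have h := volume_factorM Au Au; rewrite AA volume_factor1 in h.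
have := volume_factor_gt0 Au => v0.
by apply/eqP; rewrite -(@eqrXn2 _ 2) ?expr1n ?ltW // expr2 -h.
Qed.

End haar.

(** * Volumes of cylinders and of truncated cones *)

Section volume_of_cones.
Context {R : realType}.
Local Notation mu := (lebesgue_tuple R).

(** Infinitely many disjoint translates of one cube along v lie in S. *)
Lemma lebesgue_cylinder_infty d (S : set (d.-tuple R)) (v : d.-tuple R) (r : R)
    (j : 'I_d) :
  measurable S -> 0 < r -> cube r `<=` S -> tnth v j != 0 ->
  (forall a t, S t -> S (tadd (tscale a v) t)) -> mu d S = +oo%E.
Proof.
move=> mS r0 rS vj Sv.
(* A translation by b v moves coordinate j by 3 r, more than the side 2 r of the cube, so successive
   translates are disjoint. *)
pose b := 3 * r / tnth v j.
pose E (k : nat) := tadd (tscale (- (k%:R * b)) v) @^-1` cube r.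
have mE k : measurable (E k).
  by apply: measurableTI; [exact: measurable_taddl|exact: measurable_cube].
have muE k : mu d (E k) = ((2 * r) ^+ d)%:E.
  by rewrite lebesgue_tuple_shift ?lebesgue_cube ?ltW //; exact: measurable_cube.
have ES k : E k `<=` S.
  move=> t /rS /(Sv (k%:R * b)); congr S; apply: eq_from_tnth => i.
  by rewrite !tnth_mktuple; ring.
have tE : trivIset setT E.
  apply/trivIsetP => k l _ _ kl; apply/seteqP; split => // t [/= /(_ j) + /(_ j)].
  rewrite !tnth_mktuple !mulNr /b.
  rewrite -!mulrA mulVf // mulr1 !ler_norml => h1 h2.
  have : `|k%:R - l%:R : R| < 1.
    rewrite ltr_norml; have := r0; have := h1; have := h2; clear; nra.
  move: kl; rewrite neq_ltn => /orP[] kl.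
    rewrite distrC -natrB 1?ltnW // normr_nat.
    by rewrite -[X in _ < X]/(1%:R) ltr_nat ltnS leqn0 subn_eq0 leqNgt kl.
  rewrite -natrB 1?ltnW // normr_nat.
  by rewrite -[X in _ < X]/(1%:R) ltr_nat ltnS leqn0 subn_eq0 leqNgt kl.
have lb n : ((n%:R * (2 * r) ^+ d)%:E <= mu d S)%E.
  rewrite (_ : _%:E = mu d (\big[setU/set0]_(i < n) E i)).
    apply: le_measure; rewrite ?inE //; first exact: bigsetU_measurable.
    by move=> t; rewrite -bigcup_mkord => -[k _] /ES.
  rewrite measure_bigsetU_ord //; last first.
    by apply/trivIsetP => k l _ _ kl; move/trivIsetP : tE; apply.
  rewrite (eq_bigr (fun=> ((2 * r) ^+ d)%:E)); last by move=> i _; exact: muE.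
  by rewrite sumEFin sumr_const card_ord mulr_natl.
have : (0 <= mu d S)%E by exact: measure_ge0.
case: (mu d S) lb => [x| |] // lb _.
have c0 : 0 < (2 * r) ^+ d by rewrite exprn_gt0 // mulr_gt0.
have := lb (Num.truncn (x / (2 * r) ^+ d)).+1.
rewrite lee_fin -ler_pdivlMr // leNgt => /negP[].
exact: truncnS_gt.
Qed.

(** The value is 1 / (d + 1). It occurs on both sides of the final comparison, so being positive and
    finite is what matters. *)
Definition cone_factor d : \bar R :=
  (\int[lebesgue_measure]_(x in `]0%R, 1%R]) (x ^+ d)%:E)%E.

Lemma measurable_exprn d (D : set R) : measurable_fun D (fun x : R => (x ^+ d)%:E).
Proof.
apply: measurable_funTS; apply/measurable_EFinP.
exact: (@measurable_funX _ (measurableTypeR R) _ setT id).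
Qed.

Lemma cone_factor_lt_pinfty d : (cone_factor d < +oo)%E.
Proof.
apply: (@le_lt_trans _ _ (\int[lebesgue_measure]_(x in `]0%R, 1%R]) (cst 1 x))%E).
  apply: ge0_le_integral => //=.
  - by move=> x; rewrite in_itv /= => /andP[x0 _]; rewrite lee_fin exprn_ge0 // ltW.
  - exact: measurable_exprn.
  - move=> x; rewrite in_itv /= => /andP[x0 x1].
    by rewrite lee_fin exprn_ile1 // ltW.
rewrite integral_cst //= lebesgue_measure_itv /= lte_fin ltr01 mul1e.
by rewrite -EFinB ltry.
Qed.

Lemma cone_factor_gt0 d : (0 < cone_factor d)%E.
Proof.
apply: (@lt_le_trans _ _
  (\int[lebesgue_measure]_(x in `]2^-1%R, 1%R]) (cst ((2^-1) ^+ d)%:E x))%E).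
  rewrite integral_cst //= lebesgue_measure_itv /= lte_fin ifT; last by lra.
  by rewrite -EFinB -EFinM lte_fin mulr_gt0 ?exprn_gt0 //; lra.
apply: (@le_trans _ _ (\int[lebesgue_measure]_(x in `]2^-1%R, 1%R]) (x ^+ d)%:E)%E).
  apply: ge0_le_integral => //=.
  - exact: measurable_exprn.
  - move=> x; rewrite in_itv /= => /andP[x0 x1].
    by rewrite lee_fin lerXn2r ?nnegrE //; lra.
apply: ge0_subset_integral => //=.
- exact: measurable_exprn.
- by move=> x; rewrite in_itv /= => /andP[x0 _]; rewrite lee_fin exprn_ge0 // ltW.
- by move=> x /=; rewrite !in_itv /= => /andP[x0 ->]; rewrite andbT; lra.
Qed.

(** Tonelli along the first coordinate: the slice at height x is the dilate x K, of volume x^d times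
    that of K. The slice at height 0 is left unspecified, since a single height is negligible. *)
Lemma lebesgue_cone d (E : set (d.+1.-tuple R)) (K : set (d.-tuple R)) :
  measurable E -> measurable K ->
  (forall x t, E (tcons (x, t)) -> 0 <= x <= 1) ->
  (forall x t, 0 < x <= 1 -> E (tcons (x, t)) <-> K (tscale x^-1 t)) ->
  mu d.+1 E = (cone_factor d * mu d K)%E.
Proof.
move=> mE mK E01 EK.
rewrite lebesgue_tupleS.
have mf := measurable_fun_tcons_section mE.
set f := fun x => _ in mf.
transitivity (\int[lebesgue_measure]_(x in `[0%R, 1%R]) f x)%E.
  rewrite [RHS]integral_mkcond; apply: eq_integral => x _.
  rewrite patchE; case: ifPn => // x01.
  rewrite /f (_ : mkset _ = set0) ?measure0 //.
  apply/seteqP; split => t //= /E01 h; move: x01.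
  by rewrite notin_setE /= in_itv /= h.
rewrite -integral_itv_obnd_cbnd; last exact: measurable_funTS.
rewrite /cone_factor -ge0_integralZr //=; last 2 first.
- exact: measurable_exprn.
- by move=> x; rewrite in_itv /= => /andP[x0 _]; rewrite lee_fin exprn_ge0 // ltW.
apply: eq_integral => x; rewrite inE /= in_itv /= => x01.
have x0 : 0 < x by case/andP: x01.
rewrite /f (_ : mkset _ = @tscale R d x^-1 @^-1` K); last first.
  by apply/seteqP; split => t /=; rewrite EK.
by rewrite lebesgue_tuple_scale ?invr_gt0 // exprVn invrK.
Qed.

End volume_of_cones.

(** * Moments of the uniform law on the sphere *)

Section sphere_moments.
Context {R : realType} (k : nat).
Local Notation mu := (lebesgue_tuple R).
Local Notation P := (sphere_prob R k).

Lemma sphere_probE A : P A =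
  mnormalize (mrestr (mu k) (@measurable_unit_ball R k))
    (\d_ ([tuple of nseq k 0] : k.-tuple R)) (@radial R k @^-1` A).
Proof. by []. Qed.

(** These symmetries suffice to compute second moments. The hypotheses on e and s below make the map
    an involution, so that it preserves volume by [volume_factor_involution]. *)
Definition signed_perm_mx (e : 'I_k -> R) (s : 'I_k -> 'I_k) : 'M[R]_k :=
  \matrix_(i, j) (e j * (i == s j)%:R).

Section signed_perm.
Variables (e : 'I_k -> R) (s : 'I_k -> 'I_k).
Hypotheses (e2 : forall j, e j ^+ 2 = 1) (es : forall j, e (s j) = e j)
  (sK : involutive s).
Local Notation g := (tmulmx (signed_perm_mx e s)).

Lemma tnth_signed_perm t j : tnth (g t) j = e j * tnth t (s j).
Proof.
rewrite tnth_mktuple mxE (bigD1 (s j)) //= !mxE eqxx mulr1 big1 ?addr0.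
  by rewrite mulrC.
by move=> i /negbTE h; rewrite !mxE h !mulr0.
Qed.

Lemma signed_perm_involutive : involutive g.
Proof.
move=> t; apply: eq_from_tnth => j; rewrite !tnth_signed_perm es sK mulrA.
by rewrite -expr2 e2 mul1r.
Qed.

Lemma signed_perm_mx_sqr : signed_perm_mx e s *m signed_perm_mx e s = 1%:M.
Proof.
apply/row_matrixP => i; rewrite !rowE mulmx1 mulmxA.
have := signed_perm_involutive (row_tuple (delta_mx 0 i)).
by move=> /(congr1 (@tuple_row R k)); rewrite !tmulmxE row_tupleK.
Qed.

Lemma sqnorm_signed_perm t : sqnorm (g t) = sqnorm t.
Proof.
rewrite /sqnorm (reindex_inj (inv_inj sK)) /=; apply: eq_bigr => j _.
by rewrite tnth_signed_perm sK exprMn e2 mul1r.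
Qed.

Lemma radial_signed_perm t : radial (g t) = g (radial t).
Proof.
apply: eq_from_tnth => j.
rewrite [RHS]tnth_signed_perm [LHS]tnth_mktuple sqnorm_signed_perm.
by rewrite tnth_signed_perm tnth_mktuple mulrA.
Qed.

Lemma lebesgue_tuple_signed_perm A : measurable A -> mu k (g @^-1` A) = mu k A.
Proof.
move=> mA; have h := signed_perm_mx_sqr.
rewrite lebesgue_tuple_linear //; last by case/mulmx1_unit: h.
by rewrite volume_factor_involution // mul1e.
Qed.

(** Lebesgue measure and the ball are invariant under g, and [radial] commutes with g. The fallback
    Dirac mass of [mnormalize] sits at the origin, which g fixes. *)
Lemma sphere_prob_signed_perm A : measurable A -> P (g @^-1` A) = P A.
Proof.
move=> mA.
have mrA : measurable (@radial R k @^-1` A).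
  by apply: measurableTI => //; exact: measurable_radial.
have gr : @radial R k @^-1` (g @^-1` A) = g @^-1` (@radial R k @^-1` A).
  by apply/seteqP; split => t /=; rewrite radial_signed_perm.
rewrite !sphere_probE gr /mnormalize.
case: ifPn => _.
  rewrite /= !diracE; congr (_%:R%:E); congr (nat_of_bool _).
  apply/idP/idP; rewrite !inE /=; congr (A (radial _));
    by apply: eq_from_tnth => j; rewrite tnth_signed_perm !(tnth_nth 0) /=
      !nth_nseq !ltn_ord mulr0.
congr (_ * _)%E; rewrite /mrestr /=.
rewrite -[RHS]lebesgue_tuple_signed_perm; last first.
  by apply: measurableI => //; exact: measurable_unit_ball.
congr (lebesgue_tuple R k _); apply/seteqP; split => t /=;
  by rewrite /unit_ball /= sqnorm_signed_perm.
Qed.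

End signed_perm.

Lemma measurable_sphere : measurable (@sphere R k).
Proof.
rewrite (_ : @sphere R k = (@sqnorm R k) @^-1` [set 1]) //.
by apply: measurableTI => //; exact: measurable_sqnorm.
Qed.

Lemma sphere_coord_le1 t i : @sphere R k t -> `|tnth t i| <= 1.
Proof.
rewrite /sphere /= => t1; rewrite -(@ler_pXn2r _ 2) ?nnegrE // expr1n.
rewrite real_normK ?num_real // -t1 /sqnorm (bigD1 i) //= lerDl.
by apply: sumr_ge0 => j _; exact: sqr_ge0.
Qed.

Lemma cube_sub_ball : cube (k.+1%:R^-1) `<=` @unit_ball R k.
Proof.
move=> t /= h; rewrite /unit_ball /= /sqnorm.
apply: (@le_trans _ _ (\sum_(i < k) k.+1%:R^-1)).
  apply: ler_sum => i _; rewrite -real_normK ?num_real //.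
  rewrite (le_trans _ (h i)) // expr2 ler_piMl // (le_trans (h i)) //.
  by rewrite invf_le1 ?ltr0n // ler1n.
rewrite sumr_const card_ord -[leLHS]mulr_natl ler_pdivrMr ?ltr0n // mul1r ler_nat.
exact: leqnSn.
Qed.

Lemma ball_sub_cube : @unit_ball R k `<=` cube 1.
Proof.
move=> t /= h i; rewrite -(@ler_pXn2r _ 2) ?nnegrE // expr1n.
rewrite real_normK ?num_real // (le_trans _ h) // /sqnorm (bigD1 i) //= lerDl.
by apply: sumr_ge0 => j _; exact: sqr_ge0.
Qed.

Lemma lebesgue_ball_gt0 : (0 < mu k (@unit_ball R k))%E.
Proof.
apply: (@lt_le_trans _ _ (mu k (cube (k.+1%:R^-1)))).
  by rewrite lebesgue_cube ?invr_ge0 // lte_fin exprn_gt0 // mulr_gt0 ?invr_gt0.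
apply: le_measure; rewrite ?inE; first exact: measurable_cube.
  exact: measurable_unit_ball.
exact: cube_sub_ball.
Qed.

Lemma lebesgue_ball_lt_pinfty : (mu k (@unit_ball R k) < +oo)%E.
Proof.
apply: (@le_lt_trans _ _ (mu k (cube 1))).
  apply: le_measure; rewrite ?inE; first exact: measurable_unit_ball.
    exact: measurable_cube.
  exact: ball_sub_cube.
by rewrite lebesgue_cube // ltry.
Qed.

Definition origin : set (k.-tuple R) := [set t | sqnorm t = 0].

Lemma measurable_origin : measurable origin.
Proof.
rewrite (_ : origin = (@sqnorm R k) @^-1` [set 0]) //.
by apply: measurableTI => //; exact: measurable_sqnorm.
Qed.

Lemma sqnorm_scale (a : R) (t : k.-tuple R) :
  sqnorm (tscale a t) = a ^+ 2 * sqnorm t.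
Proof.
by rewrite /sqnorm mulr_sumr; apply: eq_bigr => i _; rewrite tnth_mktuple exprMn.
Qed.

(** The origin is its own preimage under the dilation by 2, so its volume x, finite because it lies
    in the ball, satisfies x = 2^-k x. *)
Lemma lebesgue_origin : (0 < k)%N -> mu k origin = 0%E.
Proof.
move=> k0.
have := lebesgue_tuple_scale (ltr0n R 2) measurable_origin.
rewrite (_ : _ @^-1` _ = origin); last first.
  apply/seteqP; split => t /=; rewrite /origin /= sqnorm_scale.
    by move=> /eqP; rewrite mulf_eq0 expf_eq0 /= pnatr_eq0 /= => /eqP.
  by move->; rewrite mulr0.
have : (mu k origin < +oo)%E.
  apply: le_lt_trans lebesgue_ball_lt_pinfty.
  apply: le_measure;
    rewrite ?inE; [exact: measurable_origin|exact: measurable_unit_ball|].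
  by move=> t; rewrite /origin /unit_ball /= => ->.
have : (0 <= mu k origin)%E by exact: measure_ge0.
case: (mu k origin) => [x| |] //; rewrite lee_fin => x0 _ [] /eqP.
rewrite eq_sym -subr_eq0 -{2}(mul1r x) -mulrBl mulf_eq0 => /orP[|/eqP -> //].
rewrite subr_eq0 invr_eq1 => /eqP h.
have : (1 : R) < 2 ^+ k by rewrite exprn_egt1 ?ltr1n // -lt0n.
by rewrite h ltxx.
Qed.

(** [radial] sends every point except the origin to the sphere, and the origin is negligible. *)
Lemma sphere_prob_sphere : (0 < k)%N -> P (@sphere R k) = 1%E.
Proof.
move=> k0.
suff : P (~` @sphere R k) = 0%E.
  move=> h; have := probability_setC P measurable_sphere; rewrite h.
  have : P (@sphere R k) \is a fin_num.
    by apply: fin_num_measure; exact: measurable_sphere.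
  case: (P (@sphere R k)) => [x| |] // _ [] /esym /eqP.
  by rewrite subr_eq0 => /eqP <-.
rewrite sphere_probE /mnormalize.
have vT : mrestr (mu k) (@measurable_unit_ball R k) setT = mu k (@unit_ball R k).
  by rewrite /mrestr setTI.
case: ifPn => [/orP[] /eqP h|_].
- by have := lebesgue_ball_gt0; rewrite (etrans (esym vT) h) ltxx.
- by have := lebesgue_ball_lt_pinfty; rewrite (etrans (esym vT) h) ltxx.
apply: etrans (mul0e _); congr (_ * _)%E.
apply/eqP; rewrite eq_le measure_ge0 andbT -(lebesgue_origin k0).
apply: le_measure; rewrite ?inE.
- apply: measurableI; last exact: measurable_unit_ball.
  apply: measurableTI; first exact: measurable_radial.
  by apply: measurableC; exact: measurable_sphere.
- exact: measurable_origin.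
move=> t [/= + _]; apply: contra_notP => t0.
rewrite /sphere /= /sqnorm.
under eq_bigr do rewrite tnth_mktuple exprMn exprVn sqr_sqrtr ?sqnorm_ge0 //.
by rewrite -mulr_suml divff //; apply/eqP.
Qed.

Lemma sphere_integrable (f : k.-tuple R -> R) (M : R) :
  measurable_fun setT f -> (forall t, sphere t -> `|f t| <= M) ->
  P.-integrable (@sphere R k) (EFin \o f).
Proof.
move=> mf fM; apply: measurable_bounded_integrable.
- exact: measurable_sphere.
- by rewrite (le_lt_trans (probability_le1 _ _)) ?ltry //; exact: measurable_sphere.
- exact: measurable_funTS.
- exists M; split; first exact: num_real.
  by move=> x Mx t /fM /le_trans; apply; exact: ltW.
Qed.

Definition moment2 (a b : 'I_k) : R :=
  \int[P]_(t in @sphere R k) (tnth t a * tnth t b).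

Lemma measurable_coord2 a b :
  measurable_fun [set: k.-tuple R] (fun t => tnth t a * tnth t b).
Proof. by apply: measurable_funM; exact: measurable_tnthT. Qed.

Lemma integrable_coord2 a b :
  P.-integrable (@sphere R k) (EFin \o (fun t => tnth t a * tnth t b)).
Proof.
apply: (@sphere_integrable _ 1); first exact: measurable_coord2.
move=> t ts; rewrite normrM -[leRHS](mulr1 1).
by apply: ler_pM => //; exact: sphere_coord_le1.
Qed.

Lemma moment2_signed_perm e s a b : (forall j, e j ^+ 2 = 1) ->
  (forall j, e (s j) = e j) -> involutive s ->
  moment2 a b = e a * e b * moment2 (s a) (s b).
Proof.
move=> e2 es sK; rewrite /moment2.
set g := tmulmx (signed_perm_mx e s).
have mg : measurable_fun setT g by exact: measurable_tmulmx.
have gS : g @^-1` (@sphere R k) = @sphere R k.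
  by apply/seteqP; split => t /=; rewrite /sphere /= sqnorm_signed_perm.
have E : (EFin \o (fun t => tnth t a * tnth t b)) \o g =
    (EFin \o (fun t => e a * e b * (tnth t (s a) * tnth t (s b)))).
  by apply/funext => t /=; rewrite !tnth_signed_perm mulrACA.
have := @integral_pushforward _ _ _ _ R g mg P (@sphere R k)
   (EFin \o (fun t => tnth t a * tnth t b)).
rewrite gS E => h.
rewrite -RintegralZl; [|exact: measurable_sphere|exact: integrable_coord2].
rewrite {2}/Rintegral -h //.
- congr fine; apply: eq_measure_integral => A mA _.
  exact: (esym (sphere_prob_signed_perm e2 es sK mA)).
- by apply/measurable_EFinP; exact: measurable_coord2.
- have := integrableZl measurable_sphere (e a * e b) (integrable_coord2 (s a) (s b)).
  by apply: eq_integrable => //; exact: measurable_sphere.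
- exact: measurable_sphere.
Qed.

Lemma moment2_neq a b : a != b -> moment2 a b = 0.
Proof.
move=> ab; pose e j : R := if j == a then -1 else 1.
have ea : e a = -1 by rewrite /e eqxx.
have eb : e b = 1 by rewrite /e eq_sym (negbTE ab).
have := @moment2_signed_perm e id a b.
rewrite ea eb mulr1 mulN1r => h.
have {}h : moment2 a b = - moment2 a b.
  by apply: h => // j; rewrite /e; case: ifP => _; rewrite ?sqrrN expr1n.
by lra.
Qed.

Lemma moment2_eq a b : moment2 a a = moment2 b b.
Proof.
rewrite (@moment2_signed_perm (fun=> 1) (tperm a b)) ?mul1r ?tpermL //.
  by move=> _; rewrite expr1n.
exact: tpermK.
Qed.

Lemma moment2_sum : (0 < k)%N -> \sum_a moment2 a a = 1.
Proof.
move=> k0.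
have : \int[P]_(t in @sphere R k) 1 = 1 :> R.
  rewrite (Rintegral_cst P measurable_sphere).
  by rewrite mul1r -[RHS]/(fine 1%E); congr fine; exact: sphere_prob_sphere.
have -> : \int[P]_(t in @sphere R k) 1 =
    \int[P]_(t in @sphere R k) (\sum_(a <- enum 'I_k) (tnth t a * tnth t a)).
  apply: eq_Rintegral => t; rewrite inE => ts.
  by rewrite big_enum /= -[LHS]ts; apply: eq_bigr => a _; rewrite expr2.
move=> <-; rewrite -big_enum /=.
have := integrable_coord2; rewrite /moment2.
elim: (enum 'I_k) => [|a s IH] ic.
  rewrite big_nil; under eq_Rintegral do rewrite big_nil.
  by rewrite (Rintegral_cst P measurable_sphere) mul0r.
rewrite big_cons IH // -RintegralD //.
- by apply: eq_Rintegral => t _; rewrite big_cons.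
- exact: measurable_sphere.
- have {}IH : forall s', P.-integrable (@sphere R k)
      (EFin \o (fun t => \sum_(a <- s') (tnth t a * tnth t a))).
    elim=> [|b s' IHs].
      apply: (@sphere_integrable _ 0) => [|t _]; last by rewrite big_nil normr0.
      rewrite (_ : (fun t => _) = cst 0); first exact: measurable_cst.
      by apply/funext => t; rewrite big_nil.
    have := integrableD measurable_sphere (ic b b) IHs.
    by apply: eq_integrable; [exact: measurable_sphere|move=> t _ /=; rewrite big_cons].
  exact: IH.
Qed.

(** Flipping the sign of one coordinate kills the mixed moments, transpositions make the diagonal
    ones equal, and the latter sum to 1 on the sphere. *)
Lemma moment2E a b : moment2 a b = (a == b)%:R / k%:R.
Proof.
have k0 : (0 < k)%N by exact: leq_ltn_trans (ltn_ord a).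
have [<-|ab] := eqVneq a b; last by rewrite moment2_neq ?mul0r.
have := moment2_sum k0; under eq_bigr => c _ do rewrite (moment2_eq c a).
rewrite sumr_const card_ord => h.
have k1 : k%:R != 0 :> R by rewrite pnatr_eq0 -lt0n.
by apply: (mulfI k1); rewrite [LHS]mulr_natl h mul1r divff.
Qed.

End sphere_moments.

Section moment4.
Context {R : realType} (k l : nat).
Local Notation P := (sphere_prob R k).
Local Notation Q := (sphere_prob R l).
Local Notation T := (@sphere R k `*` @sphere R l).

Lemma measurable_T : measurable T.
Proof. by apply: measurableX; exact: measurable_sphere. Qed.

Lemma T_integrable (f : k.-tuple R * l.-tuple R -> R) (M : R) :
  measurable_fun setT f -> (forall p, T p -> `|f p| <= M) ->
  (P \x Q)%E.-integrable T (EFin \o f).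
Proof.
move=> mf fM; apply: measurable_bounded_integrable.
- exact: measurable_T.
- by rewrite (le_lt_trans (probability_le1 _ _)) ?ltry //; exact: measurable_T.
- exact: measurable_funTS.
- exists M; split; first exact: num_real.
  by move=> x Mx t /fM /le_trans; apply; exact: ltW.
Qed.

Definition coord4 (a b : 'I_k) (c d : 'I_l) (p : k.-tuple R * l.-tuple R) : R :=
  (tnth p.1 a * tnth p.1 b) * (tnth p.2 c * tnth p.2 d).

Lemma measurable_coord4 a b c d : measurable_fun setT (coord4 a b c d).
Proof.
apply: measurable_funM.
  by apply: (measurableT_comp (measurable_coord2 a b)); exact: measurable_fst.
by apply: (measurableT_comp (measurable_coord2 c d)); exact: measurable_snd.
Qed.

Lemma coord4_le1 a b c d p : T p -> `|coord4 a b c d p| <= 1.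
Proof.
case=> /= p1 p2; rewrite /coord4 !normrM -[leRHS](mulr1 1).
by apply: ler_pM => //; rewrite ?mulr_ge0 // -[leRHS](mulr1 1); apply: ler_pM => //;
  exact: sphere_coord_le1.
Qed.

Lemma integrable_coord4 a b c d :
  (P \x Q)%E.-integrable T (EFin \o coord4 a b c d).
Proof.
apply: (@T_integrable _ 1); first exact: measurable_coord4.
exact: coord4_le1.
Qed.

Lemma moment4E a b c d :
  \int[(P \x Q)%E]_(p in T) coord4 a b c d p = moment2 a b * moment2 c d.
Proof.
have mS1 := @measurable_sphere R k; have mS2 := @measurable_sphere R l.
rewrite /Rintegral integral_mkcond.
have int4 : (P \x Q)%E.-integrable setT ((EFin \o coord4 a b c d) \_ T).
  by apply/(integrable_mkcond _ measurable_T); exact: integrable_coord4.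
rewrite -integral12_prod_meas1 //.
pose f := fun t : k.-tuple R => tnth t a * tnth t b.
pose g := fun t : l.-tuple R => tnth t c * tnth t d.
have intf : P.-integrable (@sphere R k) (EFin \o f) by exact: integrable_coord2.
have intg : Q.-integrable (@sphere R l) (EFin \o g) by exact: integrable_coord2.
have cf : (\int[P]_(t in @sphere R k) (f t)%:E)%E \is a fin_num.
  exact: integrable_fin_num intf.
have cg : (\int[Q]_(t in @sphere R l) (g t)%:E)%E \is a fin_num.
  exact: integrable_fin_num intg.
rewrite -[moment2 a b]/(fine (\int[P]_(t in @sphere R k) (f t)%:E)%E).
rewrite -[moment2 c d]/(fine (\int[Q]_(t in @sphere R l) (g t)%:E)%E).
rewrite -fineM //; congr fine.
rewrite -[in RHS](fineK cg) muleC -integralZl //.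
rewrite [RHS]integral_mkcond; apply: eq_integral => x _.
rewrite patchE; case: ifPn => [xS|xS].
  rewrite inE in xS.
  rewrite fineK // muleC -integralZl // /fubini_F [RHS]integral_mkcond.
  apply: eq_integral => y _; rewrite !patchE.
  case: (boolP (y \in @sphere R l)) => yS.
    by rewrite ifT ?EFinM // inE; split => //=; rewrite inE in yS.
  by rewrite ifF //; apply/negbTE; move: yS; rewrite !notin_setE => yS [].
rewrite /fubini_F integral0_eq // => y _; rewrite patchE ifF //.
by apply/negbTE; move: xS; rewrite !notin_setE => xS [].
Qed.

End moment4.

(** * Biquadratic forms as Hermitian matrices *)

Lemma sum_mxvec (V : nmodType) n m (F : 'I_(n * m) -> V) :
  \sum_p F p = \sum_i \sum_k F (mxvec_index i k).
Proof.
by rewrite (reindex _ (curry_mxvec_bij _ _)) pair_bigA; apply: eq_bigr => -[].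
Qed.

(** A real matrix X and its Hermitian counterpart [hermmx X] can be compared only after pairing the
    entries (p, q) and (q, p). *)
Lemma eq_sum_sym (K : numFieldType) (V : lmodType K) N (F G : 'I_N -> 'I_N -> V) :
  (forall p q, F p q + F q p = G p q + G q p) ->
  \sum_p \sum_q F p q = \sum_p \sum_q G p q.
Proof.
move=> FG.
have two (A : 'I_N -> 'I_N -> V) :
    \sum_p \sum_q A p q = 2^-1 *: \sum_p \sum_q (A p q + A q p).
  under [in RHS]eq_bigr do rewrite big_split.
  rewrite big_split /= [X in _ + X]exchange_big -mulr2n.
  by rewrite -[X in _ *: X]scaler_nat scalerA mulVf ?scale1r // pnatr_eq0.
rewrite (two F) (two G); congr (_ *: _).
by apply: eq_bigr => p _; apply: eq_bigr => q _; exact: FG.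
Qed.

(** Scalars become elements of the algebra, so that [ring] can prove identities that mix scaling and
    products. *)
Lemma scale_as_mul (K : comNzRingType) (B : comAlgType K) (j : K) :
  exists J : B, forall x : B, j *: x = J * x.
Proof. by exists j%:A => x; rewrite mulr_algl. Qed.

Lemma rmorph_mul_imaginary (K A : comNzRingType)
    (B : comAlgType K) (f : {rmorphism A -> B}) (j : K) (x x' y y' : A) :
  j * j = -1 ->
  f (x * y - x' * y') + j *: f (x * y' + x' * y) =
  (f x + j *: f x') * (f y + j *: f y').
Proof.
move=> jj; have [J JE] := scale_as_mul B j.
have JJ z : J * (J * z) = - z by rewrite -!JE scalerA jj scaleN1r.
rewrite rmorphB rmorphD !rmorphM /= !JE.
transitivity (f x * f y + J * (J * (f x' * f y')) +
    J * (f x * f y' + f x' * f y)); first by rewrite JJ.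
by ring.
Qed.

Lemma rmorph_herm_term (K A : comNzRingType)
    (B : comAlgType K) (f : {rmorphism A -> B}) (j s t : K) (a b a' b' : A) :
  j * j = -1 ->
  (s + j * t) *: ((f a - j *: f b) * (f a' + j *: f b')) +
  (s - j * t) *: ((f a' - j *: f b') * (f a + j *: f b)) =
  (s + t) *: f (a * a' + b * b' + b * a' - a * b') +
  (s - t) *: f (a' * a + b' * b + b' * a - a' * b).
Proof.
move=> jj; have [J JE] := scale_as_mul B j.
have [S SE] := scale_as_mul B s; have [T TE] := scale_as_mul B t.
have JJ : J * J = -1 by rewrite -[J * J]mulr1 -mulrA -!JE scalerA jj scaleN1r.
rewrite !(rmorphB, rmorphD, rmorphM) /=.
rewrite !(scalerDl, scaleNr) -!(scalerA j) !JE !SE !TE.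
apply/eqP; rewrite -subr_eq0; apply/eqP.
transitivity ((J * J + 1) *
  (2 * T * (f a * f b' - f b * f a') - 2 * S * (f b * f b'))); first by ring.
by rewrite JJ addNr mul0r.
Qed.

Section self_adjoint_coordinates.
Context {R : realType}.
Local Notation C := R[i].

(* X |-> hermmx X = sym X + i alt X is a real-linear bijection from M_N(R)
   onto the Hermitian matrices of size N, with inverse unhermmx. *)
Definition hermmx N (X : 'M[R]_N) : 'M[C]_N :=
  \matrix_(p, q) (((X p q + X q p) / 2) +i* ((X p q - X q p) / 2))%C.

Definition unhermmx N (H : 'M[C]_N) : 'M[R]_N :=
  \matrix_(p, q) (complex.Re (H p q) + complex.Im (H p q)).

Definition self_adjoint N (H : 'M[C]_N) := forall p q, H p q = (H q p)^*%C.

Lemma hermmxK N : cancel (@hermmx N) (@unhermmx N).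
Proof. by move=> X; apply/matrixP => p q; rewrite !mxE /=; lra. Qed.

Lemma hermmx_herm N (X : 'M[R]_N) : self_adjoint (hermmx X).
Proof. by move=> p q; rewrite !mxE; congr Complex; lra. Qed.

Lemma unhermmxK N (H : 'M[C]_N) : self_adjoint H -> hermmx (unhermmx H) = H.
Proof.
move=> hH; apply/matrixP => p q; rewrite !mxE (hH q p).
by case: (H p q) => a b /=; congr Complex; lra.
Qed.

(** This is Re(conj s t) - Im(conj s t). In the Hermitian form of sym X + i alt X, the symmetric
    part pairs with the real part and the antisymmetric part with minus the imaginary part, so
    [X p q] gets this weight. *)
Definition rho (s t : C) : R :=
  complex.Re s * complex.Re t + complex.Im s * complex.Im t +
  complex.Im s * complex.Re t - complex.Re s * complex.Im t.

Definition qf N (X : 'M[R]_N) (u : 'rV[C]_N) : R :=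
  \sum_p \sum_q X p q * rho (u 0 p) (u 0 q).

Lemma qfE N (X : 'M[R]_N) u : ((qf X u)%:C)%C =
  \sum_p \sum_q (u 0 p)^*%C * hermmx X p q * u 0 q.
Proof.
rewrite /qf rmorph_sum /=; under eq_bigr do rewrite rmorph_sum.
apply: (@eq_sum_sym C C^o) => p q; rewrite !mxE /= -rmorphD /= /rho.
case: (u 0 p) => a b; case: (u 0 q) => c d /=.
by apply/eqP; rewrite eq_complex /=; apply/andP; split; apply/eqP; field.
Qed.

End self_adjoint_coordinates.

Section polynomials.
Context {R : realType} (n m : nat).
Local Notation C := R[i].
Local Notation N := (n * m)%N.
Local Notation poly_R := (mpoly (nvars n m) R).
Local Notation poly_C := (mpoly (nvars n m) R[i]).
Local Notation cx := (@complexify R n m).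
Local Notation pc := (@pconj R n m).
Local Notation zv := (@zvar R n m).
Local Notation wv := (@wvar R n m).

Lemma complexifyZ (a : R) p : cx (a *: p) = (a%:C)%C *: cx p.
Proof. exact: map_mpolyZ. Qed.

Lemma complexify_sum I (r : seq I) (P : pred I) (F : I -> poly_R) :
  cx (\sum_(i <- r | P i) F i) = \sum_(i <- r | P i) cx (F i).
Proof. exact: (rmorph_sum (map_mpoly (real_complex R))). Qed.

Lemma pconjD p q : pc (p + q) = pc p + pc q.
Proof. exact: (rmorphD (map_mpoly (@conjc R))). Qed.

Lemma pconjM p q : pc (p * q) = pc p * pc q.
Proof. exact: (rmorphM (map_mpoly (@conjc R))). Qed.

Lemma pconj_sum I (r : seq I) (P : pred I) (F : I -> poly_C) :
  pc (\sum_(i <- r | P i) F i) = \sum_(i <- r | P i) pc (F i).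
Proof. exact: (rmorph_sum (map_mpoly (@conjc R))). Qed.

Lemma complexify_inj : injective cx.
Proof.
move=> p q pq; apply/mpolyP => mm.
have E r : mcoeff mm (cx r) = (mcoeff mm r)%:C%C by exact: mcoeff_map_mpoly.
by apply: complexI; rewrite -!E pq.
Qed.

Lemma pconjZ (a : C) p : pc (a *: p) = (a^*)%C *: pc p.
Proof. exact: map_mpolyZ. Qed.

Lemma pconj_complexify p : pc (cx p) = cx p.
Proof.
apply/mpolyP => mm; rewrite [LHS]mcoeff_map_mpoly.
rewrite [mcoeff mm (cx p)]mcoeff_map_mpoly.
exact: conjc_real.
Qed.

Definition repoly (p : 'I_N) : poly_R := mxvec (\matrix_(i < n, k < m)
  (xvar R m (lshift n i) * yvar R n (lshift m k) -
   xvar R m (rshift n i) * yvar R n (rshift m k))) 0 p.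

Definition impoly (p : 'I_N) : poly_R := mxvec (\matrix_(i < n, k < m)
  (xvar R m (lshift n i) * yvar R n (rshift m k) +
   xvar R m (rshift n i) * yvar R n (lshift m k))) 0 p.

Definition bilpoly (p : 'I_N) : poly_C :=
  cx (repoly p) + 'i%C *: cx (impoly p).

Lemma bilpolyE i k : bilpoly (mxvec_index i k) = zv i * wv k.
Proof.
rewrite /bilpoly /repoly /impoly !mxvecE !mxE /zvar /wvar.
apply: (@rmorph_mul_imaginary C poly_R poly_C (map_mpoly (real_complex R))).
by rewrite -expr2 sqr_i.
Qed.

Lemma pconj_bilpoly p : pc (bilpoly p) = cx (repoly p) - 'i%C *: cx (impoly p).
Proof.
have iJ : ('i^*)%C = - 'i%C :> C by apply/eqP; rewrite eq_complex /= oppr0 !eqxx.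
rewrite /bilpoly; move: (repoly p) (impoly p) => x y.
have h : pc ('i%C *: cx y) = - ('i%C *: cx y).
  by rewrite (pconjZ 'i%C (cx y)) (pconj_complexify y) iJ scaleNr.
exact: (etrans (pconjD _ _) (congr2 +%R (pconj_complexify x) h)).
Qed.

(** The weight [rho] at u_p = z_i w_k, whose real and imaginary parts are [repoly p] and [impoly p].
    All of M_N(R) serves as parameter space, with no Hermitian constraint on coordinates. *)
Definition herm_poly (X : 'M[R]_N) : poly_R :=
  \sum_p \sum_q X p q *: (repoly p * repoly q + impoly p * impoly q +
                         impoly p * repoly q - repoly p * impoly q).

Lemma herm_poly_is_linear : linear herm_poly.
Proof.
move=> a X Y; rewrite /herm_poly scaler_sumr -big_split; apply: eq_bigr => p _.
rewrite scaler_sumr -big_split; apply: eq_bigr => q _ /=.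
by rewrite !mxE scalerDl scalerA.
Qed.

HB.instance Definition _ :=
  GRing.isLinear.Build R 'M[R]_N poly_R *:%R herm_poly herm_poly_is_linear.

Lemma complexify_herm_poly X : cx (herm_poly X) =
  \sum_p \sum_q hermmx X p q *: (pc (bilpoly p) * bilpoly q).
Proof.
rewrite /herm_poly complexify_sum.
under eq_bigr do rewrite complexify_sum.
apply: (@eq_sum_sym C) => p q.
apply: (etrans (congr2 +%R (complexifyZ _ _) (complexifyZ _ _))).
generalize (pconj_bilpoly p) (pconj_bilpoly q).
generalize (pc (bilpoly p)) (pc (bilpoly q)) => c1 c2 -> ->.
rewrite /bilpoly.
pose s : C := (((X p q + X q p) / 2)%:C)%C.
pose t : C := (((X p q - X q p) / 2)%:C)%C.
have -> : (X p q)%:C%C = s + t by rewrite -rmorphD /=; congr (_%:C)%C; lra.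
have -> : (X q p)%:C%C = s - t by rewrite -rmorphB /=; congr (_%:C)%C; lra.
have -> : hermmx X p q = s + 'i%C * t.
  rewrite mxE; apply/eqP.
  by rewrite eq_complex /= !(mul0r, mul1r, mulr0, addr0, add0r, subr0) !eqxx.
have -> : hermmx X q p = s - 'i%C * t.
  rewrite mxE; apply/eqP; rewrite eq_complex /=.
  rewrite !(mul0r, mul1r, mulr0, addr0, add0r, subr0).
  by apply/andP; split; apply/eqP; lra.
apply: esym.
apply: (@rmorph_herm_term C poly_R poly_C (map_mpoly (real_complex R))).
by rewrite -expr2 sqr_i.
Qed.

End polynomials.

(** * Polarization, on all vectors and on product vectors *)

Section sesquilinear_forms.
Context {R : realType}.
Local Notation C := R[i].

Definition sesq N (G : 'M[C]_N) (u v : 'rV[C]_N) : C :=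
  (map_mx conjc u *m G *m v^T) 0 0.

Lemma sesqE N (G : 'M[C]_N) u v :
  sesq G u v = \sum_p \sum_q (u 0 p)^*%C * G p q * v 0 q.
Proof.
rewrite /sesq mxE exchange_big /=; apply: eq_bigr => q _.
rewrite !mxE mulr_suml; apply: eq_bigr => p _.
by rewrite !mxE.
Qed.

Lemma sesqDl N (G : 'M[C]_N) u u' v : sesq G (u + u') v = sesq G u v + sesq G u' v.
Proof. by rewrite /sesq map_mxD !mulmxDl mxE. Qed.

Lemma sesqDr N (G : 'M[C]_N) u v v' : sesq G u (v + v') = sesq G u v + sesq G u v'.
Proof. by rewrite /sesq linearD /= mulmxDr mxE. Qed.

Lemma sesqZl N (G : 'M[C]_N) a u v : sesq G (a *: u) v = a^*%C * sesq G u v.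
Proof.
rewrite /sesq (_ : map_mx _ (a *: u) = a^*%C *: map_mx conjc u); last first.
  by apply/matrixP => i j; rewrite !mxE rmorphM.
by rewrite -!scalemxAl mxE.
Qed.

Lemma sesqZr N (G : 'M[C]_N) a u v : sesq G u (a *: v) = a * sesq G u v.
Proof. by rewrite /sesq linearZ /= -scalemxAr mxE. Qed.

Lemma sesq_delta N (G : 'M[C]_N) i j :
  sesq G (delta_mx 0 i) (delta_mx 0 j) = G i j.
Proof.
have d (a b : 'I_N) : (delta_mx 0 a : 'rV[C]_N) 0 b = (b == a)%:R.
  by rewrite mxE eqxx.
rewrite sesqE (bigD1 i) //= [X in _ + X]big1 ?addr0 => [|p /negbTE pi]; last first.
  by apply: big1 => q _; rewrite !d pi conjc0 !mul0r.
rewrite (bigD1 j) //= big1 ?addr0 => [|q /negbTE qj]; last first.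
  by rewrite !d qj mulr0.
by rewrite !d !eqxx conjc1 mul1r mulr1.
Qed.

(** Polarization at e_i + t e_j with t = 1 and t = i shows that the two mixed values are both
    opposite and equal. *)
Lemma sesq_diag_eq0 N (G : 'M[C]_N) : (forall u, sesq G u u = 0) -> G = 0.
Proof.
move=> G0; apply/matrixP => i j; rewrite mxE -sesq_delta.
have h t : t * sesq G (delta_mx 0 i) (delta_mx 0 j) +
           t^*%C * sesq G (delta_mx 0 j) (delta_mx 0 i) = 0.
  have := G0 (delta_mx 0 i + t *: delta_mx 0 j).
  by rewrite sesqDl !sesqDr !sesqZl !sesqZr !G0 !mulr0 addr0 add0r.
have h1 := h 1; have hi := h 'i%C; move: h1 hi.
rewrite conjc1 !mul1r (_ : ('i^*)%C = - 'i%C :> C); last first.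
  by apply/eqP; rewrite eq_complex /= oppr0 !eqxx.
rewrite mulNr -mulrBr => /eqP; rewrite addr_eq0 => /eqP h1.
move/eqP; rewrite mulf_eq0 eq_complex /= oner_eq0 andbF /= subr_eq0 => /eqP h2.
have : sesq G (delta_mx 0 i) (delta_mx 0 j) *+ 2 = 0.
  by rewrite mulr2n {1}h1 h2 addNr.
by move=> /eqP; rewrite -mulr_natr mulf_eq0 pnatr_eq0 orbF => /eqP.
Qed.

Definition tens n m (z : 'rV[C]_n) (w : 'rV[C]_m) : 'rV[C]_(n * m) :=
  mxvec (z^T *m w).

Lemma tensE n m (z : 'rV[C]_n) (w : 'rV[C]_m) i k :
  tens z w 0 (mxvec_index i k) = z 0 i * w 0 k.
Proof. by rewrite mxvecE mxE big_ord1 !mxE. Qed.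

(** Polarization is applied twice: in z for fixed w, which kills the form of each block [K i j] at
    w, then in w for each block. *)
Lemma sesq_tens_eq0 n m (G : 'M[C]_(n * m)) :
  (forall z w, sesq G (tens z w) (tens z w) = 0) -> G = 0.
Proof.
move=> G0.
pose K i j : 'M[C]_m := \matrix_(k, l) G (mxvec_index i k) (mxvec_index j l).
suff K0 i j : K i j = 0.
  apply/matrixP => p q; rewrite mxE.
  case/mxvec_indexP: p => i k; case/mxvec_indexP: q => j l.
  by have /matrixP/(_ k l) := K0 i j; rewrite !mxE.
apply: sesq_diag_eq0 => w.
pose L : 'M[C]_n := \matrix_(i, j) sesq (K i j) w w.
suff -> : sesq (K i j) w w = L i j.
  rewrite (_ : L = 0) ?mxE //; apply: sesq_diag_eq0 => z.
  rewrite -(G0 z w) !sesqE sum_mxvec; apply: eq_bigr => {}i _.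
  under [RHS]eq_bigr do rewrite sum_mxvec.
  rewrite [RHS]exchange_big /=; apply: eq_bigr => {}j _.
  rewrite mxE sesqE mulr_sumr mulr_suml; apply: eq_bigr => k _.
  rewrite mulr_sumr mulr_suml; apply: eq_bigr => l _.
  by rewrite !tensE mxE rmorphM /=; ring.
by rewrite mxE.
Qed.

Lemma qf_sesq N (X : 'M[R]_N) u : ((qf X u)%:C)%C = sesq (hermmx X) u u.
Proof. by rewrite qfE sesqE. Qed.

Lemma hermmx0 N : hermmx (0 : 'M[R]_N) = 0.
Proof. by apply/matrixP => p q; rewrite !mxE !(addr0, subr0, mul0r). Qed.

Lemma qf_tens_eq0 n m (X : 'M[R]_(n * m)) :
  (forall z w, qf X (tens z w) = 0) -> X = 0.
Proof.
move=> X0; apply: (can_inj (@hermmxK R _)); rewrite hermmx0.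
by apply: sesq_tens_eq0 => z w; rewrite -qf_sesq X0.
Qed.

End sesquilinear_forms.

Section gram.
Import spectral sesquilinear.
Context {R : realType}.
Local Notation C := R[i].

(** By the spectral theorem H = P^* diag(d) P with P unitary. Each d_s is the value of the form at
    an eigenvector, hence nonnegative, and b is sqrt(d) P. *)
Lemma psd_gram N (X : 'M[R]_N) : (forall u, 0 <= qf X u) ->
  exists b : 'I_N -> 'I_N -> C, forall p q,
    hermmx X p q = \sum_s (b s p)^*%C * b s q.
Proof.
move=> X0; set H := hermmx X.
have Hh : H \is hermsymmx.
  apply/is_hermitianmxP; rewrite expr0 scale1r; apply/matrixP => p q.
  by rewrite [RHS]mxE [X in Num.conj X]mxE; exact: hermmx_herm.
have /orthomx_spectralP := hermitian_normalmx Hh.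
set P := spectralmx H; set d := spectral_diag H => HE.
have Pu : P \is unitarymx by exact: spectral_unitarymx.
have PPt : P *m (map_mx Num.conj P^T) = 1%:M by apply/unitarymxP.
rewrite invmx_unitary // in HE.
have d0 s : 0 <= d 0 s.
  pose u : 'rV[C]_N := (map_mx Num.conj P^T *m delta_mx s (0 : 'I_1))^T.
  have := X0 u; rewrite -ler0c qf_sesq /sesq trmxK -/H HE.
  have -> : map_mx conjc u = delta_mx 0 s *m P.
    apply/matrixP => i j; rewrite !mxE rmorph_sum; apply: eq_bigr => k _.
    rewrite rmorphM /= !mxE -[(_ ^*)%C]/(Num.conj (Num.conj (P k j))) conjCK mulrC.
    by rewrite [X in X * _]rmorph_nat andbC ord1.
  rewrite -!mulmxA [P *m (map_mx _ _ *m _)]mulmxA PPt mul1mx.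
  rewrite [P *m (map_mx _ _ *m _)]mulmxA PPt mul1mx.
  by rewrite mul_diag_mx -rowE !mxE eqxx mulr1.
exists (fun s p => sqrtc (d 0 s) * P s p) => p q.
rewrite -/H {1}HE mxE; apply: eq_bigr => s _.
rewrite mul_mx_diag !mxE rmorphM /=.
have -> : (sqrtc (d 0 s))^*%C = sqrtc (d 0 s).
  by rewrite sqrtc_sqrtr // conjc_real.
by rewrite mulrACA -expr2 sqr_sqrtc mulrA [_ * d 0 s]mulrC.
Qed.

End gram.

Lemma rmorph_herm_eval (K : comNzRingType)
    (L : comAlgType K) (f : {rmorphism L -> K}) (N : nat) (X : 'M[K]_N)
    (a b : 'I_N -> L) : (forall (c : K) x, f (c *: x) = c * f x) ->
  f (\sum_p \sum_q X p q *: (a p * a q + b p * b q + b p * a q - a p * b q)) =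
  \sum_p \sum_q X p q * (f (a p) * f (a q) + f (b p) * f (b q) +
                         f (b p) * f (a q) - f (a p) * f (b q)).
Proof.
move=> fZ; rewrite rmorph_sum; apply: eq_bigr => p _.
rewrite rmorph_sum; apply: eq_bigr => q _.
by rewrite fZ rmorphB !rmorphD !rmorphM.
Qed.

Section evaluation.
Context {R : realType} (n m : nat).
Local Notation C := R[i].
Local Notation N := (n * m)%N.
Local Notation poly_R := (mpoly (nvars n m) R).
Local Notation poly_C := (mpoly (nvars n m) R[i]).
Local Notation cx := (@complexify R n m).
Local Notation pc := (@pconj R n m).
Local Notation herm_poly := (@herm_poly R n m).

Lemma real_pointl (x : 'I_(n + n) -> R) (y : 'I_(m + m) -> R) j :
  real_point x y (lshift (m + m) j) = x j.
Proof.
rewrite /real_point.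
by rewrite (_ : lshift _ _ = unsplit (inl j)) // unsplitK.
Qed.

Lemma real_pointr (x : 'I_(n + n) -> R) (y : 'I_(m + m) -> R) j :
  real_point x y (rshift (n + n) j) = y j.
Proof.
rewrite /real_point.
by rewrite (_ : rshift _ _ = unsplit (inr j)) // unsplitK.
Qed.

Lemma meval_repoly (v : 'I_(nvars n m) -> R) i k :
  meval v (@repoly R n m (mxvec_index i k)) =
  v (lshift (m + m) (lshift n i)) * v (rshift (n + n) (lshift m k)) -
  v (lshift (m + m) (rshift n i)) * v (rshift (n + n) (rshift m k)).
Proof.
rewrite /repoly mxvecE mxE /xvar /yvar.
apply: etrans (mevalB _ _ _) _; congr (_ - _).
  by apply: etrans (mevalM _ _ _) _; congr (_ * _); exact: mevalXU.
by apply: etrans (mevalM _ _ _) _; congr (_ * _); exact: mevalXU.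
Qed.

Lemma meval_impoly (v : 'I_(nvars n m) -> R) i k :
  meval v (@impoly R n m (mxvec_index i k)) =
  v (lshift (m + m) (lshift n i)) * v (rshift (n + n) (rshift m k)) +
  v (lshift (m + m) (rshift n i)) * v (rshift (n + n) (lshift m k)).
Proof.
rewrite /impoly mxvecE mxE /xvar /yvar.
apply: etrans (mevalD _ _ _) _; congr (_ + _).
  by apply: etrans (mevalM _ _ _) _; congr (_ * _); exact: mevalXU.
by apply: etrans (mevalM _ _ _) _; congr (_ * _); exact: mevalXU.
Qed.

Lemma meval_herm_poly (v : 'I_(nvars n m) -> R) X :
  meval v (herm_poly X) = \sum_p \sum_q X p q *
   (meval v (@repoly R n m p) * meval v (@repoly R n m q) +
    meval v (@impoly R n m p) * meval v (@impoly R n m q) +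
    meval v (@impoly R n m p) * meval v (@repoly R n m q) -
    meval v (@repoly R n m p) * meval v (@impoly R n m q)).
Proof.
apply: (@rmorph_herm_eval R poly_R (meval v)); exact: mevalZ.
Qed.

Lemma meval_complexify (v : 'I_(nvars n m) -> R) f :
  meval (fun i => (v i)%:C%C) (cx f) = (meval v f)%:C%C.
Proof.
rewrite !mevalE (perm_big _ (msupp_map_mpoly _ (@complexI R))) /=.
rewrite rmorph_sum; apply: eq_bigr => mm _.
rewrite rmorphM rmorph_prod /=; congr (_ * _).
  exact: mcoeff_map_mpoly.
by apply: eq_bigr => i _; rewrite rmorphXn.
Qed.

Lemma ceval_herm_poly X z w :
  ceval (cx (herm_poly X)) z w = (qf X (tens z w))%:C%C.
Proof.
apply: etrans (meval_complexify _ _) _; congr (_%:C)%C.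
rewrite meval_herm_poly; apply: eq_bigr => p _; apply: eq_bigr => q _.
congr (_ * _).
case/mxvec_indexP: p => i k; case/mxvec_indexP: q => j l.
rewrite !meval_repoly !meval_impoly !real_pointl !real_pointr !tensE /rho.
rewrite /re_im.
rewrite !(_ : forall p (t : 'I_p), lshift p t = unsplit (inl t)) //.
rewrite !(_ : forall p (t : 'I_p), rshift p t = unsplit (inr t)) //.
rewrite !unsplitK.
case: (z 0 i) => a a'; case: (z 0 j) => b b'; case: (w 0 k) => c c'.
by case: (w 0 l) => d d' /=; ring.
Qed.

(** The zero polynomial vanishes at every complex product vector, and those values determine the
    matrix. *)
Lemma herm_poly_inj : injective herm_poly.
Proof.
move=> X Y XY; apply/eqP; rewrite -subr_eq0; apply/eqP.
apply: qf_tens_eq0 => z w.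
have q0 : herm_poly (X - Y) = 0
  by apply: etrans (linearB _ X Y) _; apply/eqP; rewrite subr_eq0; apply/eqP.
apply: complexI; rewrite -ceval_herm_poly q0.
apply: etrans (meval_complexify _ _) _; congr (_%:C)%C; exact: meval0.
Qed.

End evaluation.

Lemma mul4C (A : comNzRingType) (a b c d : A) :
  (a * b) * (c * d) = a * c * b * d.
Proof. by ring. Qed.

Lemma mul_scaled_sums (K : comNzRingType) (B : comAlgType K) (I : finType)
    (al be : I -> K) (x y : I -> B) :
  (\sum_p al p *: x p) * (\sum_q be q *: y q) =
  \sum_p \sum_q (al p * be q) *: (x p * y q).
Proof.
rewrite mulr_suml; apply: eq_bigr => p _; rewrite mulr_sumr.
by apply: eq_bigr => q _; rewrite -scalerAl -scalerAr scalerA.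
Qed.

(** * The cones of forms in matrix coordinates *)

Section cones.
Context {R : realType} (n m : nat).
Local Notation C := R[i].
Local Notation N := (n * m)%N.
Local Notation poly_R := (mpoly (nvars n m) R).
Local Notation poly_C := (mpoly (nvars n m) R[i]).
Local Notation cx := (@complexify R n m).
Local Notation pc := (@pconj R n m).
Local Notation herm_poly := (@herm_poly R n m).
Local Notation bil := (@bilpoly R n m).
Local Notation zv := (@zvar R n m).
Local Notation wv := (@wvar R n m).

Definition matrix_poly (H : 'M[C]_N) : poly_C :=
  \sum_p \sum_q H p q *: (pc (bil p) * bil q).

Lemma matrix_polyE H : matrix_poly H =
  \sum_(i < n) \sum_(j < n) \sum_(k < m) \sum_(l < m)
    H (mxvec_index i k) (mxvec_index j l) *:
    (pc (zv i) * zv j * pc (wv k) * wv l).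
Proof.
rewrite /matrix_poly sum_mxvec; apply: eq_bigr => i _.
rewrite [RHS]exchange_big; apply: eq_bigr => k _.
rewrite sum_mxvec; apply: eq_bigr => j _; apply: eq_bigr => l _.
apply: congr1.
have h1 : pc (bil (mxvec_index i k)) = pc (zv i) * pc (wv k).
  exact: (etrans (congr1 pc (bilpolyE i k)) (pconjM _ _)).
exact: (etrans (congr2 *%R h1 (bilpolyE j l)) (mul4C _ _ _ _)).
Qed.

Lemma complexify_unhermmx H : self_adjoint H ->
  cx (herm_poly (unhermmx H)) = matrix_poly H.
Proof.
move=> hH; apply: etrans (complexify_herm_poly _) _.
by rewrite unhermmxK.
Qed.

Lemma herm_poly_unique H X : self_adjoint H ->
  cx (herm_poly X) = matrix_poly H -> hermmx X = H.
Proof.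
move=> hH; rewrite -complexify_unhermmx // => /complexify_inj /herm_poly_inj ->.
exact: unhermmxK.
Qed.

(** Real coefficients mean that [hermmx X] is real, that is, that the antisymmetric part of X
    vanishes. *)
Definition ground_matrix (F : ground_field) (X : 'M[R]_N) : Prop :=
  match F with GroundR => X^T = X | GroundC => True end.

Lemma real_model_SymFP F f : real_model (SymF F) f <->
  exists X, ground_matrix F X /\ f = herm_poly X.
Proof.
split=> [[a [aF asym fE]]|[X [XF ->]]].
  pose H : 'M[C]_N := \matrix_(p, q)
    (mxvec (\matrix_(i, k) (mxvec (\matrix_(j, l) a i j k l)) 0 q)) 0 p.
  have HE i j k l : H (mxvec_index i k) (mxvec_index j l) = a i j k l.
    by rewrite mxE mxvecE mxE mxvecE mxE.
  have hH : self_adjoint H.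
    move=> p q; case/mxvec_indexP: p => i k; case/mxvec_indexP: q => j l.
    by rewrite !HE.
  exists (unhermmx H); split; last first.
    apply: complexify_inj; rewrite complexify_unhermmx // fE matrix_polyE.
    do 2 (apply: eq_bigr => ? _); do 2 (apply: eq_bigr => ? _).
    by rewrite HE.
  case: F aF => //= aF.
  have hr p q : complex.Im (H p q) = 0.
    case/mxvec_indexP: p => i k; case/mxvec_indexP: q => j l.
    by rewrite HE; exact: aF.
  have uE p q : unhermmx H p q = complex.Re (H p q) by rewrite mxE hr addr0.
  by apply/matrixP => p q; rewrite mxE !uE (hH p q); case: (H q p).
exists (fun i j k l => hermmx X (mxvec_index i k) (mxvec_index j l)); split.
- move=> i j k l; case: F XF => //= XT.
  by rewrite mxE /= -[in X in _ - X]XT mxE subrr mul0r.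
- by move=> i j k l; exact: hermmx_herm.
- by rewrite -[RHS]matrix_polyE; exact: complexify_herm_poly.
Qed.

Lemma real_model_SymF_herm_poly F X :
  real_model (SymF F) (herm_poly X) <-> ground_matrix F X.
Proof.
rewrite real_model_SymFP; split=> [[Y [YF /herm_poly_inj ->]]|XF] //.
by exists X.
Qed.

Lemma real_model_PosC X : real_model (@PosF R n m GroundC) (herm_poly X) <->
  forall z w, 0 <= qf X (tens z w).
Proof.
split=> [[_ h] z w|h]; first by rewrite -ler0c -ceval_herm_poly.
split; first by apply/real_model_SymF_herm_poly.
by move=> z w; rewrite ceval_herm_poly ler0c.
Qed.

Lemma real_model_PosR X : X^T = X -> real_model (@PosR R n m) (herm_poly X) <->
  forall (x : 'rV[R]_n) (y : 'rV[R]_m),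
    0 <= qf X (tens (map_mx (real_complex R) x) (map_mx (real_complex R) y)).
Proof.
move=> XT.
split=> [[_ h] x y|h]; first by rewrite -ler0c -ceval_herm_poly.
split; first by apply/real_model_SymF_herm_poly.
by move=> x y; rewrite ceval_herm_poly ler0c.
Qed.

Definition gram r (b : 'I_r -> 'I_N -> C) : 'M[C]_N :=
  \matrix_(p, q) \sum_s (b s p)^*%C * b s q.

Lemma gram_herm r (b : 'I_r -> 'I_N -> C) : self_adjoint (gram b).
Proof.
move=> p q; rewrite !mxE rmorph_sum; apply: eq_bigr => s _.
by rewrite rmorphM /= conjcK mulrC.
Qed.

Lemma gram_ge0 r (b : 'I_r -> 'I_N -> C) X u : hermmx X = gram b -> 0 <= qf X u.
Proof.
move=> XE; rewrite -ler0c qfE XE.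
rewrite (_ : \sum_p _ = \sum_s (\sum_q b s q * u 0 q) * (\sum_q b s q * u 0 q)^*%C).
  by apply: sumr_ge0 => s _; exact: mulcJ_ge0.
transitivity (\sum_p \sum_q \sum_s (u 0 p)^*%C * ((b s p)^*%C * b s q) * u 0 q).
  apply: eq_bigr => p _; apply: eq_bigr => q _.
  by rewrite mxE mulr_sumr mulr_suml.
under eq_bigr do rewrite exchange_big.
rewrite exchange_big; apply: eq_bigr => s _ /=.
rewrite rmorph_sum mulrC mulr_suml; apply: eq_bigr => p _.
rewrite mulr_sumr; apply: eq_bigr => q _.
by rewrite rmorphM /=; ring.
Qed.

Lemma sum_sos r (b : 'I_r -> 'I_N -> C) :
  \sum_s pc (\sum_p b s p *: bil p) * (\sum_p b s p *: bil p) =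
  matrix_poly (gram b).
Proof.
transitivity (\sum_s \sum_p \sum_q ((b s p)^*%C * b s q) *: (pc (bil p) * bil q)).
  apply: eq_bigr => s _; rewrite -mul_scaled_sums; congr (_ * _).
  by rewrite pconj_sum; apply: eq_bigr => p _; exact: pconjZ.
rewrite exchange_big; apply: eq_bigr => p _.
rewrite exchange_big; apply: eq_bigr => q _ /=.
by rewrite mxE scaler_suml.
Qed.

Lemma bilinFP F (f : poly_C) : @bilinF R n m F f <->
  exists b : 'I_N -> C, (forall p, in_ground F (b p)) /\ f = \sum_p b p *: bil p.
Proof.
split=> [[a [aF ->]]|[b [bF ->]]].
  exists (fun p => mxvec (\matrix_(j, k) a j k) 0 p); split.
    by move=> p; case/mxvec_indexP: p => j k; rewrite mxvecE mxE.
  rewrite sum_mxvec; apply: eq_bigr => j _; apply: eq_bigr => k _.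
  by rewrite mxvecE mxE; congr (_ *: _); exact: (esym (bilpolyE _ _)).
exists (fun j k => b (mxvec_index j k)); split=> //.
rewrite sum_mxvec; apply: eq_bigr => j _; apply: eq_bigr => k _.
by congr (_ *: _); exact: bilpolyE.
Qed.

Lemma psd_gram_mx X : (forall u, 0 <= qf X u) ->
  exists b : 'I_N -> 'I_N -> C, hermmx X = gram b.
Proof.
move=> /psd_gram[b bE]; exists b.
by apply/matrixP => p q; rewrite bE mxE.
Qed.

(** The coefficients of the bilinear forms g_s make up a Gram factorization of [hermmx X]; hence the
    condition bears on all vectors u, not only on product vectors. *)
Lemma real_model_SosC X : real_model (@SosF R n m GroundC) (herm_poly X) <->
  forall u, 0 <= qf X u.
Proof.
split=> [[_ [r [g [gF gE]]]] u|h].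
  have /choice[b bE] : forall s, exists b : 'I_N -> C, g s = \sum_p b p *: bil p.
    by move=> s; have /bilinFP[b [_ ->]] := gF s; exists b.
  apply: (@gram_ge0 _ b); apply: herm_poly_unique; first exact: gram_herm.
  by rewrite gE -sum_sos; apply: eq_bigr => s _; rewrite bE.
split; first by apply/real_model_SymF_herm_poly.
have [b bE] := psd_gram_mx h.
exists N, (fun s => \sum_p b s p *: bil p); split.
  by move=> s; apply/bilinFP; exists (b s).
by rewrite sum_sos -bE; exact: complexify_herm_poly.
Qed.

End cones.

Lemma sqnorm_product_identity (A : comNzRingType) (n m : nat)
    (x : 'I_(n + n) -> A) (y : 'I_(m + m) -> A) :
  (\sum_j x j ^+ 2) * (\sum_k y k ^+ 2) =
  \sum_(i < n) \sum_(k < m)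
    ((x (lshift n i) * y (lshift m k) - x (rshift n i) * y (rshift m k)) ^+ 2 +
     (x (lshift n i) * y (rshift m k) + x (rshift n i) * y (lshift m k)) ^+ 2).
Proof.
rewrite !big_split_ord /= -!big_split /= mulr_suml; apply: eq_bigr => i _.
by rewrite mulr_sumr; apply: eq_bigr => k _; ring.
Qed.

Lemma alg_trace_term (A : comNzRingType) (a b : A) :
  a * a + b * b + b * a - a * b = a ^+ 2 + b ^+ 2.
Proof. by ring. Qed.

(** * Integrals of biquadratic forms over the product of spheres *)

Section integral.
Context {R : realType} (n m : nat).
Local Notation N := (n * m)%N.
Local Notation poly_R := (mpoly (nvars n m) R).
Local Notation herm_poly := (@herm_poly R n m).
Local Notation T := (@sphere R (n + n) `*` @sphere R (m + m)).
Local Notation PQ := (sphere_prob R (n + n) \x sphere_prob R (m + m))%E.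

Let mT : measurable T.
Proof. exact: measurable_T. Qed.

(** Both sides are |z|^2 |w|^2 = |z (x) w|^2. *)
Lemma sqnormsE : @sqnorms R n m = herm_poly 1%:M.
Proof.
rewrite /sqnorms; apply: etrans (sqnorm_product_identity _ _) _.
rewrite /herm_poly sum_mxvec; apply: eq_bigr => i _; apply: eq_bigr => k _.
rewrite (bigD1 (mxvec_index i k)) //= [X in _ = _ + X]big1; last first.
  by move=> q /negbTE h; rewrite mxE eq_sym h scale0r.
rewrite addr0 mxE eqxx scale1r.
apply: esym; apply: etrans (alg_trace_term _ _) _.
by rewrite /repoly /impoly !mxvecE !mxE.
Qed.

(* The integrals over T of the functions at hand, packaged with integrability
   so that linear combinations can be handled mechanically. *)
Definition has_T_integral (f : _ -> R) (v : R) :=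
  PQ.-integrable T (EFin \o f) /\ \int[PQ]_(p in T) f p = v.

Lemma has_T_integral_coord a b c d : has_T_integral (coord4 a b c d)
  ((a == b)%:R * (c == d)%:R / ((n + n)%:R * (m + m)%:R)).
Proof.
split; first exact: integrable_coord4.
by rewrite moment4E !moment2E mulf_div.
Qed.

Lemma has_T_integralD f g v w : has_T_integral f v -> has_T_integral g w ->
  has_T_integral (fun p => f p + g p) (v + w).
Proof.
move=> [fi <-] [gi <-]; split; last by rewrite RintegralD //; exact: mT.
have := integrableD mT fi gi.
by apply: eq_integrable => //; exact: mT.
Qed.

Lemma has_T_integralZ c f v : has_T_integral f v ->
  has_T_integral (fun p => c * f p) (c * v).
Proof.
move=> [fi <-]; split; last by rewrite RintegralZl //; exact: mT.
have := integrableZl mT c fi.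
by apply: eq_integrable => //; exact: mT.
Qed.

Lemma has_T_integral0 : has_T_integral (fun=> 0) 0.
Proof.
split; first exact: integrable0.
by rewrite (Rintegral_cst PQ mT) mul0r.
Qed.

Lemma has_T_integral_sum I (r : seq I) (f : I -> _ -> R) v :
  (forall i, has_T_integral (f i) (v i)) ->
  has_T_integral (fun p => \sum_(i <- r) f i p) (\sum_(i <- r) v i).
Proof.
move=> fv; elim: r => [|i r IH].
  rewrite big_nil (_ : (fun p => _) = fun=> 0); first exact: has_T_integral0.
  by apply/funext => p; rewrite big_nil.
rewrite big_cons (_ : (fun p => _) = fun p => f i p + \sum_(j <- r) f j p).
  exact: has_T_integralD.
by apply/funext => p; rewrite big_cons.
Qed.

Definition moment4 (a b : 'I_(n + n)) (c d : 'I_(m + m)) : R :=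
  (a == b)%:R * (c == d)%:R / ((n + n)%:R * (m + m)%:R).

Lemma has_T_integral_prod a a' b b' c c' d d' s t :
  has_T_integral (fun p =>
    (tnth p.1 a * tnth p.2 c + s * (tnth p.1 a' * tnth p.2 c')) *
    (tnth p.1 b * tnth p.2 d + t * (tnth p.1 b' * tnth p.2 d')))
  (moment4 a b c d + t * moment4 a b' c d' + s * moment4 a' b c' d +
   (s * t) * moment4 a' b' c' d').
Proof.
have := has_T_integralD (has_T_integralD (has_T_integralD
  (has_T_integral_coord a b c d)
  (has_T_integralZ t (has_T_integral_coord a b' c d')))
  (has_T_integralZ s (has_T_integral_coord a' b c' d)))
  (has_T_integralZ (s * t) (has_T_integral_coord a' b' c' d')).
by congr has_T_integral; apply/funext => p; rewrite /coord4; ring.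
Qed.

(** The mean of conj(z_i) z_j is 1/n if i = j and 0 otherwise, since each z_i has two real
    coordinates of second moment 1/(2n); likewise for w. So z (x) w has covariance 1/N times the
    identity, and mean zero means trace zero. *)
Lemma has_T_integral_herm_poly X :
  has_T_integral (reval (herm_poly X)) (\tr X / N%:R).
Proof.
pose v (p q : 'I_N) : R := (p == q)%:R / N%:R.
have -> : \tr X / N%:R = \sum_p \sum_q X p q * v p q.
  rewrite mulr_suml; apply: eq_bigr => p _.
  rewrite (bigD1 p) //= big1 ?addr0 => [|q /negbTE h].
    by rewrite /v eqxx mul1r.
  by rewrite /v eq_sym h mul0r mulr0.
pose g (p q : 'I_N) (t : (n + n).-tuple R * (m + m).-tuple R) :=
  let e := meval (real_point (tnth t.1) (tnth t.2)) in
  e (@repoly R n m p) * e (@repoly R n m q) +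
  e (@impoly R n m p) * e (@impoly R n m q) +
  e (@impoly R n m p) * e (@repoly R n m q) -
  e (@repoly R n m p) * e (@impoly R n m q).
suff gv p q : has_T_integral (g p q) (v p q).
  have := has_T_integral_sum (index_enum _) (fun p =>
    has_T_integral_sum (index_enum _) (fun q => has_T_integralZ (X p q) (gv p q))).
  by congr has_T_integral; apply/funext => t; rewrite /reval meval_herm_poly.
case/mxvec_indexP: p => i k; case/mxvec_indexP: q => j l.
pose li := lshift n i; pose ri := rshift n i.
pose lj := lshift n j; pose rj := rshift n j.
pose lk := lshift m k; pose rk := rshift m k.
pose ll := lshift m l; pose rl := rshift m l.
have := has_T_integralD (has_T_integralD (has_T_integralD
  (has_T_integral_prod li ri lj rj lk rk ll rl (-1) (-1))
  (has_T_integral_prod li ri lj rj rk lk rl ll 1 1))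
  (has_T_integral_prod li ri lj rj rk lk ll rl 1 (-1)))
  (has_T_integralZ (-1) (has_T_integral_prod li ri lj rj lk rk rl ll (-1) 1)).
congr has_T_integral.
  apply/funext => t; rewrite /g !meval_repoly !meval_impoly.
  by rewrite !real_pointl !real_pointr; ring.
rewrite /moment4 /li /ri /lj /rj /lk /rk /ll /rl.
rewrite !(eq_lshift, eq_rshift, eq_lrshift, eq_rlshift) /v /=.
have -> : (mxvec_index i k == mxvec_index j l) = (i == j) && (k == l).
  rewrite /mxvec_index (inj_eq (@cast_ord_inj _ _ _)) (inj_eq enum_rank_inj).
  by rewrite xpair_eqE.
have [_|_] := eqVneq i j; last by rewrite !mul0r /=; ring.
have [_|_] := eqVneq k l; last by rewrite !mulr0 !mul0r /=; ring.
rewrite /= !natrD natrM.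
have n0 : n%:R != 0 :> R.
  by rewrite pnatr_eq0 -lt0n; exact: leq_ltn_trans (ltn_ord j).
have m0 : m%:R != 0 :> R.
  by rewrite pnatr_eq0 -lt0n; exact: leq_ltn_trans (ltn_ord l).
have dbl (x : R) : x != 0 -> x + x != 0 by rewrite -mulr2n mulrn_eq0.
by field; rewrite m0 n0 !dbl.
Qed.

Lemma integral_T_herm_poly X : integral_T (herm_poly X) = \tr X / N%:R.
Proof. have [_ h] := has_T_integral_herm_poly X; exact: h. Qed.

End integral.

(** * The space of mean-zero forms *)

Section dimension.
Context {R : realType} (n m : nat).
Hypotheses (n0 : (0 < n)%N) (m0 : (0 < m)%N).
Local Notation N := (n * m)%N.
Local Notation herm_poly := (@herm_poly R n m).

Lemma mean_zeroP F f : @mean_zero R n m F f <->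
  exists X : 'M[R]_N, [/\ ground_matrix F X, \tr X = 0 & f = herm_poly X].
Proof.
have N0 : N%:R != 0 :> R by rewrite pnatr_eq0 muln_eq0 negb_or -!lt0n n0 m0.
split=> [[/real_model_SymFP[X [XF ->]]]|[X [XF X0 ->]]].
  rewrite integral_T_herm_poly => /eqP; rewrite mulf_eq0 invr_eq0 (negbTE N0).
  by rewrite orbF => /eqP X0; exists X.
split; first by apply/real_model_SymFP; exists X.
by rewrite integral_T_herm_poly X0 mul0r.
Qed.

Lemma has_dimension_image (V : {vspace 'M[R]_N}) :
  has_dimension [set f | exists X, X \in V /\ f = herm_poly X] (\dim V).
Proof.
pose psi (v : 'rV[R]_(\dim V)) : 'M[R]_N := \sum_i v 0 i *: (vbasis V)`_i.
have psiV v : psi v \in V.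
  by apply: memv_suml => i _; apply: memvZ;
  by apply: vbasis_mem; apply: mem_nth; rewrite size_tuple.
have psi_coord v i : coord (vbasis V) i (psi v) = v 0 i.
  have := basis_free (vbasisP V) => fr.
  by rewrite /psi (coord_sum_free (fun i => v 0 i)).
have lin : linear (fun v => herm_poly (psi v)).
  move=> a u v; rewrite -linearP; congr herm_poly; rewrite /psi scaler_sumr -big_split.
  by apply: eq_bigr => i _; rewrite !mxE scalerDl scalerA.
pose phi : {linear 'rV[R]_(\dim V) -> mpoly (nvars n m) R} :=
  HB.pack (fun v => herm_poly (psi v)) (GRing.isLinear.Build _ _ _ _ _ lin).
exists phi; split.
  move=> u v /herm_poly_inj uv; apply/rowP => i.
  by rewrite -!psi_coord uv.
apply/seteqP; split => [f [v _ <-]|f [X [XV ->]]]; first by exists (psi v).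
exists (\row_i coord (vbasis V) i X) => //=; congr herm_poly.
rewrite [RHS](coord_vbasis XV); apply: eq_bigr => i _; rewrite mxE //.
Qed.

Definition trace_map : 'Hom('M[R]_N, R^o) := linfun (@mxtrace R N).

(** The identity has trace N, which is nonzero, so the trace maps U onto R and its kernel loses
    exactly one dimension. *)
Lemma dim_traceless (U : {vspace 'M[R]_N}) : 1%:M \in U ->
  \dim (U :&: lker trace_map) = (\dim U).-1.
Proof.
move=> U1; have := limg_ker_dim trace_map U.
suff -> : \dim (trace_map @: U) = 1%N by move=> <-; rewrite addn1.
apply/eqP; rewrite eqn_leq; apply/andP; split.
  by rewrite -(dimvf R^o : _ = 1%N) dimvS // subvf.
rewrite lt0n dimv_eq0; apply/negP => /eqP h.
have : trace_map 1%:M \in (trace_map @: U)%VS by exact: memv_img.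
rewrite h memv0 lfunE /= mxtrace1 pnatr_eq0 muln_eq0 => /orP[] /eqP z.
  by move: n0; rewrite z.
by move: m0; rewrite z.
Qed.

(** The entries on or above the diagonal are free coordinates on the symmetric matrices. *)
Definition upper_pair := {x : 'I_N * 'I_N | (x.1 <= x.2)%N}.

Lemma card_upper_pair : #|{: upper_pair}| = ((N * (N + 1)) %/ 2)%N.
Proof.
rewrite card_sig -sum1_card.
rewrite (eq_bigl (fun x : 'I_N * 'I_N => (x.1 <= x.2)%N)); last first.
  by move=> x; rewrite inE.
rewrite -(pair_big_dep xpredT (fun p q : 'I_N => (p <= q)%N) (fun _ _ => 1%N)) /=.
rewrite (exchange_big_dep xpredT) //=.
transitivity (\sum_(q < N) q.+1)%N.
  apply: eq_bigr => q _.
  have := big_ord_widen N (fun=> 1%N) (ltn_ord q) : (_ = \sum_(p < N | p < q.+1) 1)%N.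
  by rewrite sum1_card card_ord => ->; apply: eq_bigl => p.
have -> : (\sum_(q < N) q.+1 = \sum_(q < N.+1) q)%N by rewrite big_ord_recl add0n.
by rewrite -(big_mkord xpredT id) triangular_sum bin2 /= divn2 addn1 mulnC.
Qed.

Definition sym_of (h : {ffun upper_pair -> R^o}) : 'M[R]_N :=
  \matrix_(p, q) match insub (if (p <= q)%N then (p, q) else (q, p)) with
                  | Some x => h x | None => 0 end.

Lemma sym_of_linear : linear sym_of.
Proof.
move=> a g h; apply/matrixP => p q; rewrite !mxE.
by case: insub => [x|]; rewrite ?ffunE ?mulr0 ?addr0.
Qed.

HB.instance Definition _ := GRing.isLinear.Build R {ffun upper_pair -> R^o}
  'M[R]_N *:%R sym_of sym_of_linear.

Lemma sym_of_val h (x : upper_pair) : sym_of h (val x).1 (val x).2 = h x.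
Proof. by rewrite mxE (valP x) -surjective_pairing valK. Qed.

Lemma sym_ofT h : (sym_of h)^T = sym_of h.
Proof.
apply/matrixP => p q; rewrite !mxE.
case: (ltngtP p q) => // pq.
by rewrite (val_inj pq).
Qed.

Definition sym_space : {vspace 'M[R]_N} := limg (linfun sym_of).

Lemma sym_spaceP X : X \in sym_space <-> X^T = X.
Proof.
split=> [/memv_imgP[h _ ->]|XT]; first by rewrite lfunE /= sym_ofT.
apply/memv_imgP; exists [ffun x : upper_pair => X (val x).1 (val x).2].
  exact: memvf.
rewrite lfunE /=; apply/matrixP => p q; rewrite mxE.
case: ifP => pq.
  by rewrite (insubT (fun x : 'I_N * 'I_N => (x.1 <= x.2)%N) (x := (p, q)) pq) ffunE.
have qp : (q <= p)%N by move/negbT: pq; rewrite -ltnNge => /ltnW.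
rewrite (insubT (fun x : 'I_N * 'I_N => (x.1 <= x.2)%N) (x := (q, p)) qp) ffunE /=.
by rewrite -[in LHS]XT mxE.
Qed.

Lemma dim_sym_space : \dim sym_space = ((N * (N + 1)) %/ 2)%N.
Proof.
rewrite limg_dim_eq; first by rewrite dimvf -card_upper_pair; exact: muln1.
apply/eqP; rewrite -subv0; apply/subvP => h; rewrite memv_cap => /andP[_].
rewrite memv_ker lfunE /= memv0 => /eqP h0; apply/eqP/ffunP => x.
by rewrite -sym_of_val h0 mxE ffunE.
Qed.

Lemma has_dimension_mean_zero F : has_dimension (@mean_zero R n m F) (dimM F n m).
Proof.
pose U F : {vspace 'M[R]_N} := match F with GroundR => sym_space | GroundC => fullv end.
have UP X : X \in U F <-> ground_matrix F X.
  by rewrite /U; case: F => /=; [exact: sym_spaceP|rewrite memvf].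
have -> : dimM F n m = \dim (U F :&: lker trace_map).
  rewrite dim_traceless; last by apply/UP; case: F {UP} => //=; rewrite trmx1.
  rewrite -subn1 /dimM; case: F {UP} => /=; first by rewrite dim_sym_space.
  by rewrite dimvf /dim /= -expnMn mulnn.
have -> : @mean_zero R n m F =
    [set f | exists X, X \in (U F :&: lker trace_map)%VS /\ f = herm_poly X].
  apply/seteqP; split=> f /=.
    move/mean_zeroP => [X [XF X0 ->]]; exists X; split=> //.
    by rewrite memv_cap memv_ker lfunE /= X0 eqxx andbT; apply/UP.
  move=> [X [+ ->]]; rewrite memv_cap memv_ker lfunE /= => /andP[/UP XF /eqP X0].
  by apply/mean_zeroP; exists X.
exact: has_dimension_image.
Qed.

End dimension.

(** * Measurability of the sections *)

Section quadratic_cones.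
Context {R : realType}.
Local Notation C := R[i].

Lemma qf_is_linear N (u : 'rV[C]_N) :
  linear_for *%R (fun X : 'M[R]_N => qf X u).
Proof.
move=> a X Y; rewrite /qf mulr_sumr -big_split; apply: eq_bigr => p _.
rewrite mulr_sumr -big_split; apply: eq_bigr => q _ /=.
by rewrite !mxE mulrDl mulrA.
Qed.

Lemma qfD N (X Y : 'M[R]_N) u : qf (X + Y) u = qf X u + qf Y u.
Proof. by have := qf_is_linear u 1 X Y; rewrite scale1r mul1r. Qed.

Lemma qf0 N (u : 'rV[C]_N) : qf 0 u = 0.
Proof. by rewrite /qf big1 // => p _; rewrite big1 // => q _; rewrite mxE mul0r. Qed.

Lemma qfZ N a (X : 'M[R]_N) u : qf (a *: X) u = a * qf X u.
Proof. by have := qf_is_linear u a X 0; rewrite qf0 !addr0. Qed.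

Lemma qf_sum N I (r : seq I) (F : I -> 'M[R]_N) u :
  qf (\sum_(i <- r) F i) u = \sum_(i <- r) qf (F i) u.
Proof.
elim: r => [|i r IH]; first by rewrite !big_nil qf0.
by rewrite !big_cons qfD IH.
Qed.

Definition sqn N (u : 'rV[C]_N) : R :=
  \sum_p (complex.Re (u 0 p) ^+ 2 + complex.Im (u 0 p) ^+ 2).

Lemma sqn_ge0 N (u : 'rV[C]_N) : 0 <= sqn u.
Proof. by apply: sumr_ge0 => p _; rewrite addr_ge0 ?sqr_ge0. Qed.

Lemma qf1 N (u : 'rV[C]_N) : qf 1%:M u = sqn u.
Proof.
rewrite /qf; apply: eq_bigr => p _.
rewrite (bigD1 p) //= big1 ?addr0 => [|q /negbTE h].
  by rewrite mxE eqxx mul1r /rho; ring.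
by rewrite mxE eq_sym h mul0r.
Qed.

Lemma ge0_on_rationals k (f : 'rV[R]_k -> R) : continuous f ->
  (forall q : 'rV[rat]_k, 0 <= f (map_mx ratr q)) -> forall u, 0 <= f u.
Proof.
move=> cf fq u; rewrite leNgt; apply/negP => fu.
have : \forall v \near u, f v < 0.
  by apply: (@cvgr_lt _ _ (nbhs u) _ f (f u)) => //; exact: cf.
move=> /nbhs_ballP[e /= e0 eu].
have /choice[q qE] : forall j, exists q : rat, ratr q \in `]u 0 j - e, u 0 j + e[.
  by move=> j; apply: rat_in_itvoo; rewrite ltrD2l gtrN.
have := fq (\row_j q j); rewrite leNgt => /negP; apply; apply: eu.
split=> // i j; rewrite !mxE ord1 /ball /= ltr_distlC.
by have := qE j; rewrite in_itv.
Qed.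

Lemma continuous_qf N k (X : 'M[R]_N) (g : 'rV[R]_k -> 'rV[C]_N) :
  (forall p, continuous (fun u => complex.Re (g u 0 p))) ->
  (forall p, continuous (fun u => complex.Im (g u 0 p))) ->
  continuous (fun u => qf X (g u)).
Proof.
move=> cr ci; apply: continuous_big => [|p _]; first exact: add_continuous.
apply: continuous_big => [|q _]; first exact: add_continuous.
move=> u; have [rp rq ip iq] := And4 (cr p u) (cr q u) (ci p u) (ci q u).
exact: cvgM (cvg_cst _)
  (cvgB (cvgD (cvgD (cvgM rp rq) (cvgM ip iq)) (cvgM ip rq)) (cvgM rp iq)).
Qed.

Lemma measurable_qf N d (T : {linear 'rV[R]_d -> 'M[R]_N}) X v :
  measurable_fun setT (fun t : d.-tuple R => qf (T (tuple_row t) + X) v).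
Proof.
rewrite (_ : (fun t => _) = (fun t : d.-tuple R =>
    \sum_(i < d) tnth t i * qf (T (delta_mx 0 i)) v + qf X v)).
  apply: measurable_funD => //; apply: measurable_sum => i.
  by apply: measurable_funM => //; exact: measurable_tnthT.
apply/funext => t; rewrite qfD; congr (_ + _).
rewrite [tuple_row t]row_sum_delta linear_sum qf_sum; apply: eq_bigr => i _.
by rewrite linearZ qfZ mxE.
Qed.

(** Each u gives a measurable condition on t, and continuity in u reduces the intersection to the
    countably many rational u. The parametrization g covers all vectors, product vectors and real
    product vectors at once. *)
Lemma measurable_qf_cone N d k (T : {linear 'rV[R]_d -> 'M[R]_N}) X
    (g : 'rV[R]_k -> 'rV[C]_N) :
  (forall p, continuous (fun u => complex.Re (g u 0 p))) ->
  (forall p, continuous (fun u => complex.Im (g u 0 p))) ->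
  measurable [set t : d.-tuple R | forall u, 0 <= qf (T (tuple_row t) + X) (g u)].
Proof.
move=> cr ci.
rewrite (_ : mkset _ = \bigcap_(q in [set: 'rV[rat]_k])
    [set t | 0 <= qf (T (tuple_row t) + X) (g (map_mx ratr q))]).
  rewrite -[X in measurable X]setCK setC_bigcap; apply: measurableC.
  apply: countable_bigcupT_measurable => [|q]; first exact: countableP.
  apply: measurableC.
  rewrite (_ : mkset _ = (fun t => qf (T (tuple_row t) + X) (g (map_mx ratr q)))
    @^-1` `[0, +oo[).
    by apply: measurableTI => //; exact: measurable_qf.
  by apply/seteqP; split => t /=; rewrite in_itv /= andbT.
apply/seteqP; split=> t /= h; first by move=> q _; exact: h.
apply: ge0_on_rationals; first exact: continuous_qf.
by move=> q; exact: h.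
Qed.

Definition cvec N (u : 'rV[R]_(N + N)) : 'rV[C]_N :=
  \row_p (u 0 (lshift N p) +i* u 0 (rshift N p))%C.

Lemma cvec_surj N (v : 'rV[C]_N) : exists u, v = cvec u.
Proof.
exists (row_mx (map_mx (@complex.Re R) v) (map_mx (@complex.Im R) v)).
by apply/rowP => p; rewrite mxE row_mxEl row_mxEr !mxE; case: (v 0 p).
Qed.

Lemma measurable_psd N d (T : {linear 'rV[R]_d -> 'M[R]_N}) X :
  measurable [set t : d.-tuple R | forall u, 0 <= qf (T (tuple_row t) + X) u].
Proof.
rewrite (_ : mkset _ =
    [set t | forall u, 0 <= qf (T (tuple_row t) + X) (cvec u)]).
  apply: measurable_qf_cone => p;
    under eq_fun do rewrite mxE; exact: coord_continuous.
apply/seteqP; split=> t /= h u //.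
by have [v ->] := cvec_surj u.
Qed.

Lemma measurable_block_positive n m d (T : {linear 'rV[R]_d -> 'M[R]_(n * m)}) X :
  measurable [set t : d.-tuple R |
    forall z w, 0 <= qf (T (tuple_row t) + X) (tens z w)].
Proof.
pose g (u : 'rV[R]_((n + n) + (m + m))) :=
  tens (cvec (lsubmx u)) (cvec (rsubmx u)).
rewrite (_ : mkset _ = [set t | forall u, 0 <= qf (T (tuple_row t) + X) (g u)]).
  have c := @coord_continuous R 1 ((n + n) + (m + m)).
  apply: measurable_qf_cone => p; case/mxvec_indexP: p => i k;
    under eq_fun do rewrite tensE !mxE /=; move=> u.
    exact: cvgB (cvgM (c _ _ u) (c _ _ u)) (cvgM (c _ _ u) (c _ _ u)).
  exact: cvgD (cvgM (c _ _ u) (c _ _ u)) (cvgM (c _ _ u) (c _ _ u)).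
apply/seteqP; split=> t /= h; first by move=> u; exact: h.
move=> z w; have [a ->] := cvec_surj z; have [b ->] := cvec_surj w.
by have := h (row_mx a b); rewrite /g row_mxKl row_mxKr.
Qed.

Lemma measurable_real_positive n m d (T : {linear 'rV[R]_d -> 'M[R]_(n * m)}) X :
  measurable [set t : d.-tuple R | forall (x : 'rV[R]_n) (y : 'rV[R]_m),
    0 <= qf (T (tuple_row t) + X)
      (tens (map_mx (real_complex R) x) (map_mx (real_complex R) y))].
Proof.
pose g (u : 'rV[R]_(n + m)) :=
  tens (map_mx (real_complex R) (lsubmx u)) (map_mx (real_complex R) (rsubmx u)).
rewrite (_ : mkset _ = [set t | forall u, 0 <= qf (T (tuple_row t) + X) (g u)]).
  have c := @coord_continuous R 1 (n + m).
  apply: measurable_qf_cone => p; case/mxvec_indexP: p => i k;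
    under eq_fun do rewrite tensE !mxE /= !(mul0r, mulr0, subr0, addr0);
    move=> u; last (move: u; exact: cst_continuous).
  exact: cvgM (c _ _ u) (c _ _ u).
apply/seteqP; split=> t /= h; first by move=> u; exact: h.
by move=> x y; have := h (row_mx x y); rewrite /g row_mxKl row_mxKr.
Qed.

End quadratic_cones.

(** * The real section has infinite volume *)

Section coordinates.
Context {R : realType} (n m : nat).
Hypotheses (n0 : (0 < n)%N) (m0 : (0 < m)%N).
Local Notation N := (n * m)%N.
Local Notation herm_poly := (@herm_poly R n m).

(** T is [iota] followed by the inverse of [herm_poly]; all volumes are computed through it. *)
Record matrix_coordinates (F : ground_field) d
    (iota : {linear 'rV[R]_d -> mpoly (nvars n m) R})
    (T : {linear 'rV[R]_d -> 'M[R]_N}) : Prop := MatrixCoordinates {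
  coord_poly : forall v, iota v = herm_poly (T v);
  coord_inj : injective T;
  coord_ground : forall v, ground_matrix F (T v);
  coord_trace : forall v, \tr (T v) = 0;
  coord_surj : forall X, ground_matrix F X -> \tr X = 0 -> exists v, T v = X }.

Lemma isometry_matrix_coordinates F d iota :
  @linear_isometry_onto R n m (@mean_zero R n m F) d iota ->
  exists T, matrix_coordinates F iota T.
Proof.
move=> [iso rng].
have iotaV v : @mean_zero R n m F (iota v) by rewrite -rng; exists v.
have /choice[f fE] v : exists X : 'M[R]_N,
    [/\ ground_matrix F X, \tr X = 0 & iota v = herm_poly X].
  exact/(mean_zeroP n0 m0).
have lin : linear f.
  move=> a u v; apply: (@herm_poly_inj R n m).
  have [_ _ <-] := fE (a *: u + v); rewrite linearP.
  have [_ _ ->] := fE u; have [_ _ ->] := fE v.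
  by apply: esym; exact: linearP.
pose T : {linear 'rV[R]_d -> 'M[R]_N} :=
  HB.pack f (GRing.isLinear.Build _ _ _ _ _ lin).
(* [iota] preserves inner products, so a vector of its kernel has Euclidean norm 0. *)
have iota_inj : injective iota.
  move=> u v uv; apply/eqP; rewrite -subr_eq0; apply/eqP.
  have z : iota (u - v) = iota 0.
    by rewrite linear0; apply: etrans (linearB _ _ _) _; rewrite uv subrr.
  have := iso (u - v) (u - v); rewrite z iso big1 => [/esym/eqP|i _]; last first.
    by rewrite mxE mul0r.
  rewrite psumr_eq0 => [/allP h|i _]; last by rewrite -expr2 sqr_ge0.
  apply/rowP => i; have := h i (mem_index_enum _).
  by rewrite /= -expr2 sqrf_eq0 => /eqP ->; rewrite mxE.
exists T; split=> [v|u v uv|v|v|X XF X0];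
  [by case: (fE v)| |by case: (fE v)|by case: (fE v)|].
  apply: iota_inj; have [_ _ ->] := fE u; have [_ _ ->] := fE v.
  by congr herm_poly.
have : @mean_zero R n m F (herm_poly X) by apply/(mean_zeroP n0 m0); exists X.
rewrite -rng => -[v _ vX]; exists v; apply: (@herm_poly_inj R n m).
by rewrite -vX; have [_ _ ->] := fE v.
Qed.

Lemma section_of_matrix F d iota T (K : set (mpoly (nvars n m) R)) :
  @matrix_coordinates F d iota T ->
  [set t : d.-tuple R | section_of F K (iota (\row_i tnth t i))] =
  [set t | K (herm_poly (T (tuple_row t) + 1%:M))].
Proof.
move=> [TP _ TF T0 _].
have E t : iota (\row_i tnth t i) + @sqnorms R n m =
    herm_poly (T (tuple_row t) + 1%:M).
  by rewrite sqnormsE TP; apply: esym; exact: linearD.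
apply/seteqP; split => t /=; first by case; rewrite E.
move=> h; split; last by rewrite E.
by apply/(mean_zeroP n0 m0); exists (T (tuple_row t)); split.
Qed.

End coordinates.

Section real_ground_field.
Context {R : realType} (n m : nat).
Hypotheses (n2 : (2 <= n)%N) (m2 : (2 <= m)%N).
Local Notation N := (n * m)%N.
Local Notation herm_poly := (@herm_poly R n m).
Local Notation rc := (map_mx (real_complex R)).

(** Each product a_p a_q is at most (a_p^2 + a_q^2) / 2 in absolute value. This puts a cube around
    the origin inside the real section. *)
Lemma qf_real_bound (X : 'M[R]_N) (x : 'rV[R]_n) (y : 'rV[R]_m) (e : R) :
  (forall p q, `|X p q| <= e) ->
  `|qf X (tens (rc x) (rc y))| <= e * N%:R * sqn (tens (rc x) (rc y)).
Proof.
move=> Xe; set u := tens _ _.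
have uI p : complex.Im (u 0 p) = 0.
  by case/mxvec_indexP: p => i k; rewrite tensE !mxE /= mulr0 mul0r addr0.
pose a p := complex.Re (u 0 p).
have rE p q : rho (u 0 p) (u 0 q) = a p * a q by rewrite /rho !uI; ring.
have sE : sqn u = \sum_p a p ^+ 2.
  by apply: eq_bigr => p _; rewrite uI expr0n /= addr0.
apply: (@le_trans _ _ (\sum_p \sum_q e * ((a p ^+ 2 + a q ^+ 2) / 2))).
  rewrite (le_trans (ler_norm_sum _ _ _)) // ler_sum // => p _.
  rewrite (le_trans (ler_norm_sum _ _ _)) // ler_sum // => q _.
  rewrite rE normrM; apply: ler_pM => //.
  rewrite ler_norml; apply/andP.
  have := sqr_ge0 (a p + a q); have := sqr_ge0 (a p - a q).
  rewrite sqrrB sqrrD; split; lra.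
rewrite le_eqVlt; apply/orP; left; apply/eqP.
under eq_bigr do rewrite -mulr_sumr.
rewrite -mulr_sumr -mulrA; congr (_ * _).
under eq_bigr do rewrite -mulr_suml big_split /= sumr_const card_ord -sE.
by rewrite -mulr_suml big_split /= sumrMnl -sE sumr_const card_ord -mulr_natl; field.
Qed.

(* The form Im(conj z_1 z_2) Im(conj w_1 w_2), up to a factor. *)
Lemma real_null_direction : exists X : 'M[R]_N,
  [/\ X^T = X, \tr X = 0, X != 0 &
      forall x y, qf X (tens (rc x) (rc y)) = 0].
Proof.
have n0 : (0 < n)%N by exact: leq_trans n2.
have m0 : (0 < m)%N by exact: leq_trans m2.
pose i0 := Ordinal n0; pose i1 := Ordinal (n2 : (1 < n)%N).
pose k0 := Ordinal m0; pose k1 := Ordinal (m2 : (1 < m)%N).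
pose p00 := mxvec_index i0 k0; pose p11 := mxvec_index i1 k1.
pose p01 := mxvec_index i0 k1; pose p10 := mxvec_index i1 k0.
pose X : 'M[R]_N := delta_mx p00 p11 + delta_mx p11 p00
  - delta_mx p01 p10 - delta_mx p10 p01.
have neq i k j l : (mxvec_index i k == mxvec_index j l :> 'I_N) = (i == j) && (k == l).
  rewrite /mxvec_index (inj_eq (@cast_ord_inj _ _ _)) (inj_eq enum_rank_inj).
  by rewrite xpair_eqE.
have tr_delta (p q : 'I_N) : p != q -> \tr (delta_mx p q : 'M[R]_N) = 0.
  move=> pq; rewrite /mxtrace big1 // => r _; rewrite mxE.
  by case: eqVneq => //= ->; rewrite (negbTE pq).
exists X; split.
- rewrite /X !linearB !linearD /= !trmx_delta.
  by rewrite addrAC [_ + delta_mx p00 p11]addrC addrAC.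
- by rewrite /X !linearB !linearD /= !tr_delta ?neq // !(subr0, addr0).
- apply/eqP => /matrixP/(_ p00 p11)/eqP; rewrite !mxE !neq /=.
  by rewrite !(subr0, addr0) oner_eq0.
move=> x y; set u := tens _ _.
have qd p q : qf (delta_mx p q) u = rho (u 0 p) (u 0 q).
  rewrite /qf (bigD1 p) //= (bigD1 q) //= !big1 ?addr0.
  - by rewrite mxE !eqxx mul1r.
  - by move=> r /negbTE h; rewrite big1 // => s _; rewrite mxE h mul0r.
  - by move=> r /negbTE h; rewrite mxE h andbF mul0r.
have qN Y : qf (- Y) u = - qf Y u by rewrite -scaleN1r qfZ mulN1r.
by rewrite /X !qfD !qN !qd !tensE !mxE /rho /=; ring.
Qed.

(** The section contains a cube and is invariant along the preimage v of the null direction, hence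
    [lebesgue_cylinder_infty] applies. *)
Lemma Vol_positive_real (d : nat)
    (iota : {linear 'rV[R]_d -> mpoly (nvars n m) R}) :
  linear_isometry_onto (@mean_zero R n m GroundR) iota ->
  Vol iota (section_of GroundR (real_model (@positive_maps R n m GroundR)))
  = +oo%E.
Proof.
have n0 : (0 < n)%N by exact: leq_trans n2.
have m0 : (0 < m)%N by exact: leq_trans m2.
move=> /(isometry_matrix_coordinates n0 m0)[T Tc].
rewrite /Vol (section_of_matrix n0 m0 _ Tc) /=.
have [_ Tinj TF T0 Tsurj] := Tc.
rewrite (_ : mkset _ = [set t : d.-tuple R | forall (x : 'rV[R]_n) (y : 'rV[R]_m),
    0 <= qf (T (tuple_row t) + 1%:M) (tens (rc x) (rc y))]); last first.
  apply/seteqP; split => t /=.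
    by move/real_model_PosR; apply; rewrite linearD /= TF trmx1.
  by move=> h; apply/real_model_PosR => //; rewrite linearD /= TF trmx1.
have [X0 [X0T X0tr X0n0 X0q]] := real_null_direction.
have [v vX0] := Tsurj X0 X0T X0tr.
have [j vj] : exists j, v 0 j != 0.
  apply/existsP; apply: contraT; rewrite negb_exists => /forallP h.
  have v0 : v = 0 by apply/rowP => i; rewrite mxE; apply/eqP; rewrite -[_ == _]negbK h.
  by move: X0n0; rewrite -vX0 v0 linear0 eqxx.
pose M := \sum_(i < d) \sum_p \sum_q `|T (delta_mx 0 i) p q|.
have M0 : 0 <= M by do 3 (apply: sumr_ge0 => ? _).
(* On the cube of radius r the entries of T t are at most r M, so the form is at most r M N |u|^2,
   and r M N <= 1. *)
pose r := (M * N%:R + 1)^-1.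
have D0 : 0 < M * N%:R + 1 by rewrite ltr_wpDl // mulr_ge0.
have r0 : 0 < r by rewrite invr_gt0.
apply: (@lebesgue_cylinder_infty R d _ (row_tuple v) r j) => //.
- exact: measurable_real_positive.
- move=> t tr x y; rewrite qfD qf1.
  have Xb p q : `|T (tuple_row t) p q| <= r * M.
    rewrite [tuple_row t]row_sum_delta linear_sum summxE.
    rewrite (le_trans (ler_norm_sum _ _ _)) // mulr_sumr ler_sum // => i _.
    rewrite linearZ !mxE normrM; apply: ler_pM => //.
    rewrite (bigD1 p) //= (bigD1 q) //= -!addrA lerDl addr_ge0 //.
      exact: sumr_ge0.
    by do 2 (apply: sumr_ge0 => ? _).
  have := qf_real_bound x y Xb; set q := qf _ _; set s := sqn _ => qs.
  have s0 : 0 <= s by exact: sqn_ge0.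
  have : r * M * N%:R <= 1.
    by rewrite -mulrA /r mulrC ler_pdivrMr // mul1r lerDl.
  move: qs; rewrite ler_norml => /andP[qs _] h.
  have : r * M * N%:R * s <= s by rewrite ler_piMl.
  lra.
- by rewrite tnth_mktuple.
- move=> a t h x y; have := h x y.
  rewrite (_ : tuple_row (tadd _ _) = a *: v + tuple_row t); last first.
    by apply/rowP => i; rewrite !mxE !tnth_mktuple.
  by rewrite linearD linearZ /= vX0 !qfD qfZ X0q mulr0 add0r.
Qed.

End real_ground_field.

(** * Volume of congruences *)

Section congruence_action.
Context {R : realType} (N : nat).
Local Notation C := R[i].
Local Notation conjm := (map_mx (@conjc R)).

(** Congruence, that is, precomposition of the form with u |-> u h, transported to real matrices so
    that it acts linearly on a real space of dimension N^2. *)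
Definition act (h : 'M[C]_N) (X : 'M[R]_N) : 'M[R]_N :=
  unhermmx (conjm h *m hermmx X *m h^T).

Lemma conjmK m1 m2 (A : 'M[C]_(m1, m2)) : conjm (conjm A) = A.
Proof. by apply/matrixP => i j; rewrite !mxE conjcK. Qed.

Lemma self_adjoint_congr (h H : 'M[C]_N) : self_adjoint H ->
  self_adjoint (conjm h *m H *m h^T).
Proof.
move=> hH p q.
have {}hH : conjm H^T = H by apply/matrixP => i j; rewrite !mxE -hH.
have : conjm (conjm h *m H *m h^T)^T = conjm h *m H *m h^T.
  by rewrite !trmx_mul trmxK !map_mxM map_trmx conjmK hH mulmxA.
move: (_ *m h^T) => G GE.
by rewrite -[in LHS]GE !mxE.
Qed.

Lemma qf_act h X u : qf (act h X) u = qf X (u *m h).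
Proof.
apply: complexI; rewrite !qf_sesq /act unhermmxK.
  by rewrite /sesq map_mxM trmx_mul !mulmxA.
exact/self_adjoint_congr/hermmx_herm.
Qed.

Lemma qf_eq (X Y : 'M[R]_N) : (forall u, qf X u = qf Y u) -> X = Y.
Proof.
move=> XY; apply: (can_inj (@hermmxK R N)).
apply/eqP; rewrite -subr_eq0; apply/eqP; apply: sesq_diag_eq0 => u.
have sB (G H : 'M[C]_N) : sesq (G - H) u u = sesq G u u - sesq H u u.
  by rewrite /sesq mulmxBr mulmxBl !mxE.
by rewrite sB -!qf_sesq XY subrr.
Qed.

Lemma act_linear h : linear (act h).
Proof.
by move=> a X Y; apply: qf_eq => u; rewrite !(qf_act, qfD, qfZ).
Qed.

HB.instance Definition _ h :=
  GRing.isLinear.Build R 'M[R]_N 'M[R]_N *:%R (act h) (act_linear h).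

Lemma act_mul h k X : act h (act k X) = act (h *m k) X.
Proof. by apply: qf_eq => u; rewrite !qf_act mulmxA. Qed.

Lemma act1 X : act 1%:M X = X.
Proof. by apply: qf_eq => u; rewrite qf_act mulmx1. Qed.

Lemma qfZr (X : 'M[R]_N) (a : R) u : qf X ((a%:C)%C *: u) = a ^+ 2 * qf X u.
Proof.
apply: complexI; rewrite rmorphM /= !qf_sesq sesqZl sesqZr conjc_real mulrA.
by rewrite -rmorphM expr2.
Qed.

Lemma act_scalar (a : R) X : act ((a%:C)%C)%:M X = a ^+ 2 *: X.
Proof.
by apply: qf_eq => u; rewrite qf_act mul_mx_scalar qfZr qfZ.
Qed.

Lemma mxtrace_qf (X : 'M[R]_N) : \tr X = \sum_p qf X (delta_mx 0 p).
Proof.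
apply: eq_bigr => p _; apply: complexI; rewrite qf_sesq sesq_delta mxE.
by congr Complex; rewrite ?subrr ?mul0r //; field.
Qed.

(** The map u |-> u + c <u, v> v: it multiplies v by 1 + c |v|^2 and fixes the orthogonal of v. *)
Definition rank1_update (c : R) (v : 'rV[C]_N) : 'M[C]_N :=
  1%:M + (c%:C)%C *: ((conjm v)^T *m v).

Lemma mul_rank1_update u c v :
  u *m rank1_update c v = u + ((c%:C)%C * (u *m (conjm v)^T) 0 0) *: v.
Proof.
rewrite /rank1_update mulmxDr mulmx1 -scalemxAr mulmxA -scalerA; congr (_ + _ *: _).
by rewrite [u *m _ *m v]mulmx_sum_row big_ord1 row_id.
Qed.

Lemma sesq_suml I (r : seq I) (H : 'M[C]_N) (F : I -> 'rV[C]_N) v :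
  sesq H (\sum_(i <- r) F i) v = \sum_(i <- r) sesq H (F i) v.
Proof.
elim: r => [|i r IH]; last by rewrite !big_cons sesqDl IH.
by rewrite !big_nil -(scale0r (0 : 'rV[C]_N)) sesqZl conjc0 mul0r.
Qed.

Lemma sesq_herm (X : 'M[R]_N) u v :
  sesq (hermmx X) u v = (sesq (hermmx X) v u)^*%C.
Proof.
rewrite !sesqE rmorph_sum exchange_big /=; apply: eq_bigr => p _.
rewrite rmorph_sum; apply: eq_bigr => q _.
by rewrite (hermmx_herm X q p) !rmorphM /= conjcK; ring.
Qed.

Lemma qf_add (X : 'M[R]_N) u v :
  qf X (u + v) = qf X u + qf X v + 2 * complex.Re (sesq (hermmx X) u v).
Proof.
apply: complexI; rewrite !rmorphD /= !qf_sesq sesqDl !sesqDr.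
rewrite [sesq _ v u]sesq_herm.
case: (sesq _ u u) => a1 b1; case: (sesq _ u v) => a2 b2.
case: (sesq _ v v) => a3 b3.
by apply/eqP; rewrite eq_complex /=; apply/andP; split; apply/eqP; ring.
Qed.

Lemma qfZc (X : 'M[R]_N) (a : C) u :
  qf X (a *: u) = (complex.Re a ^+ 2 + complex.Im a ^+ 2) * qf X u.
Proof.
apply: complexI; rewrite rmorphM /= !qf_sesq sesqZl sesqZr mulrA; congr (_ * _).
by case: a => a b; apply/eqP; rewrite eq_complex /=; apply/andP; split; apply/eqP; ring.
Qed.

(** The trace is the sum of the values at basis vectors; cross terms contribute 2 c X[v] and squares
    c^2 |v|^2 X[v]. For c = s / |v|^2 the growth is (2 s + s^2) X[v] / |v|^2, so it is controlled on
    matrices with X[v] on one side of its typical value. *)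
Lemma mxtrace_rank1_update c v X :
  \tr (act (rank1_update c v) X) = \tr X + (2 * c + c ^+ 2 * sqn v) * qf X v.
Proof.
rewrite mxtrace_qf [\tr X]mxtrace_qf.
pose b p := sesq (hermmx X) (delta_mx 0 p) v.
have bv : \sum_p (v 0 p)^*%C * b p = (qf X v)%:C%C.
  rewrite qf_sesq {2}(row_sum_delta v) sesq_suml.
  by apply: eq_bigr => p _; rewrite sesqZl.
have E p : qf (act (rank1_update c v) X) (delta_mx 0 p) = qf X (delta_mx 0 p) +
    (c ^+ 2 * qf X v * (complex.Re (v 0 p) ^+ 2 + complex.Im (v 0 p) ^+ 2) +
     2 * c * complex.Re ((v 0 p)^*%C * b p)).
  rewrite qf_act mul_rank1_update qf_add -addrA; congr (_ + _).
  rewrite -rowE !mxE qfZc sesqZr -/(b p).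
  by case: (v 0 p) => v1 v2; case: (b p) => b1 b2 /=; ring.
under eq_bigr do rewrite E.
rewrite !big_split /= -!mulr_sumr -/(sqn v); congr (_ + _).
have -> : \sum_p complex.Re ((v 0 p)^*%C * b p) = qf X v.
  have := congr1 (@complex.Re R) bv; rewrite /= => <-.
  by rewrite (raddf_sum (@complex.Re R : Rcomplex R -> R)).
by ring.
Qed.

End congruence_action.

Section volume_of_congruence.
Context {R : realType} (N : nat).
Local Notation C := R[i].
Local Notation conjm := (map_mx (@conjc R)).
Variables (e : nat) (T : {linear 'rV[R]_e -> 'M[R]_N}) (S : 'M[R]_N -> 'rV[R]_e).
Hypotheses (TK : cancel T S) (SK : cancel S T).

Definition act_mx (h : 'M[C]_N) : 'M[R]_e := lin1_mx (fun u => S (act h (T u))).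

Lemma mul_act_mx u h : u *m act_mx h = S (act h (T u)).
Proof.
have lin : linear (fun u => S (act h (T u))).
  move=> a v w; apply: (can_inj TK).
  by rewrite SK !(linearP T) !SK; exact: act_linear.
pose f : {linear 'rV[R]_e -> 'rV[R]_e} :=
  HB.pack (fun u => S (act h (T u))) (GRing.isLinear.Build _ _ _ _ _ lin).
exact: (mul_rV_lin1 f u).
Qed.

Lemma act_mx_mul h k : act_mx h *m act_mx k = act_mx (k *m h).
Proof.
apply/row_matrixP => i; rewrite !rowE mulmxA !mul_act_mx SK.
by rewrite act_mul.
Qed.

Lemma act_mx1 : act_mx 1%:M = 1%:M.
Proof. by apply/row_matrixP => i; rewrite !rowE mul_act_mx act1 TK mulmx1. Qed.

Lemma act_mx_scalar (a : R) : act_mx ((a%:C)%C)%:M = (a ^+ 2)%:M.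
Proof.
apply/row_matrixP => i; rewrite !rowE mul_act_mx act_scalar mul_mx_scalar.
by rewrite -linearZ TK.
Qed.

Lemma act_mx_unit h : h \in unitmx -> act_mx h \in unitmx.
Proof.
move=> hu; have E : act_mx h *m act_mx (invmx h) = 1%:M.
  by rewrite act_mx_mul mulVmx // act_mx1.
exact: (mulmx1_unit E).1.
Qed.

(** The inverse Jacobian of the congruence by h, for invertible h. *)
Definition congr_factor h : R := volume_factor (act_mx h).

Lemma congr_factor_gt0 h : h \in unitmx -> 0 < congr_factor h.
Proof. by move=> hu; apply: volume_factor_gt0; exact: act_mx_unit. Qed.

Lemma congr_factorM h k : h \in unitmx -> k \in unitmx ->
  congr_factor (h *m k) = congr_factor h * congr_factor k.
Proof.
move=> hu ku; have E := act_mx_mul k h.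
have F := volume_factorM (act_mx_unit ku) (act_mx_unit hu).
exact: etrans (etrans (congr1 (@volume_factor R e) (esym E)) F) (mulrC _ _).
Qed.

Lemma congr_factor_scalar (a : R) : 0 < a ->
  congr_factor ((a%:C)%C)%:M = (a ^+ (2 * e))^-1.
Proof.
move=> a0; rewrite /congr_factor act_mx_scalar.
by rewrite volume_factor_scalar ?exprn_gt0 // exprM.
Qed.

Lemma congr_factor_reflection r h : r *m r = 1%:M -> h \in unitmx ->
  congr_factor (r *m h *m r) = congr_factor h.
Proof.
move=> rr hu; have ru : r \in unitmx by case/mulmx1_unit: rr.
rewrite !congr_factorM ?unitmx_mul ?ru //.
have -> : congr_factor r = 1.
  rewrite /congr_factor volume_factor_involution //.
  by rewrite act_mx_mul rr act_mx1.
by rewrite mul1r mulr1.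
Qed.

Definition cdot (u v : 'rV[C]_N) : C := (u *m (conjm v)^T) 0 0.

Lemma cdot_sqn v : cdot v v = (sqn v)%:C%C.
Proof.
rewrite /cdot mxE /sqn rmorph_sum; apply: eq_bigr => p _; rewrite !mxE.
case: (v 0 p) => a b; apply/eqP.
by rewrite eq_complex /=; apply/andP; split; apply/eqP; ring.
Qed.

Lemma rank1_update_mul (a b : R) (v : 'rV[C]_N) :
  rank1_update a v *m rank1_update b v = rank1_update (a + b + a * b * sqn v) v.
Proof.
rewrite {1}/rank1_update mulmxDl mul1mx -scalemxAl -mulmxA mul_rank1_update.
rewrite -/(cdot v v) cdot_sqn /rank1_update -addrA; congr (_ + _).
rewrite mulmxDr -scalemxAr scalerDr scalerA -!scalerDl !rmorphD !rmorphM /=.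
by congr (_ *: _); ring.
Qed.

Lemma rank1_update0 (v : 'rV[C]_N) : rank1_update 0 v = 1%:M.
Proof. by rewrite /rank1_update scale0r addr0. Qed.

Lemma rank1_update_unit (c : R) (v : 'rV[C]_N) : 1 + c * sqn v != 0 ->
  rank1_update c v \in unitmx.
Proof.
move=> h; suff : rank1_update c v *m rank1_update (- c / (1 + c * sqn v)) v = 1%:M.
  by move=> E; exact: (mulmx1_unit E).1.
rewrite rank1_update_mul -(rank1_update0 v); congr rank1_update.
by field.
Qed.

(* The reflection along v - w. *)
Lemma exchanging_reflection (v w : 'rV[C]_N) : sqn v = sqn w ->
  complex.Im (cdot v w) = 0 ->
  exists r, [/\ r *m r = 1%:M, conjm r^T = r & v *m r = w].
Proof.
move=> vw im0; have [->|vwn] := eqVneq v w.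
  by exists 1%:M; rewrite mulmx1 trmx1 map_mx1 mulmx1.
pose x := v - w.
have x0 : sqn x != 0.
  rewrite psumr_eq0 => [|p _]; last by rewrite addr_ge0 ?sqr_ge0.
  apply/negP => /allP h; move: vwn; rewrite -subr_eq0 => /eqP; apply.
  apply/rowP => p; have := h p (mem_index_enum _).
  rewrite [RHS]mxE /= -/x paddr_eq0 ?sqr_ge0 // !sqrf_eq0.
  by case: (x 0 p) => a b /= /andP[/eqP -> /eqP ->].
have conj_rank1 (u : 'rV[C]_N) : conjm ((conjm u)^T *m u)^T = (conjm u)^T *m u.
  by rewrite trmx_mul trmxK map_mxM map_trmx conjmK.
exists (rank1_update (- 2 / sqn x) x); split.
- rewrite rank1_update_mul -(rank1_update0 x); congr rank1_update.
  by field.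
- rewrite /rank1_update linearD /= trmx1 map_mxD map_mx1; congr (_ + _).
  by rewrite linearZ /= map_mxZ conj_rank1; congr (_ *: _); exact: conjc_real.
rewrite mul_rank1_update.
have xE : cdot v x = ((sqn x / 2)%:C)%C.
  have cB a b c : cdot a (b - c) = cdot a b - cdot a c.
    by rewrite /cdot map_mxB linearB /= mulmxBr !mxE.
  have cBl a b c : cdot (a - b) c = cdot a c - cdot b c.
    by rewrite /cdot mulmxBl !mxE.
  have cJ a b : cdot a b = (cdot b a)^*%C.
    rewrite /cdot !mxE rmorph_sum; apply: eq_bigr => p _.
    by rewrite !mxE rmorphM /= conjcK mulrC.
  have sE : (sqn x)%:C%C = cdot v x - cdot w x by rewrite -cdot_sqn cBl.
  have := sE; rewrite !cB !cdot_sqn (cJ w v) -vw.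
  move: im0; case: (cdot v w) => a b /= ->; rewrite !oppr0 => -[h _].
  by apply/eqP; rewrite eq_complex /= h; apply/andP; split; apply/eqP; field.
have E : - 2 / sqn x * (sqn x / 2) = -1 by field.
rewrite -/(cdot v x) xE -rmorphM /= E.
by rewrite (_ : ((-1)%:C)%C = -1 :> C) ?scaleN1r ?subKr // rmorphN1.
Qed.

Lemma rank1_update_reflect (c : R) (v w : 'rV[C]_N) r :
  conjm r^T = r -> r *m r = 1%:M ->
  v *m r = w -> r *m rank1_update c v *m r = rank1_update c w.
Proof.
move=> rJ rr <-; rewrite /rank1_update mulmxDr mulmx1 mulmxDl rr; congr (_ + _).
rewrite -scalemxAr -scalemxAl map_mxM trmx_mul; congr (_ *: _).
have rJ' : (conjm r)^T = r by rewrite map_trmx.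
by rewrite rJ' !mulmxA.
Qed.

(** A self-adjoint involution can map v to u only if <v, u> is real; the phase of w arranges this
    for u = w e_i. *)
Lemma phase_alignment (a : C) (l : R) : 0 <= l -> exists w : C,
  complex.Re w ^+ 2 + complex.Im w ^+ 2 = l /\ complex.Im (a * w^*%C) = 0.
Proof.
move=> l0; pose s := complex.Re a ^+ 2 + complex.Im a ^+ 2.
have s0 : 0 <= s by rewrite addr_ge0 ?sqr_ge0.
have [sz|sn] := eqVneq s 0.
  have a0 : a = 0.
    move/eqP: sz; rewrite paddr_eq0 ?sqr_ge0 // !sqrf_eq0 => /andP[/eqP x /eqP y].
    by apply/eqP; rewrite eq_complex x y !eqxx.
  exists ((Num.sqrt l)%:C)%C; split; first by rewrite /= sqr_sqrtr // expr0n addr0.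
  by rewrite a0 mul0r.
exists ((Num.sqrt (l / s))%:C%C * a); split; last first.
  by move: (Num.sqrt _) => t; clear; case: a => x y /=; ring.
have : Num.sqrt (l / s) ^+ 2 = l / s by rewrite sqr_sqrtr // divr_ge0.
move: sn; rewrite /s; case: a {s s0} => x y /= sn.
move: (Num.sqrt _) => t tE.
transitivity (t ^+ 2 * (x ^+ 2 + y ^+ 2)); first by ring.
by rewrite tE divfK.
Qed.

End volume_of_congruence.

Section volume_of_rank1_update.
Context {R : realType} (N : nat).
Local Notation C := R[i].
Variables (e : nat) (T : {linear 'rV[R]_e -> 'M[R]_N}) (S : 'M[R]_N -> 'rV[R]_e).
Hypotheses (TK : cancel T S) (SK : cancel S T) (eE : e = (N * N)%N) (N0 : (0 < N)%N).
Local Notation cf := (congr_factor T S).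
Variables (s : R).
Hypothesis s1 : 0 < 1 + s.

(** As r grows this goes from 1 to the scalar 1 + s, by one rank one update per coordinate. *)
Definition partial_dilation (r : seq 'I_N) : 'M[C]_N :=
  diag_mx (\row_j (if j \in r then ((1 + s)%:C)%C else 1)).

Lemma partial_dilation_unit r : partial_dilation r \in unitmx.
Proof.
rewrite unitmxE det_diag unitfE; apply/prodf_neq0 => i _; rewrite mxE.
case: ifP => _; last exact: oner_neq0.
by apply/eqP => -[] /eqP; rewrite gt_eqF.
Qed.

Lemma partial_dilation1 i : partial_dilation [:: i] = rank1_update s (delta_mx 0 i).
Proof.
apply/matrixP => p q; rewrite !mxE big_ord1 !mxE !inE !eqxx /=.
have [->|pi] := eqVneq p i; last by rewrite conjc0 mul0r mulr0 addr0.
rewrite conjc1 mul1r [q == i]eq_sym; have [_|_] := eqVneq i q; last first.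
  by rewrite mulr0 addr0.
by rewrite mulr1 mulr1n rmorphD.
Qed.

Lemma partial_dilation_cons i r : i \notin r ->
  partial_dilation (i :: r) = partial_dilation [:: i] *m partial_dilation r.
Proof.
move=> ir; rewrite mulmx_diag; congr diag_mx; apply/rowP => j; rewrite !mxE !inE.
by case: eqVneq => [->|_] /=; rewrite ?(negbTE ir) ?mulr1 ?mul1r.
Qed.

(** A reflection maps v to a multiple of the i-th basis vector of the same norm and conjugates one
    update into the other. *)
Lemma congr_factor_rank1_coord (v : 'rV[C]_N) i : sqn v != 0 ->
  cf (rank1_update (s / sqn v) v) = cf (partial_dilation [:: i]).
Proof.
move=> v0; have [w [wl wim]] := phase_alignment (v 0 i) (sqn_ge0 v).
pose u : 'rV[C]_N := w *: delta_mx 0 i.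
have uE p : u 0 p = if p == i then w else 0.
  by rewrite !mxE eqxx /=; case: eqP => _; rewrite ?mulr1 ?mulr0.
have vu : sqn v = sqn u.
  rewrite -wl /sqn (bigD1 i) //= uE eqxx big1 ?addr0 // => p /negbTE pi.
  by rewrite uE pi /= expr0n addr0.
have im0 : complex.Im (cdot v u) = 0.
  rewrite /cdot mxE (bigD1 i) //= big1 ?addr0 => [|p /negbTE pi]; last first.
    by rewrite !mxE pi andbF mulr0 conjc0 mulr0.
  by rewrite [(_^T) _ _]mxE [(map_mx _ _) _ _]mxE uE eqxx.
have [r [rr rJ vr]] := exchanging_reflection vu im0.
have hu : rank1_update (s / sqn v) v \in unitmx.
  by apply: rank1_update_unit; rewrite divfK // gt_eqF.
rewrite -(congr_factor_reflection TK SK rr hu).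
rewrite (rank1_update_reflect _ rJ rr vr) partial_dilation1; congr (cf (_ + _)).
have ww : w^*%C * w = (sqn v)%:C%C.
  by rewrite -wl; case: (w) => a b; apply/eqP; rewrite eq_complex /=;
     apply/andP; split; apply/eqP; ring.
apply/matrixP => p q; rewrite !mxE !big_ord1 !mxE.
set x : C := (_ && (p == i))%:R; set y : C := (_ && (q == i))%:R.
have -> : (w * x)^*%C = w^*%C * x^*%C by exact: rmorphM.
have lc : ((s / sqn v)%:C * (sqn v)%:C = s%:C)%C by rewrite -rmorphM /= divfK.
by rewrite mulrACA ww [LHS]mulrA lc.
Qed.

(** The N coordinate dilations all have factor c, and their product is the scalar 1 + s, of factor
    (1 + s)^(-2 N^2). Taking positive N-th roots gives c. *)
Lemma congr_factor_rank1 (v : 'rV[C]_N) : sqn v != 0 ->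
  cf (rank1_update (s / sqn v) v) = ((1 + s) ^+ (2 * N))^-1.
Proof.
move=> v0; set c := cf _.
have c0 : 0 < c.
  apply: (congr_factor_gt0 TK SK); apply: rank1_update_unit.
  by rewrite divfK // gt_eqF.
have h r : uniq r -> cf (partial_dilation r) = c ^+ size r.
  elim: r => [_|i r IH /= /andP[ir ur]].
    have -> : partial_dilation [::] = ((1%:C)%C)%:M.
      by rewrite -diag_const_mx; congr diag_mx; apply/rowP => j; rewrite !mxE.
    by rewrite (congr_factor_scalar TK) ?ltr01 // expr1n invr1.
  rewrite partial_dilation_cons // (congr_factorM TK SK) ?partial_dilation_unit //.
  by rewrite IH // exprS -(congr_factor_rank1_coord i v0).
have := h _ (enum_uniq 'I_N); rewrite size_enum_ord.
have -> : partial_dilation (enum 'I_N) = (((1 + s)%:C)%C)%:M.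
  by rewrite -diag_const_mx; congr diag_mx; apply/rowP => j; rewrite !mxE mem_enum.
rewrite (congr_factor_scalar TK) // eE mulnA exprM -exprVn => /eqP.
rewrite eqrXn2 // ?invr_ge0 ?exprn_ge0 ?ltW // => /eqP ->; rewrite //.
Qed.

End volume_of_rank1_update.

(** * Deviation sets *)

Section truncated_cone.
Context {R : realType} (N D : nat).
Local Notation C := R[i].
Local Notation mu := (lebesgue_tuple R).
Variable T : {linear 'rV[R]_D -> 'M[R]_N}.
Hypotheses (N0 : (0 < N)%N) (DE : D.+1 = (N * N)%N) (T_inj : injective T)
  (T_trace : forall v, \tr (T v) = 0)
  (T_surj : forall X, \tr X = 0 -> exists v, T v = X).

(** The first coordinate is the height tr X / N, and the section sits at height 1. *)
Definition cone_coord (u : 'rV[R]_D.+1) : 'M[R]_N :=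
  u 0 ord0 *: 1%:M + T (\row_i u 0 (lift ord0 i)).

Lemma cone_coord_linear : linear cone_coord.
Proof.
move=> a u v; rewrite /cone_coord scalerDr addrACA; congr (_ + _).
  by rewrite !mxE scalerDl scalerA.
by rewrite -linearP; congr (T _); apply/rowP => i; rewrite !mxE.
Qed.

HB.instance Definition _ := GRing.isLinear.Build R 'rV[R]_D.+1 'M[R]_N *:%R
  cone_coord cone_coord_linear.

Let Nn0 : N%:R != 0 :> R. Proof. by rewrite pnatr_eq0 -lt0n. Qed.

Lemma mxtrace_cone_coord u : \tr (cone_coord u) = u 0 ord0 * N%:R.
Proof. by rewrite linearD linearZ /= T_trace addr0 mxtrace1. Qed.

Lemma cone_coord_tcons x (t : D.-tuple R) :
  cone_coord (tuple_row (tcons (x, t))) = x *: 1%:M + T (tuple_row t).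
Proof.
rewrite /cone_coord mxE; congr (_ *: _ + T _).
by apply/rowP => i; rewrite !mxE tnthS.
Qed.

Lemma cone_coord_surj X : exists u, cone_coord u = X.
Proof.
have tr0 : \tr (X - (\tr X / N%:R) *: 1%:M) = 0.
  by rewrite linearB linearZ /= mxtrace1 divfK ?subrr.
have [v vE] := T_surj tr0.
exists (\row_i if unlift ord0 i is Some j then v 0 j else \tr X / N%:R).
rewrite /cone_coord mxE unlift_none (_ : \row_i _ = v).
  by rewrite vE addrC subrK.
by apply/rowP => i; rewrite !mxE liftK.
Qed.

Lemma cone_coord_inj : injective cone_coord.
Proof.
move=> u v uv; have := congr1 (@mxtrace R N) uv.
rewrite !mxtrace_cone_coord => /(mulIf Nn0) uv0.
move: uv; rewrite /cone_coord uv0 => /addrI/T_inj/rowP uv'.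
apply/rowP => i; have [j ->|->//] := unliftP ord0 i.
by have := uv' j; rewrite !mxE.
Qed.

Lemma cone_coord_inverse : exists S, cancel cone_coord S /\ cancel S cone_coord.
Proof.
have /choice[S SE] := cone_coord_surj.
by exists S; split=> // u; apply: cone_coord_inj; rewrite SE.
Qed.

Definition psd_cone : set (D.+1.-tuple R) :=
  [set t | 0 <= tnth t ord0 <= 1 /\ forall u, 0 <= qf (cone_coord (tuple_row t)) u].

Lemma measurable_height : measurable [set t : D.+1.-tuple R | 0 <= tnth t ord0 <= 1].
Proof.
rewrite (_ : mkset _ = (fun t => tnth t ord0) @^-1` `[0, 1]).
  by apply: measurableTI => //; exact: measurable_tnthT.
by apply/seteqP; split => t /=; rewrite in_itv.
Qed.

Lemma measurable_psd_cone : measurable psd_cone.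
Proof.
apply: measurableI; first exact: measurable_height.
have := measurable_psd cone_coord 0.
by congr measurable; apply/seteqP; split => t /= h u; have := h u; rewrite addr0.
Qed.

(** The factor c has the sign of tau in the application. Thus tau > 0 describes X[v] too small and
    tau < 0 describes X[v] too large, in the form needed to bound the trace after the congruence. *)
Definition deviation_set (v : 'rV[C]_N) (c tau : R) : set (D.+1.-tuple R) :=
  psd_cone `&` [set t | c * qf (cone_coord (tuple_row t)) v <=
                        c * (1 - tau) * tnth t ord0 * sqn v].

Lemma measurable_deviation_set v c tau : measurable (deviation_set v c tau).
Proof.
apply: measurableI; first exact: measurable_psd_cone.
have mf : measurable_fun setT (fun t : D.+1.-tuple R =>
    c * (1 - tau) * tnth t ord0 * sqn v - c * qf (cone_coord (tuple_row t) + 0) v).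
  apply: measurable_funB.
    do 2 apply: measurable_funM => //.
    exact: measurable_tnthT.
  by apply: measurable_funM => //; exact: measurable_qf.
rewrite (_ : mkset _ = (fun t : D.+1.-tuple R =>
    c * (1 - tau) * tnth t ord0 * sqn v - c * qf (cone_coord (tuple_row t) + 0) v)
    @^-1` `[0, +oo[); first exact: measurableTI.
by apply/seteqP; split => t /=; rewrite in_itv /= andbT subr_ge0 addr0.
Qed.

(* Congruence by the rank one update of v followed by a dilation maps the
   deviation set into the truncated cone. *)
Lemma deviation_set_le v (s tau : R) (c := 2 * s + s ^+ 2)
    (k := 1 + c * (1 - tau) / N%:R) :
  sqn v != 0 -> 0 < 1 + s -> 0 < k ->
  (mu D.+1 (deviation_set v c tau) <=
   (((1 + s) ^+ (2 * N))^-1 * k ^+ (N * N))%:E * mu D.+1 psd_cone)%E.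
Proof.
move=> v0 s1 k0.
have [S [TK SK]] := cone_coord_inverse.
pose h := rank1_update (s / sqn v) v.
have hu : h \in unitmx by apply: rank1_update_unit; rewrite divfK // gt_eqF.
pose A := act_mx cone_coord S h.
have Au : A \in unitmx by exact: act_mx_unit.
have ku : (k^-1)%:M \in @unitmx R D.+1.
  by rewrite unitmxE det_scalar unitfE expf_neq0 // invr_neq0 // gt_eqF.
have vf : volume_factor (A *m (k^-1)%:M) = ((1 + s) ^+ (2 * N))^-1 * k ^+ (N * N).
  rewrite volume_factorM // volume_factor_scalar ?invr_gt0 //.
  rewrite exprVn invrK -DE; congr (_ * _).
  exact: (congr_factor_rank1 TK SK DE N0 s1 v0).
rewrite -vf -lebesgue_tuple_linear ?unitmx_mul ?Au //; last exact: measurable_psd_cone.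
apply: le_measure; rewrite ?inE; first exact: measurable_deviation_set.
  by apply: measurableTI; [exact: measurable_tmulmx|exact: measurable_psd_cone].
move=> t [[/andP[t0 t1] tpsd]] /= tdev.
set B := cone_coord (tuple_row t) in tpsd tdev.
(* The congruence multiplies the height by at most k, and the division by k brings it back below
   1. *)
pose t' := tmulmx (A *m (k^-1)%:M) t.
have BE : cone_coord (tuple_row t') = k^-1 *: act h B.
  rewrite tmulmxE mulmxA mul_mx_scalar linearZ /=; congr (_ *: _).
  by rewrite (mul_act_mx TK SK) SK.
have trE : tnth t' ord0 = k^-1 * (tnth t ord0 + c * qf B v / sqn v / N%:R).
  have := mxtrace_cone_coord (tuple_row t'); rewrite BE linearZ /= mxE => trE.
  apply: (mulIf Nn0); rewrite -trE mxtrace_rank1_update mxtrace_cone_coord mxE.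
  by rewrite /c; field; rewrite v0 Nn0 gt_eqF.
have sv : 0 < sqn v by rewrite lt_neqAle eq_sym v0 sqn_ge0.
have Npos : (0 : R) < N%:R by rewrite ltr0n.
split; last by move=> u; rewrite BE qfZ qf_act mulr_ge0 // invr_ge0 ltW.
rewrite -/t'; apply/andP; split.
  rewrite -(pmulr_lge0 _ Npos).
  have := mxtrace_cone_coord (tuple_row t'); rewrite mxE => <-.
  rewrite mxtrace_qf; apply: sumr_ge0 => p _.
  by rewrite BE qfZ qf_act mulr_ge0 // invr_ge0 ltW.
rewrite trE mulrC ler_pdivrMr // mul1r.
apply: (@le_trans _ _ (k * tnth t ord0)).
  rewrite [leRHS]mulrDl mul1r lerD2l ler_pdivrMr // ler_pdivrMr //.
  by rewrite (le_trans tdev) // le_eqVlt; apply/orP; left; apply/eqP; field.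
by rewrite ler_piMr // ltW.
Qed.

End truncated_cone.

Section deviation_rate.
Context {R : realType}.
Local Notation expR := (@expR R).

(** From 1 + x <= exp x at x = - s + 2 s^2, since (1 - s + 2 s^2)(1 + s) = 1 + s^2 (1 + 2 s) >=
    1. *)
Lemma exp_le_1D (s : R) : - 2^-1 <= s -> expR (s - 2 * s ^+ 2) <= 1 + s.
Proof.
move=> s1.
have D : 0 < 1 + s by lra.
have := expR_ge1Dx (- (s - 2 * s ^+ 2)).
rewrite expRN => h.
have E0 : 0 < expR (s - 2 * s ^+ 2) by exact: expR_gt0.
rewrite -ler_pV2 ?inE ?unitfE ?gt_eqF //=.
apply: le_trans h.
rewrite -[leLHS]mul1r ler_pdivrMr //.
have : 0 <= s ^+ 2 * (1 + 2 * s) by rewrite mulr_ge0 ?sqr_ge0 //; lra.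
by move=> h; nra.
Qed.

Lemma deviation_rate (N : nat) (tau : R) (s := tau / 6) (c := 2 * s + s ^+ 2)
    (k := 1 + c * (1 - tau) / N%:R) :
  (0 < N)%N -> -1 <= tau <= 1 ->
  [/\ 0 < 1 + s, 0 < k &
   ((1 + s) ^+ (2 * N))^-1 * k ^+ (N * N) <= expR (- (N%:R * tau ^+ 2 / 6))].
Proof.
move=> N0 /andP[t1 t2].
have s1 : 0 < 1 + s by rewrite /s; lra.
have N1 : (1 : R) <= N%:R by rewrite ler1n.
have Npos : (0 : R) < N%:R by rewrite ltr0n.
have tau2 : tau ^+ 2 <= 1 by nra.
have k0 : 0 < k.
  rewrite /k; have : - 1 < c * (1 - tau) / N%:R.
    rewrite ltr_pdivlMr // mulN1r.
    have : - 1 < c * (1 - tau) by rewrite /c /s; nra.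
    by lra.
  by lra.
split => //.
have kb : k ^+ (N * N) <= expR (N%:R * (c * (1 - tau))).
  apply: (@le_trans _ _ (expR (c * (1 - tau) / N%:R) ^+ (N * N))).
    rewrite lerXn2r ?nnegrE ?expR_ge0 ?(ltW k0) //; exact: expR_ge1Dx.
  rewrite -expRM_natl le_eqVlt; apply/orP; left; apply/eqP; congr expR.
  by rewrite natrM; field; rewrite gt_eqF.
have sb : ((1 + s) ^+ (2 * N))^-1 <= expR (- (2 * N%:R * (s - 2 * s ^+ 2))).
  rewrite expRN ler_pV2 ?inE ?unitfE ?gt_eqF ?expR_gt0 ?exprn_gt0 //=.
  have -> : expR (2 * N%:R * (s - 2 * s ^+ 2)) = expR (s - 2 * s ^+ 2) ^+ (2 * N).
    by rewrite -expRM_natl natrM.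
  by rewrite lerXn2r ?nnegrE ?expR_ge0 ?exp_le_1D ?ltW // /s; lra.
apply: (le_trans (ler_pM _ _ sb kb)).
- by rewrite invr_ge0 exprn_ge0 // ltW.
- by rewrite exprn_ge0 // ltW.
rewrite -expRD ler_expR.
(* With s = tau / 6 the left side equals - (7 + tau) tau^2 / 36, and tau >= -1. *)
have : c * (1 - tau) - 2 * (s - 2 * s ^+ 2) <= - (tau ^+ 2 / 6).
  by rewrite /c /s; nra.
move=> h; have := ler_wpM2l (ltW Npos) h.
by rewrite mulrN; lra.
Qed.

End deviation_rate.

(** * Nets of product vectors *)

Section lattice_net.
Context {R : realType} (k : nat).
Local Notation C := R[i].

(* A pair (b, i) stands for the integer (-1)^b i. *)
Definition lattice := {ffun 'I_(k + k) -> bool * 'I_((1024 * (k + k)).+1)}.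

(** Sums of absolute values are easier to count than sums of squares, and for integers the former
    are at most the latter. *)
Definition in_net (f : lattice) : bool :=
  (\sum_j (f j).2 <= 1024 * (k + k))%N.

Lemma sum_half_powers L : \sum_(a < L) (2^-1 : R) ^+ a <= 2.
Proof.
suff -> : \sum_(a < L) (2^-1 : R) ^+ a = 2 - 2 * 2^-1 ^+ L.
  by rewrite gerBl mulr_ge0 // exprn_ge0 // invr_ge0.
elim: L => [|L IH]; first by rewrite big_ord0 expr0; lra.
by rewrite big_ord_recr /= IH exprS; field.
Qed.

(** Each net point has weight at least 1 under the product weight 2^1024 2^(-|a|) per coordinate.
    The total weight factors, and each factor is at most 2^1024 * 4 because both signs give a
    geometric series bounded by 2. *)
Lemma card_net : (#|[pred f | in_net f]|%:R : R) <= (2 ^+ 1026) ^+ (k + k).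
Proof.
rewrite -sum1_card natr_sum /=.
apply: (@le_trans _ _ (\sum_(f : lattice) \prod_j (2 ^+ 1024 * 2^-1 ^+ (f j).2))).
  rewrite big_mkcond; apply: ler_sum => f _.
  case: ifPn => [fn|_]; last first.
    by apply: prodr_ge0 => j _; rewrite mulr_ge0 // exprn_ge0 // invr_ge0.
  rewrite big_split /= prodr_const card_ord prodrXr exprVn.
  rewrite -exprM ler_pdivlMr ?exprn_gt0 // mul1r ler_eXn2l ?ltr1n //.
rewrite -(bigA_distr_bigA (fun _ (x : bool * 'I_((1024 * (k + k)).+1)) =>
  2 ^+ 1024 * 2^-1 ^+ x.2 : R)).
rewrite prodr_const card_ord lerXn2r ?nnegrE ?exprn_ge0 //.
  by apply: sumr_ge0 => x _; rewrite mulr_ge0 // exprn_ge0 // invr_ge0.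
rewrite -mulr_sumr (exprD _ 1024 2) ler_pM2l ?exprn_gt0 //.
rewrite -(pair_bigA _ (fun (b : bool) (a : 'I_((1024 * (k + k)).+1)) => 2^-1 ^+ a)) /=.
rewrite big_bool /= expr2 mulr_natl mulr2n; apply: lerD; exact: sum_half_powers.
Qed.

Variable eta : R.

Definition net_coord (x : bool * 'I_((1024 * (k + k)).+1)) : R :=
  (-1) ^+ x.1 * (x.2%:R * eta).

Definition net_vector (f : lattice) : 'rV[C]_k :=
  \row_j (net_coord (f (lshift k j)) +i* net_coord (f (rshift k j)))%C.

(** Rounding each real coordinate toward zero keeps the norm at most 1, and 2k errors of size at
    most eta add up to 2 k eta^2 = 1/1024. *)
Lemma net_approximation (z : 'rV[C]_k) : 0 < eta ->
  eta ^+ 2 * (1024 * (k + k))%:R = 1 ->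
  sqn z <= 1 ->
  exists f, [/\ in_net f, sqn (net_vector f) <= 1 &
                sqn (z - net_vector f) <= 1024^-1].
Proof.
move=> e0 e2 z1.
pose x (j : 'I_(k + k)) := match fintype.split j with
  | inl i => complex.Re (z 0 i) | inr i => complex.Im (z 0 i) end.
pose a j := Num.truncn (`|x j| / eta).
have aE j : (a j)%:R * eta <= `|x j| < (a j)%:R * eta + eta.
  have : (a j)%:R <= `|x j| / eta < (a j).+1%:R.
    by apply: truncn_itv; rewrite divr_ge0 // ltW.
  rewrite ler_pdivlMr // ltr_pdivrMr // -natr1 mulrDl mul1r //.
have sqnE (v : 'rV[C]_k) : sqn v = \sum_j (match fintype.split j with
    | inl i => complex.Re (v 0 i) | inr i => complex.Im (v 0 i) end) ^+ 2.
  rewrite /sqn big_split big_split_ord /=; congr (_ + _); apply: eq_bigr => i _.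
    by rewrite (_ : lshift _ _ = unsplit (inl i)) // unsplitK.
  by rewrite (_ : rshift _ _ = unsplit (inr i)) // unsplitK.
have a2 : (\sum_j a j ^ 2 <= 1024 * (k + k))%N.
  rewrite -(ler_nat R) -(ler_pM2l (exprn_gt0 2 e0)) e2 natr_sum mulr_sumr.
  rewrite (le_trans _ z1) // sqnE; apply: ler_sum => j _.
  rewrite -/(x j) -(real_normK (num_real (x j))) natrX -exprMn mulrC.
  rewrite lerXn2r ?nnegrE ?mulr_ge0 ?(ltW e0) //.
  by case/andP: (aE j).
have aL j : (a j < (1024 * (k + k)).+1)%N.
  rewrite ltnS; apply: leq_trans a2; rewrite (bigD1 j) //=.
  rewrite (leq_trans _ (leq_addr _ _)) // -mulnn.
  by case: (a j) => // i; rewrite leq_pmulr.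
pose f : lattice := [ffun j => (x j < 0, Ordinal (aL j))].
have fx j : `|net_coord (f j)| <= `|x j| /\ `|x j - net_coord (f j)| <= eta.
  have /andP[h1 h2] := aE j.
  rewrite ffunE /net_coord /=; case: (ltrP (x j) 0) h1 h2 => xj.
    rewrite (ltr0_norm xj) expr1 mulN1r normrN => h1 h2; split.
      by rewrite ger0_norm // mulr_ge0 // ltW.
    by rewrite ler_norml; apply/andP; split; lra.
  rewrite (ger0_norm xj) expr0 mul1r => h1 h2; split.
    by rewrite ger0_norm // mulr_ge0 // ltW.
  by rewrite ler_norml; apply/andP; split; lra.
have netE j : (match fintype.split j with
    | inl i => complex.Re (net_vector f 0 i)
    | inr i => complex.Im (net_vector f 0 i) end) = net_coord (f j).
  by rewrite -[in RHS](splitK j); case: (fintype.split j) => i /=; rewrite mxE.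
have sq_le (s t : R) : `|s| <= `|t| -> s ^+ 2 <= t ^+ 2.
  move=> st; rewrite -(real_normK (num_real s)) -(real_normK (num_real t)).
  by rewrite lerXn2r ?nnegrE.
exists f; split.
- rewrite /in_net (leq_trans _ a2) //; apply: leq_sum => j _.
  by rewrite ffunE /= -mulnn; case: (a j) => // i; rewrite leq_pmulr.
- rewrite (le_trans _ z1) // !sqnE; apply: ler_sum => j _; rewrite netE -/(x j).
  by apply: sq_le; case: (fx j).
apply: (@le_trans _ _ (\sum_(j < k + k) eta ^+ 2)).
  rewrite sqnE; apply: ler_sum => j _.
  have -> : (match fintype.split j with
      | inl i => complex.Re ((z - net_vector f) 0 i)
      | inr i => complex.Im ((z - net_vector f) 0 i) end) = x j - net_coord (f j).
    by rewrite -netE /x; case: (fintype.split j) => i; rewrite !mxE;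
       case: (z 0 i).
  by apply: sq_le; rewrite (ger0_norm (ltW e0)); case: (fx j).
rewrite sumr_const card_ord -mulr_natr.
have := e2; rewrite natrM; lra.
Qed.

End lattice_net.

(** * From the net to all product vectors *)

Section product_vectors.
Context {R : realType}.
Local Notation C := R[i].

Lemma sqn_tens n m (z : 'rV[C]_n) (w : 'rV[C]_m) :
  sqn (tens z w) = sqn z * sqn w.
Proof.
rewrite /sqn sum_mxvec mulr_suml; apply: eq_bigr => i _.
rewrite mulr_sumr; apply: eq_bigr => k _; rewrite tensE.
by case: (z 0 i) => a b; case: (w 0 k) => c d /=; ring.
Qed.

Lemma sqnZ N (a : R) (v : 'rV[C]_N) : sqn ((a%:C)%C *: v) = a ^+ 2 * sqn v.
Proof.
rewrite /sqn mulr_sumr; apply: eq_bigr => p _; rewrite mxE.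
by case: (v 0 p) => b c /=; ring.
Qed.

Lemma sqnD_le N (u v : 'rV[C]_N) : sqn (u + v) <= 2 * (sqn u + sqn v).
Proof.
rewrite /sqn -big_split mulr_sumr; apply: ler_sum => p _; rewrite mxE.
case: (u 0 p) => a b; case: (v 0 p) => c d /=.
by have := sqr_ge0 (a - c); have := sqr_ge0 (b - d); nra.
Qed.

Lemma sqn0_eq0 N (v : 'rV[C]_N) : sqn v = 0 -> v = 0.
Proof.
move=> /eqP; rewrite psumr_eq0 => [/allP h|p _]; last by rewrite addr_ge0 ?sqr_ge0.
apply/rowP => p; have := h p (mem_index_enum _); rewrite /= [RHS]mxE.
rewrite paddr_eq0 ?sqr_ge0 // !sqrf_eq0.
by case: (v 0 p) => a b /= /andP[/eqP -> /eqP ->].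
Qed.

Lemma tensDl n m (z z' : 'rV[C]_n) (w : 'rV[C]_m) :
  tens (z + z') w = tens z w + tens z' w.
Proof. by rewrite /tens linearD /= mulmxDl linearD. Qed.

Lemma tensDr n m (z : 'rV[C]_n) (w w' : 'rV[C]_m) :
  tens z (w + w') = tens z w + tens z w'.
Proof. by rewrite /tens mulmxDr linearD. Qed.

Lemma tensZl n m (a : C) (z : 'rV[C]_n) (w : 'rV[C]_m) :
  tens (a *: z) w = a *: tens z w.
Proof. by rewrite /tens linearZ /= -scalemxAl linearZ. Qed.

Lemma tensZr n m (a : C) (z : 'rV[C]_n) (w : 'rV[C]_m) :
  tens z (a *: w) = a *: tens z w.
Proof. by rewrite /tens -scalemxAr linearZ. Qed.

Lemma tensNl n m (z : 'rV[C]_n) (w : 'rV[C]_m) : tens (- z) w = - tens z w.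
Proof. by rewrite /tens linearN /= mulNmx linearN. Qed.

Lemma tensNr n m (z : 'rV[C]_n) (w : 'rV[C]_m) : tens z (- w) = - tens z w.
Proof. by rewrite /tens mulmxN linearN. Qed.

Lemma sesqNr N (G : 'M[C]_N) u v : sesq G u (- v) = - sesq G u v.
Proof. by rewrite -scaleN1r sesqZr mulN1r. Qed.

(* The combination of a pair of vectors used to write a difference of values
   of a quadratic form as a difference of values at shorter vectors. *)
Definition spread N (s : R) (u v : 'rV[C]_N) : 'rV[C]_N :=
  ((4^-1)%:C)%C *: (u + v) + (s%:C)%C *: (u - v).

(** Both sides equal the real part of the sesquilinear form at (u + v, u - v). The large coefficient
    on u - v produces the gain 1/16. *)
Lemma qf_difference N (X : 'M[R]_N) u v :
  qf X u - qf X v = 16^-1 * (qf X (spread 16 u v) - qf X (spread (-16) u v)).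
Proof.
rewrite /spread !qf_add !qfZr !sesqZl !sesqZr !conjc_real.
rewrite !sesqDl !sesqDr !sesqNr.
have uE a : complex.Re (sesq (hermmx X) a a) = qf X a by rewrite -qf_sesq.
rewrite [sesq _ v u]sesq_herm; move: (uE u) (uE v).
case: (sesq _ u u) => a1 b1; case: (sesq _ v v) => a2 b2.
case: (sesq _ u v) => a3 b3 /= -> ->.
by field.
Qed.

(** The constants match: |u + v|^2 / 16 <= 1/4 and 256 |u - v|^2 <= 1/4, and [sqnD_le] doubles the
    sum. *)
Lemma sqn_spread N s (u v : 'rV[C]_N) : s ^+ 2 = 16 ^+ 2 -> sqn u <= 1 ->
  sqn v <= 1 -> sqn (u - v) <= 1024^-1 -> sqn (spread s u v) <= 1.
Proof.
move=> s2 u1 v1 uv; apply: le_trans (sqnD_le _ _) _.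
rewrite !sqnZ s2; have := sqnD_le u v; lra.
Qed.

Lemma half_sum_bound (a b M : R) : `|a| <= M -> `|b| <= M ->
  16^-1 * `|a - b| <= M / 8.
Proof. by move=> ha hb; have := ler_normB a b; lra. Qed.

Lemma triangle_bound (a b c B M : R) : `|c| <= B -> `|a - b| <= M / 8 ->
  `|b - c| <= M / 8 -> `|a| <= B + M / 4.
Proof.
by rewrite !ler_norml => /andP[? ?] /andP[? ?] /andP[? ?]; apply/andP; split; lra.
Qed.

Section net_bound.
Variables (n m : nat) (X : 'M[R]_(n * m)) (etaz etaw B : R).
Hypotheses (ez0 : 0 < etaz) (ew0 : 0 < etaw)
  (ez2 : etaz ^+ 2 * (1024 * (n + n))%:R = 1)
  (ew2 : etaw ^+ 2 * (1024 * (m + m))%:R = 1)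
  (B0 : 0 <= B).
Hypothesis netB : forall (f : lattice n) (g : lattice m), in_net f -> in_net g ->
  sqn (net_vector etaz f) <= 1 -> sqn (net_vector etaw g) <= 1 ->
  `|qf X (tens (net_vector etaz f) (net_vector etaw g))| <= B.

Definition ball_bound (M : R) := forall (z : 'rV[C]_n) (w : 'rV[C]_m),
  sqn z <= 1 -> sqn w <= 1 -> `|qf X (tens z w)| <= M.

(** Moving z, then w, to the net costs 2 M / 16 each time, as the spread vectors stay in the unit
    ball. *)
Lemma ball_bound_step M : ball_bound M -> ball_bound (B + M / 4).
Proof.
move=> hM z w z1 w1.
have [f [fn f1 fz]] := net_approximation ez0 ez2 z1.
have [g [gn g1 gw]] := net_approximation ew0 ew2 w1.
have hB := netB fn gn f1 g1.
move: (net_vector etaz f) (net_vector etaw g) f1 fz g1 gw hB => z' w' f1 fz g1 gw hB.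
have dz : `|qf X (tens z w) - qf X (tens z' w)| <= M / 8.
  have sp s : spread s (tens z w) (tens z' w) = tens (spread s z z') w.
    by rewrite /spread tensDl (tensZl _ (z + z') w) (tensZl _ (z - z') w)
      (tensDl z z' w) (tensDl z (- z') w) tensNl.
  rewrite qf_difference !sp normrM ger0_norm ?invr_ge0 //.
  exact: half_sum_bound (hM _ _ (sqn_spread (s := 16) erefl z1 f1 fz) w1)
    (hM _ _ (sqn_spread (s := -16) (sqrrN _) z1 f1 fz) w1).
have dw : `|qf X (tens z' w) - qf X (tens z' w')| <= M / 8.
  have sp s : spread s (tens z' w) (tens z' w') = tens z' (spread s w w').
    by rewrite /spread tensDr (tensZr _ z' (w + w')) (tensZr _ z' (w - w'))
      (tensDr z' w w') (tensDr z' w (- w')) tensNr.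
  rewrite qf_difference !sp normrM ger0_norm ?invr_ge0 //.
  exact: half_sum_bound (hM _ _ f1 (sqn_spread (s := 16) erefl w1 g1 gw))
    (hM _ _ f1 (sqn_spread (s := -16) (sqrrN _) w1 g1 gw)).
exact: triangle_bound hB dz dw.
Qed.

Lemma ball_bound_exists : exists2 M, 0 <= M & ball_bound M.
Proof.
exists (\sum_p \sum_q `|X p q| * 4).
  by do 2 (apply: sumr_ge0 => ? _); rewrite mulr_ge0.
move=> z w z1 w1; set u := tens z w.
have u1 : sqn u <= 1 by rewrite sqn_tens mulr_ile1 ?sqn_ge0.
have up p : complex.Re (u 0 p) ^+ 2 + complex.Im (u 0 p) ^+ 2 <= 1.
  apply: le_trans u1; rewrite /sqn (bigD1 p) //= lerDl.
  by apply: sumr_ge0 => q _; rewrite addr_ge0 ?sqr_ge0.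
rewrite (le_trans (ler_norm_sum _ _ _)) // ler_sum // => p _.
rewrite (le_trans (ler_norm_sum _ _ _)) // ler_sum // => q _.
rewrite normrM ler_wpM2l // /rho ler_norml; have := up p; have := up q.
case: (u 0 p) => a b; case: (u 0 q) => c d /= h1 h2.
have := (sqr_ge0 (a + c), sqr_ge0 (b + d), sqr_ge0 (b + c), sqr_ge0 (a - d)).
have := (sqr_ge0 (a - c), sqr_ge0 (b - d), sqr_ge0 (b - c), sqr_ge0 (a + d)).
rewrite !sqrrB !sqrrD => -[[[? ?] ?] ?] [[[? ?] ?] ?].
by apply/andP; split; lra.
Qed.

(** The step is a contraction, so iterating it from any finite bound yields 2 B on the unit balls;
    homogeneity extends this to all vectors. *)
Lemma net_sup z w : `|qf X (tens z w)| <= 2 * B * (sqn z * sqn w).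
Proof.
have [M M0 hM] := ball_bound_exists.
(* Induction uses B + (2 B + x) / 4 <= 2 B + x / 2. *)
have hk k : ball_bound (2 * B + M / 2 ^+ k).
  elim: k => [|k IH].
    move=> a b a1 b1.
    by rewrite expr0 divr1 (le_trans (hM _ _ a1 b1)) // lerDr mulr_ge0.
  move=> a b a1 b1; apply: le_trans (ball_bound_step IH a1 b1) _.
  have : 0 <= M / 2 ^+ k by rewrite divr_ge0 // exprn_ge0.
  have -> : M / 2 ^+ k.+1 = M / 2 ^+ k / 2 by rewrite exprSr invfM mulrA.
  by move: (M / _) B0 => x; lra.
have unit_bound : ball_bound (2 * B).
  move=> a b a1 b1; rewrite leNgt; apply/negP => h.
  pose e := `|qf X (tens a b)| - 2 * B.
  have e0 : 0 < e by rewrite subr_gt0.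
  pose k := (Num.truncn (M / e)).+1.
  have := hk k a b a1 b1; rewrite -lerBlDl -/e leNgt => /negP; apply.
  rewrite ltr_pdivrMr ?exprn_gt0 // mulrC -ltr_pdivrMr //.
  apply: (@lt_trans _ _ k%:R); first exact: truncnS_gt.
  by rewrite -natrX ltr_nat ltn_expl.
have [z0|zn] := eqVneq (sqn z) 0.
  rewrite (sqn0_eq0 z0) -(scale0r z) tensZl -[0](rmorph0 (real_complex R)).
  by rewrite qfZr expr0n mul0r normr0 sqnZ expr0n !mul0r mulr0.
have [w0|wn] := eqVneq (sqn w) 0.
  rewrite (sqn0_eq0 w0) -(scale0r w) tensZr -[0](rmorph0 (real_complex R)).
  by rewrite qfZr expr0n mul0r normr0 sqnZ expr0n mul0r !mulr0.
have zp : 0 < sqn z by rewrite lt_neqAle eq_sym zn sqn_ge0.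
have wp : 0 < sqn w by rewrite lt_neqAle eq_sym wn sqn_ge0.
pose sz := Num.sqrt (sqn z); pose sw := Num.sqrt (sqn w).
have sz2 : sz ^+ 2 = sqn z by rewrite sqr_sqrtr // ltW.
have sw2 : sw ^+ 2 = sqn w by rewrite sqr_sqrtr // ltW.
have := unit_bound (((sz^-1)%:C)%C *: z) (((sw^-1)%:C)%C *: w).
rewrite !sqnZ !exprVn sz2 sw2 !mulVf // => /(_ (lexx _) (lexx _)).
rewrite tensZl tensZr !qfZr !exprVn sz2 sw2 !normrM.
rewrite (ger0_norm (x := (sqn z)^-1)) ?invr_ge0 ?sqn_ge0 //.
rewrite (ger0_norm (x := (sqn w)^-1)) ?invr_ge0 ?sqn_ge0 //.
by rewrite mulrA -invfM mulrC ler_pdivrMr ?mulr_gt0 // mulrC.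
Qed.

End net_bound.

End product_vectors.

(** * The volume ratio *)

Lemma measure_union_bound (dd : measure_display) (U : measurableType dd)
    (R : realType) (mu : {measure set U -> \bar R}) (I : finType) (P : pred I)
    (F : I -> set U) (X G : set U) (b : \bar R) :
  measurable X -> measurable G -> (forall i, measurable (F i)) ->
  (forall x, X x -> G x \/ exists2 i, P i & F i x) ->
  (forall i, P i -> (mu (F i) <= b)%E) -> (0 <= b)%E ->
  (mu X <= mu G + (#|[pred i | P i]|%:R)%:E * b)%E.
Proof.
move=> mX mG mF XGF Fb b0.
have mB s : measurable (\big[setU/set0]_(i <- s | P i) F i).
  by apply: bigsetU_measurable => i _.
apply: (@le_trans _ _ (mu (G `|` \big[setU/set0]_(i <- enum I | P i) F i))).
  apply: le_measure; rewrite ?inE //; first exact: measurableU.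
  move=> x /XGF[Gx|[i Pi Fi]]; first by left.
  by right; rewrite -bigcup_seq_cond; exists i => //=; rewrite mem_enum.
apply: (le_trans (measureU2 mu mG (mB _))); apply: leeD => //.
have -> : #|[pred i | P i]|%:R = (\sum_(i <- enum I | P i) 1 : R)%R.
  by rewrite -sum1_card natr_sum big_enum_cond /=; apply: eq_bigl.
elim: (enum I) => [|i s IH]; first by rewrite !big_nil measure0 mul0e.
rewrite !big_cons; case: ifPn => // Pi.
apply: (le_trans (measureU2 mu (mF i) (mB s))).
rewrite EFinD ge0_muleDl ?lee_fin //; last by apply: sumr_ge0.
by rewrite mul1e; apply: leeD => //; exact: Fb.
Qed.

Lemma card_signed_pairs (I J : finType) (P : pred I) (Q : pred J)
    (S : pred (I * J * bool)) :
  (forall x, S x -> P x.1.1 && Q x.1.2) ->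
  (#|[pred x | S x]| <= #|[pred f | P f]| * #|[pred g | Q g]| * 2)%N.
Proof.
move=> h; have -> : 2%N = #|{: bool}| by rewrite card_bool.
rewrite -!cardX; apply/subset_leq_card/fintype.subsetP => -[[f g] b] Sx.
by have := h _ Sx; rewrite !inE /= andbT.
Qed.

(** Here r is the height, l = |v|^2 and q the value at v of the traceless part. As [c false] > 0 >
    [c true], failing to deviate on either side bounds q from below and from above. *)
Lemma small_deviation (R : realFieldType) (tau r l q : R)
    (s := fun b : bool => (-1) ^+ b * tau)
    (c := fun b => 2 * (s b / 6) + (s b / 6) ^+ 2) :
  0 < tau -> tau <= 1 -> tau * r * l <= tau * r ->
  c false * (1 - s false) * r * l < c false * (r * l + q) ->
  c true * (1 - s true) * r * l < c true * (r * l + q) ->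
  `|q| <= tau * r.
Proof.
rewrite /c /s expr0 expr1 mul1r mulN1r -!mulrA => t0 t1 b.
rewrite ltr_pM2l; last by nra.
rewrite ltr_nM2l; last by nra.
by rewrite mulrBl mul1r mulrBl mul1r ler_norml => h1 h2; apply/andP; split; lra.
Qed.

Section ratio.
Context {R : realType} (n m : nat).
Local Notation C := R[i].
Local Notation N := (n * m)%N.
Local Notation mu := (lebesgue_tuple R).
Variable D : nat.
Variable T : {linear 'rV[R]_D -> 'M[R]_N}.
Hypotheses (n0 : (0 < n)%N) (m0 : (0 < m)%N) (DE : D.+1 = (N * N)%N)
  (T_inj : injective T) (T_trace : forall v, \tr (T v) = 0)
  (T_surj : forall X, \tr X = 0 -> exists v, T v = X).

Let N0 : (0 < N)%N. Proof. by rewrite muln_gt0 n0 m0. Qed.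

Definition psd_section : set (D.-tuple R) :=
  [set t | forall u, 0 <= qf (T (tuple_row t) + 1%:M) u].

Definition block_positive_section : set (D.-tuple R) :=
  [set t | forall z w, 0 <= qf (T (tuple_row t) + 1%:M) (tens z w)].

Lemma measurable_psd_section : measurable psd_section.
Proof. exact: measurable_psd. Qed.

Lemma measurable_block_positive_section : measurable block_positive_section.
Proof. exact: measurable_block_positive. Qed.

Lemma psd_block_positive : psd_section `<=` block_positive_section.
Proof. by move=> t h z w; exact: h. Qed.

Lemma tuple_row_scale (a : R) (t : D.-tuple R) :
  tuple_row (tscale a t) = a *: tuple_row t.
Proof. by apply/rowP => i; rewrite !mxE tnth_mktuple. Qed.

Lemma lebesgue_psd_cone :
  mu D.+1 (psd_cone T) = (cone_factor (R:=R) D * mu D psd_section)%E.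
Proof.
apply: lebesgue_cone.
- exact: measurable_psd_cone.
- exact: measurable_psd_section.
- by move=> x t [].
move=> x t /andP[x0 x1]; rewrite /psd_cone /= cone_coord_tcons.
have E u : qf (x *: 1%:M + T (tuple_row t)) u =
    x * qf (T (tuple_row (tscale x^-1 t)) + 1%:M) u.
  rewrite tuple_row_scale linearZ /= !qfD !qfZ mulrDr mulrA divff ?gt_eqF //.
  by rewrite mul1r addrC.
split=> [[_ h] u|h]; first by have := h u; rewrite E pmulr_rge0.
by split=> [|u]; [rewrite (ltW x0) x1|rewrite E pmulr_rge0].
Qed.

Section dilated.
Variable kappa : R.
Hypothesis kappa0 : 0 < kappa.

(** Dividing the traceless part by kappa amounts to dilating the section by kappa. *)
Definition dilated_coord (v : 'rV[R]_D) : 'M[R]_N := kappa^-1 *: T v.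

Lemma dilated_coord_linear : linear dilated_coord.
Proof.
move=> a u v; rewrite /dilated_coord linearP scalerDr !scalerA.
by rewrite [kappa^-1 * a]mulrC.
Qed.

HB.instance Definition _ := GRing.isLinear.Build R 'rV[R]_D 'M[R]_N *:%R
  dilated_coord dilated_coord_linear.

Definition dilated_cone : set (D.+1.-tuple R) :=
  [set t | 0 <= tnth t ord0 <= 1] `&`
  [set t | forall z w,
     0 <= qf (cone_coord dilated_coord (tuple_row t) + 0) (tens z w)].

Lemma measurable_dilated_cone : measurable dilated_cone.
Proof.
apply: measurableI; first exact: measurable_height.
exact: measurable_block_positive.
Qed.

Lemma lebesgue_dilated_cone : mu D.+1 dilated_cone =
  (cone_factor (R:=R) D * ((kappa ^+ D)%:E * mu D block_positive_section))%E.
Proof.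
have mB := measurable_block_positive_section.
have <- : mu D (@tscale R D kappa^-1 @^-1` block_positive_section) =
    ((kappa ^+ D)%:E * mu D block_positive_section)%E.
  by rewrite lebesgue_tuple_scale ?invr_gt0 // exprVn invrK.
apply: lebesgue_cone.
- exact: measurable_dilated_cone.
- by apply: measurableTI => //; exact: measurable_tscale.
- by move=> x t [].
move=> x t /andP[x0 x1]; rewrite /dilated_cone /= cone_coord_tcons.
have E u : qf (x *: 1%:M + dilated_coord (tuple_row t) + 0) u =
    x * qf (T (tuple_row (tscale kappa^-1 (tscale x^-1 t))) + 1%:M) u.
  rewrite addr0 !tuple_row_scale !linearZ /= !qfD !qfZ mulrDr.
  by rewrite [x * (_ * _)]mulrCA [x * (x^-1 * _)]mulrA divff ?gt_eqF // mul1r addrC.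
split=> [[_ h] z w|h]; first by have := h z w; rewrite E pmulr_rge0.
by split=> [|z w]; [rewrite (ltW x0) x1|rewrite E pmulr_rge0].
Qed.

End dilated.

Variables (tau etaz etaw : R).
Hypotheses (tau0 : 0 < tau) (tau1 : tau <= 1) (ez0 : 0 < etaz) (ew0 : 0 < etaw)
  (ez2 : etaz ^+ 2 * (1024 * (n + n))%:R = 1)
  (ew2 : etaw ^+ 2 * (1024 * (m + m))%:R = 1).

(** The boolean records the side on which X[v] deviates. *)
Definition net_index := (lattice n * lattice m * bool)%type.

Definition net_tens (x : net_index) : 'rV[C]_N :=
  tens (net_vector etaz x.1.1) (net_vector etaw x.1.2).

(** Zero vectors are excluded because the rank one update divides by |v|^2; every form vanishes
    there anyway. *)
Definition net_ok (x : net_index) : bool :=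
  [&& in_net x.1.1, in_net x.1.2 & sqn (net_tens x) != 0].

Definition signed_tau (x : net_index) : R := (-1) ^+ x.2 * tau.

Definition net_deviation (x : net_index) : set (D.+1.-tuple R) :=
  deviation_set T (net_tens x)
    (2 * (signed_tau x / 6) + (signed_tau x / 6) ^+ 2) (signed_tau x).

Lemma mu_net_deviation x : net_ok x ->
  (mu D.+1 (net_deviation x) <=
   (expR (- (N%:R * tau ^+ 2 / 6)))%:E * mu D.+1 (psd_cone T))%E.
Proof.
move=> /and3P[_ _ v0].
have st : -1 <= signed_tau x <= 1.
  by rewrite /signed_tau; case: (x.2) => /=; rewrite ?expr1 ?expr0 ?mulN1r ?mul1r;
    apply/andP; split; move: tau0 tau1; lra.
have [s1 k0 le] := deviation_rate N0 st.
have s2 : signed_tau x ^+ 2 = tau ^+ 2.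
  by rewrite /signed_tau exprMn sqrr_sign mul1r.
apply: (le_trans (deviation_set_le N0 DE T_inj T_trace T_surj v0 s1 k0)).
rewrite -s2; apply: lee_wpmul2r; first exact: measure_ge0.
by rewrite lee_fin.
Qed.

(** Let r be the height and A the traceless part. Outside all deviation sets |A[v]| <= tau r on the
    net, hence |A[u]| <= 2 tau r |u|^2 on product vectors, and r |u|^2 + A[u] / (2 tau) >= 0. *)
Lemma psd_cone_cover t : psd_cone T t ->
  dilated_cone (2 * tau) t \/ exists2 x, net_ok x & net_deviation x t.
Proof.
move=> tp; have [h|h] := pselect (exists2 x, net_ok x & net_deviation x t).
  by right.
left; have [t01 tpsd] := tp; split=> // z w.
pose r := tnth t ord0; have r0 : 0 <= r by case/andP: t01.
pose A := T (\row_i (tuple_row t) 0 (lift ord0 i)).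
have BE u : qf (cone_coord T (tuple_row t)) u = r * sqn u + qf A u.
  by rewrite /cone_coord qfD qfZ qf1 mxE.
have netA f g : in_net f -> in_net g ->
    sqn (net_vector etaz f) <= 1 -> sqn (net_vector etaw g) <= 1 ->
    `|qf A (tens (net_vector etaz f) (net_vector etaw g))| <= tau * r.
  move=> fn gn f1 g1; set v := tens _ _.
  have v1 : sqn v <= 1 by rewrite sqn_tens mulr_ile1 ?sqn_ge0.
  have [v0|v0] := eqVneq (sqn v) 0.
    rewrite (sqn0_eq0 v0) -(scale0r (0 : 'rV[C]_N)).
    rewrite -[0](rmorph0 (real_complex R)) qfZr expr0n mul0r normr0.
    by rewrite mulr_ge0 // ltW.
  have notdev b : ~ net_deviation (f, g, b) t.
    by move=> dev; apply: h; exists (f, g, b) => //; apply/and3P.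
  have sv := sqn_ge0 v.
  have trv : tau * r * sqn v <= tau * r by rewrite ler_piMr // mulr_ge0 // ltW.
  have dev (b : bool) (s := (-1) ^+ b * tau) :
      (2 * (s / 6) + (s / 6) ^+ 2) * (1 - s) * r * sqn v <
      (2 * (s / 6) + (s / 6) ^+ 2) * (r * sqn v + qf A v).
    rewrite -BE ltNge; apply/negP => le; case: (notdev b); split => //.
  exact: small_deviation tau0 tau1 trv (dev false) (dev true).
have tr0 : 0 <= tau * r by rewrite mulr_ge0 // ltW.
have := net_sup ez0 ew0 ez2 ew2 tr0 netA z w.
rewrite addr0 /cone_coord qfD qfZ qf1 sqn_tens [tuple_row t 0 ord0]mxE -/r.
rewrite /dilated_coord -/A qfZ ler_norml => /andP[hA _].
have k0 : 0 < 2 * tau by rewrite mulr_gt0.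
rewrite -(pmulr_rge0 _ k0) mulrDr mulrA [X in _ + X]mulrA divff ?gt_eqF // mul1r.
lra.
Qed.

(** The factor 4 pays for the two signs and for a total proportion of one half. *)
Hypothesis net_small :
  4 * (#|[pred f : lattice n | in_net f]|%:R * #|[pred g : lattice m | in_net g]|%:R)
    <= expR (N%:R * tau ^+ 2 / 6).

Lemma card_net_ok : (#|[pred x | net_ok x]| <=
  (#|[pred f : lattice n | in_net f]| * #|[pred g : lattice m | in_net g]|) * 2)%N.
Proof.
apply: card_signed_pairs => x /and3P[fn gn _]; exact/andP.
Qed.

(** By the union bound the deviation sets fill at most half of the cone; finiteness allows
    subtracting that half from both sides. *)
Lemma psd_cone_le : (mu D.+1 (psd_cone T) < +oo)%E ->
  (mu D.+1 (psd_cone T) <= 2%:E * mu D.+1 (dilated_cone (2 * tau)))%E.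
Proof.
move=> fin.
have k0 : 0 < 2 * tau by rewrite mulr_gt0.
have mP : measurable (psd_cone T) by exact: measurable_psd_cone.
have p0 : (0 <= mu D.+1 (psd_cone T))%E by exact: measure_ge0.
have e0 : (0 <= (expR (- (N%:R * tau ^+ 2 / 6)))%:E)%E by rewrite lee_fin expR_ge0.
have : (mu D.+1 (psd_cone T) <= mu D.+1 (dilated_cone (2 * tau)) +
    (#|[pred x | net_ok x]|%:R)%:E *
      ((expR (- (N%:R * tau ^+ 2 / 6)))%:E * mu D.+1 (psd_cone T)))%E :=
  measure_union_bound mP (measurable_dilated_cone _)
    (fun x => measurable_deviation_set _ _ _ _) psd_cone_cover mu_net_deviation
    (mule_ge0 e0 p0).
move: fin p0; case: (mu D.+1 (psd_cone T)) => [x| |] // _.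
have : (0 <= mu D.+1 (dilated_cone (2 * tau)))%E by exact: measure_ge0.
case: (mu D.+1 (dilated_cone (2 * tau))) => [y| |] //; last first.
  by move=> _ _ _; rewrite mulry gtr0_sg // mul1e leey.
rewrite -!EFinM -EFinD !lee_fin => y0 x0 h.
have small : #|[pred x | net_ok x]|%:R * expR (- (N%:R * tau ^+ 2 / 6)) <= 2^-1 :> R.
  rewrite expRN ler_pdivrMr ?expR_gt0 //.
  have := card_net_ok; rewrite -(ler_nat R) !natrM => /le_trans; apply.
  by move: net_small; rewrite natrM; lra.
have := ler_wpM2r x0 small.
rewrite -[_ * _ * x]mulrA; move: h; set w := _%:R * (_ * x); clearbody w; lra.
Qed.

Lemma psd_section_le : (mu D psd_section < +oo)%E ->
  (mu D psd_section <=
   (2 * (2 * tau) ^+ D)%:E * mu D block_positive_section)%E.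
Proof.
move=> fin.
have k0 : 0 < 2 * tau by rewrite mulr_gt0.
have := cone_factor_gt0 D (R := R); have := cone_factor_lt_pinfty D (R := R).
have := psd_cone_le; rewrite lebesgue_psd_cone (lebesgue_dilated_cone k0).
case: (cone_factor (R:=R) D) => [c| |] // h _; rewrite lte_fin => c0.
have fin' : (c%:E * mu D psd_section < +oo)%E.
  by rewrite lte_mul_pinfty // lee_fin ltW.
have := h fin'; rewrite muleCA lee_pmul2l // ?lte_fin //.
by rewrite muleA -EFinM.
Qed.

End ratio.

(** The degenerate denominators follow the conventions of extended reals: p = +oo gives quotient 0,
    and p = 0 forces s = 0, with 0 times +oo equal to 0. *)
Lemma inve_quotient_lt (R : realFieldType) (s p : \bar R) (a b : R) :
  (0 <= s)%E -> (s <= p)%E -> ((p < +oo)%E -> (s <= a%:E * p)%E) ->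
  a < b -> 0 < b -> (s / p < b%:E)%E.
Proof.
case: p => [p| |] s0 sp h ab b0; last 2 first.
- by rewrite invey mule0 lte_fin.
- by have := le_trans s0 sp.
move: s0 sp (h (ltry p)); case: s {h} => [s| |] //.
rewrite -EFinM !lee_fin => s0 sp sa; rewrite inver; case: eqP => [p0|/eqP p0].
  by have -> : s = 0 by [lra]; rewrite mul0e lte_fin.
have pp : 0 < p by rewrite lt_neqAle eq_sym p0 (le_trans s0 sp).
by rewrite -EFinM lte_fin ltr_pdivrMr // (le_lt_trans sa) // ltr_pM2r.
Qed.

(** * Numerical constants and conclusion *)

Section constants.
Context {R : realType}.

Lemma constC_gt0 F : 0 < constC R F.
Proof. by rewrite /constC divr_gt0 ?mulr_gt0 ?exprn_gt0 ?powR_gt0. Qed.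

(** The value 2^20 serves twice: as the threshold on min(n, m) below which the bound is trivial, and
    as a majorant of (4 tau)^2 min(n, m) = 2^19 above it. *)
Lemma constC_complex_gt : 1024 * 1024 < constC R GroundC.
Proof.
have p1 : 1 <= (10 : R) `^ (4 / 9).
  by rewrite -[leLHS](powRr0 10); apply: ler_powR; [lra|rewrite divr_ge0].
rewrite /constC /= ltr_pdivlMr ?exprn_gt0 //.
have -> : (2 : R) ^+ (28 - 2) = 1024 * 1024 * 64.
  have -> : (1024 : R) = 2 ^+ 10 by ring.
  have -> : (64 : R) = 2 ^+ 6 by ring.
  by rewrite -!exprD.
have -> : (3 : R) ^+ 5 = 243 by ring.
have -> : (5 : R) ^+ 4 = 625 by ring.
lra.
Qed.

Lemma min_sub_half_gt0 (n m : nat) : (3 <= n)%N -> (3 <= m)%N ->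
  0 < (minn n m)%:R - 2^-1 :> R.
Proof.
move=> n3 m3; have : (1 : R) <= (minn n m)%:R.
  by rewrite ler1n leq_min; apply/andP; split; lia.
lra.
Qed.

Lemma powR_half (x : R) D : 0 <= x -> (x ^+ 2) `^ (D%:R / 2) = x ^+ D.
Proof.
move=> x0; rewrite -powR_mulrn // -powRrM mulrC divfK // powR_mulrn //.
Qed.

(** The left side is at most 2^(1026 * 5 max(n, m)), and 2 <= e. Since 6 * 5130 = 30780 < 2^15, this
    explains the constant 1024 * 32. *)
Lemma card_nets_le (n m : nat) : (0 < n)%N -> (0 < m)%N ->
  4 * (#|[pred f : lattice n | in_net f]|%:R * #|[pred g : lattice m | in_net g]|%:R)
    <= expR ((maxn n m)%:R * (1024 * 32) / 6) :> R.
Proof.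
move=> n0 m0; set mx := maxn n m.
pose A : R := 2 ^+ 1026.
have e1 : 2 <= expR (1 : R) by have := expR_ge1Dx (1 : R); lra.
have A4 : 4 <= A.
  rewrite (_ : 4 = 2 ^+ 2); last by ring.
  by rewrite ler_eXn2l //; lra.
have A1 : 1 <= A by lra.
have A0 : 0 <= A by lra.
apply: (@le_trans _ _ (A ^+ (5 * mx))).
  apply: (@le_trans _ _ (A ^+ (1 + ((n + n) + (m + m))))).
    rewrite exprD expr1 exprD; apply: ler_pM => //.
    by apply: ler_pM => //; exact: card_net.
  rewrite ler_weXn2l // /mx; have := leq_maxl n m; have := leq_maxr n m; lia.
apply: (@le_trans _ _ (expR 1026 ^+ (5 * mx))).
  rewrite lerXn2r ?nnegrE ?expR_ge0 // /A.
  rewrite -[X in expR X]mulr1 expRM_natl.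
  by rewrite lerXn2r ?nnegrE ?expR_ge0.
rewrite -expRM_natl ler_expR natrM.
have : 0 <= mx%:R :> R by [].
move: (mx%:R) => x; lra.
Qed.

End constants.

Lemma completely_positive_ratio_lt (R : realType) (n m : nat)
    (iota : {linear 'rV[R]_(dimM GroundC n m) -> mpoly (nvars n m) R}) :
  (3 <= n)%N -> (3 <= m)%N ->
  linear_isometry_onto (@mean_zero R n m GroundC) iota ->
  (prob_cp GroundC iota <
   ((constC R GroundC / ((minn n m)%:R - 2^-1)) `^
      ((dimM GroundC n m)%:R / 2))%:E)%E.
Proof.
move=> n3 m3; have n0 : (0 < n)%N by lia. have m0 : (0 < m)%N by lia.
move: iota; set D := dimM _ _ _ => iota /(isometry_matrix_coordinates n0 m0)[T Tc].
have DE : D.+1 = (n * m * (n * m))%N.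
  rewrite /D /= -expnMn mulnn subn1 prednK //.
  by rewrite expn_gt0 muln_gt0 n0 m0.
have D0 : (0 < D)%N.
  by rewrite -ltnS DE; have : (3 * 3 <= n * m)%N by [exact: leq_mul]; nia.
have Tsurj X : \tr X = 0 -> exists v, T v = X by apply: (coord_surj Tc).
rewrite /prob_cp /Vol !(section_of_matrix n0 m0 _ Tc).
have -> : [set t : D.-tuple R | real_model (@SosF R n m GroundC)
    (herm_poly (T (tuple_row t) + 1%:M))] = psd_section T.
  by apply/seteqP; split => t /real_model_SosC.
have -> : [set t : D.-tuple R | real_model (@positive_maps R n m GroundC)
    (herm_poly (T (tuple_row t) + 1%:M))] = block_positive_section T.
  by apply/seteqP; split => t /real_model_PosC.
have SP : (lebesgue_tuple R D (psd_section T) <=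
    lebesgue_tuple R D (block_positive_section T))%E.
  apply: le_measure; rewrite ?inE; last exact: psd_block_positive.
    exact: measurable_psd_section.
  exact: measurable_block_positive_section.
have h0 := min_sub_half_gt0 n3 m3 : 0 < (minn n m)%:R - 2^-1 :> R.
have C0 := constC_complex_gt : 1024 * 1024 < constC R GroundC.
have D2 : 0 < D%:R / 2 :> R by rewrite divr_gt0 ?ltr0n.
have b0 : 0 < constC R GroundC / ((minn n m)%:R - 2^-1).
  by rewrite divr_gt0 // constC_gt0.
(* Below the threshold the base C / (min(n, m) - 1/2) exceeds 1, while the ratio is at most 1 by
   inclusion. *)
have [small|large] := ltP ((minn n m)%:R : R) (1024 * 1024).
  apply: (inve_quotient_lt (a := 1)) => //.
  - by rewrite mul1e.
  - have := @gt0_ltr_powR R _ D2 1 (constC R GroundC / ((minn n m)%:R - 2^-1)).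
    rewrite powR1; apply; rewrite ?nnegrE ?ltW //.
    by rewrite ltr_pdivlMr // mul1r; move: small C0; lra.
  - exact: powR_gt0.
pose mn := (minn n m)%:R : R.
have mn0 : 0 < mn by rewrite /mn; lra.
(* With this choice n m tau^2 / 6 exceeds the logarithm of the number of net
   points. *)
pose tau := Num.sqrt (1024 * 32 / mn).
have K0 : 0 < 1024 * 32 / mn by apply: divr_gt0 mn0; lra.
have tau2 : tau ^+ 2 = 1024 * 32 / mn by apply: sqr_sqrtr; exact: ltW.
have tau0 : 0 < tau by rewrite sqrtr_gt0.
have tau1 : tau <= 1.
  rewrite -(@expr_le1 _ 2) ?(ltW tau0) // tau2.
  by rewrite ler_pdivrMr // mul1r; rewrite /mn; lra.
have scale (x : R) : 0 < x -> exists2 e : R, 0 < e & e ^+ 2 * x = 1.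
  move=> x0; exists (Num.sqrt x^-1); first by rewrite sqrtr_gt0 invr_gt0.
  by rewrite sqr_sqrtr ?mulVf ?gt_eqF // invr_ge0 ltW.
have eta k : (0 < k)%N -> exists2 e : R, 0 < e & e ^+ 2 * (1024 * (k + k))%:R = 1.
  by move=> k0; apply: scale; rewrite ltr0n muln_gt0 addn_gt0 k0.
have [etaz ez0 ez2] := eta n n0; have [etaw ew0 ew2] := eta m m0.
have small : 4 * (#|[pred f : lattice n | in_net f]|%:R *
    #|[pred g : lattice m | in_net g]|%:R) <= expR ((n * m)%:R * tau ^+ 2 / 6).
  apply: le_trans (card_nets_le n0 m0) _; rewrite ler_expR ler_pM2r // tau2.
  have -> : (n * m = maxn n m * minn n m)%N.
    by rewrite /maxn /minn; case: ltnP => // _; rewrite mulnC.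
  rewrite natrM -[X in _ <= X]mulrA ler_pM2l; last first.
    by rewrite ltr0n leq_max n0.
  by rewrite -/mn [mn * _]mulrC divfK // gt_eqF.
have le := psd_section_le n0 m0 DE (coord_inj Tc) (coord_trace Tc) Tsurj
  tau0 tau1 ez0 ew0 ez2 ew2 small.
(* As D >= 1, the factor 2 is absorbed by 2 (2 tau)^D <= (4 tau)^D, and (4 tau)^2 = 2^19 / min(n, m)
   lies below the base of the bound. *)
apply: (inve_quotient_lt (a := (4 * tau) ^+ D)) => //.
- move=> fin; apply: le_trans (le (le_lt_trans SP fin)) _.
  apply: lee_wpmul2r; first exact: measure_ge0.
  rewrite lee_fin (_ : 4 * tau = 2 * (2 * tau)); last by ring.
  rewrite [leRHS]exprMn ler_pM2r ?exprn_gt0 ?mulr_gt0 //.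
  by rewrite -[leLHS]expr1; apply: ler_weXn2l => //; rewrite ler1n.
- rewrite -powR_half; last by rewrite mulr_ge0 // ltW.
  apply: gt0_ltr_powR; rewrite ?nnegrE ?sqr_ge0 ?ltW //.
  have -> : (4 * tau) ^+ 2 = 1024 * 512 / mn by rewrite exprMn tau2; ring.
  rewrite ltr_pdivlMr // mulrAC ltr_pdivrMr //.
  by have := C0; rewrite -(ltr_pM2r mn0); move: mn0; rewrite -/mn; lra.
- exact: powR_gt0.
Qed.

Theorem theorem1p10 (R : realType) (F : ground_field) (n m : nat)
    (hn : (3 <= n)%N) (hm : (3 <= m)%N) :
  has_dimension (@mean_zero R n m F) (dimM F n m) /\
  forall iota : {linear 'rV[R]_(dimM F n m) -> mpoly (nvars n m) R},
    linear_isometry_onto (@mean_zero R n m F) iota ->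
    (prob_cp F iota <
     ((constC R F / ((minn n m)%:R - 2^-1)) `^ ((dimM F n m)%:R / 2))%:E)%E.
Proof.
have n0 : (0 < n)%N by exact: leq_trans hn.
have m0 : (0 < m)%N by exact: leq_trans hm.
split; first exact: has_dimension_mean_zero.
case: F => iota h; last exact: completely_positive_ratio_lt.
(* The inverse of +oo is 0, so the quotient is 0 whatever the numerator, and the bound is
   positive. *)
rewrite /prob_cp (Vol_positive_real (ltnW hn) (ltnW hm) h) invey mule0 lte_fin.
by rewrite powR_gt0 // divr_gt0 ?constC_gt0 // min_sub_half_gt0.
Qed.
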